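(* Let $(N^{m+1},h,Z)$ be a lightlike manifold with $m\ge3$ and assume that $A_Z=\mathrm{Id}$. Then there exists, up to isomorphism, at most one lightlike extension vector bundle $(\mathcal T,\mathbf h,\nabla^{\mathcal T},\xi)$ for $(N,h,Z)$ satisfying the following conditions: (1) $R^{\mathcal T}(V,W)\xi$ is collinear with $\xi$ for every $V,W\in\mathfrak X(N)$. (2) $R^{\mathcal T}(Z,V)\Phi(W)$ is collinear with $\xi$ for every $V,W\in\mathfrak X(N)$. (3) The Ricci-type contraction of $\mathcal W\in\Gamma(\Lambda^2\mathcal E^*\otimes L(\mathcal E,\mathcal E))$ vanishes. Moreover, such a lightlike extension vector bundle exists if and only if for every $\tau\in S(N,h,Z)$ the equation $$h(X,Y)\,D^\tau(Z)-h(Y,D^\tau(Z))\,X=R^\tau(Z,X)Y\qquad\text{for all }X,Y\in\Gamma(\mathrm{An}(\tau))$$ is solvable for the unknown $D^\tau(Z)\in\Gamma(\mathrm{An}(\tau))$, where $R^\tau$ is the curvature of the metric connection $\nabla^\tau$ on $\mathrm{An}(\tau)$ determined by $(N,h,Z)$ and $\tau$ (see context).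
   Context: Manifolds are smooth, Hausdorff, connected, second countable. A lightlike manifold $(N^{m+1},h,Z)$ is an $(m+1)$-dimensional manifold with a symmetric positive semidefinite $(0,2)$-tensor $h$ whose radical $\mathrm{Rad}(h)=\{v:h(v,\cdot)=0\}$ is one-dimensional at each point and a vector field $Z$ spanning it everywhere. Put $\mathcal E=TN/\mathrm{Rad}(h)$, with the positive definite metric (also denoted $h$) $h([V],[W])=h(V,W)$. The endomorphism $A_Z:\mathcal E\to\mathcal E$ is defined by $(\mathcal L_Zh)(V,W)=2h(A_Z[V],[W])$; so $A_Z=\mathrm{Id}$ means $\mathcal L_Zh=2h$. $S(N,h,Z)=\{\tau\in\Omega^1(N,\mathbb R):\tau(Z)=1\}$, $\mathrm{An}(\tau)=\ker\tau\subset TN$, $P^\tau(v)=v-\tau(v)Z$. When $A_Z=\mathrm{Id}$, for each $\tau$ there is a unique metric linear connection $\nabla^\tau$ on $(\mathrm{An}(\tau)\to N,h)$ such that $\nabla^\tau_ZX=X+P^\tau([Z,X])$ and $\nabla^\tau_XY-\nabla^\tau_YX-P^\tau([X,Y])=0$ for all $X,Y\in\Gamma(\mathrm{An}(\tau))$; $R^\tau(V,W)X=\nabla^\tau_V\nabla^\tau_WX-\nabla^\tau_W\nabla^\tau_VX-\nabla^\tau_{[V,W]}X$. A lightlike extension vector bundle over $N$ is a quadruple $(\mathcal T,\mathbf h,\nabla^{\mathcal T},\xi)$: a real vector bundle $\mathcal T\to N$ of rank $m+2$ with a bundle metric $\mathbf h$ of Lorentzian signature, a linear connection $\nabla^{\mathcal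 T}$ with $\nabla^{\mathcal T}\mathbf h=0$, and a lightlike section $\xi$ such that $\Phi(W):=\nabla^{\mathcal T}_W\xi$ defines a vector bundle monomorphism $\Phi:TN\to\mathcal T$. Then $\Phi(TN)=\xi^\perp$. It is said to be for $(N,h,Z)$ if $h(V,W)=\mathbf h(\Phi(V),\Phi(W))$ and $\Phi(Z)=\xi$. Isomorphisms of such quadruples are vector bundle isomorphisms over $\mathrm{id}_N$ preserving metric, connection and distinguished section. $R^{\mathcal T}(V,W)T=\nabla^{\mathcal T}_V\nabla^{\mathcal T}_WT-\nabla^{\mathcal T}_W\nabla^{\mathcal T}_VT-\nabla^{\mathcal T}_{[V,W]}T$. ''Collinear with $\xi$'' means equal to $f\xi$ for some function $f$ on $N$ (possibly zero). Under conditions (1) and (2), $\mathcal W([U],[V])[W]:=[\Phi^{-1}(R^{\mathcal T}(U,V)\Phi(W))]$ is a well-defined section of $\Lambda^2\mathcal E^*\otimes L(\mathcal E,\mathcal E)$; its Ricci-type contraction is $([V],[W])\mapsto\mathrm{trace}\big([U]\mapsto\mathcal W([U],[V])[W]\big)$. *)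

(* Defs.v *)
From HB Require Import structures.
From mathcomp Require Import all_boot all_order all_algebra.
From mathcomp Require Import generic_quotient ring_quotient ring.
From mathcomp Require Import all_classical all_reals all_analysis.
Set Implicit Arguments.
Unset Strict Implicit.
Unset Printing Implicit Defensive.
Import Order.TTheory GRing.Theory Num.Theory.
Import numFieldNormedType.Exports.
Local Open Scope classical_set_scope.
Local Open Scope ring_scope.

Section Cn.
Context {R : realType} {n : nat}.
Implicit Types (U : set 'rV[R]_n) (f g : 'rV[R]_n -> R^o).

(* C^k on an open set [U]; the values of [f] off [U] are irrelevant. *)
Fixpoint Ck (k : nat) U f : Prop :=
  (forall x, U x -> {for x, continuous f}) /\
  (if k is k'.+1 then
     forall i : 'I_n, (forall x, U x -> derivable f x (delta_mx 0 i))
                      /\ Ck k' U ('D_(delta_mx 0 i) f)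
   else True).

Definition csmooth U f := forall k, Ck k U f.

Lemma Ck_cont k U f : Ck k U f -> forall x, U x -> {for x, continuous f}.
Proof. by case: k => [|k] []. Qed.

Lemma CkW k U f : Ck k.+1 U f -> Ck k U f.
Proof.
elim: k f => [|k IH] f [cf df]; first by split.
by split=> // i; have [d1 d2] := df i; split=> //; exact: IH.
Qed.

Lemma Ck_ext k U f g : open U -> {in U, f =1 g} -> Ck k U f -> Ck k U g.
Proof.
move=> oU.
have nfg (u v : 'rV[R]_n -> R^o) x : {in U, u =1 v} -> U x ->
    \near x, u x = v x.
  move=> uv Ux; have : nbhs x U by exact: open_nbhs_nbhs.
  by apply: filterS => y /mem_set/uv.
elim: k f g => [|k IH] f g fg [cf df].
all: have cg x : U x -> {for x, continuous g}.
1,3: move=> Ux; have /near_eq_cvg h := nfg _ _ x fg Ux.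
1,2: rewrite /prop_for /continuous_at -(fg x (mem_set Ux)).
1,2: exact: cvg_trans h (cf x Ux).
  by split.
split=> // i; have [d1 d2] := df i; split.
  by move=> x Ux; exact: (near_eq_derivable (nfg _ _ x fg Ux) (d1 x Ux)).
by apply: IH d2 => x /set_mem Ux; exact: near_eq_derive (nfg _ _ x fg Ux).
Qed.

Lemma Ck_cst k U (a : R) : Ck k U (fun=> a).
Proof.
elim: k a => [|k IH] a; first by split=> [x _|] //; exact: cst_continuous.
split=> [x _|i]; first exact: cst_continuous.
split=> // .
rewrite (_ : 'D_ _ _ = fun=> 0)//.
by apply/funext => x; exact: derive_cst.
Qed.

Lemma Ck_add k U f g : open U -> Ck k U f -> Ck k U g -> Ck k U (f \+ g).
Proof.
move=> oU; elim: k f g => [|k IH] f g [cf df] [cg dg].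
  by split=> // x Ux; apply: continuousD; [exact: cf | exact: cg].
split=> [x Ux|i]; first by apply: continuousD; [exact: cf | exact: cg].
have [df1 df2] := df i; have [dg1 dg2] := dg i; split=> [x Ux|].
  by apply: derivableD; [exact: df1 | exact: dg1].
apply: Ck_ext oU _ (IH _ _ df2 dg2) => x /set_mem Ux /=.
by rewrite deriveD //; [exact: df1 | exact: dg1].
Qed.

Lemma Ck_mul k U f g : open U -> Ck k U f -> Ck k U g -> Ck k U (f \* g).
Proof.
move=> oU; elim: k f g => [|k IH] f g Hf Hg.
  by split=> // x Ux; apply: continuousM; [exact: Ck_cont Hf _ _ | exact: Ck_cont Hg _ _].
split=> [x Ux|i].
  by apply: continuousM; [exact: Ck_cont Hf _ _ | exact: Ck_cont Hg _ _].
have [df1 df2] := Hf.2 i; have [dg1 dg2] := Hg.2 i; split=> [x Ux|].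
  by apply: derivableM; [exact: df1 | exact: dg1].
have H1 := IH _ _ (CkW Hf) dg2; have H2 := IH _ _ (CkW Hg) df2.
apply: Ck_ext oU _ (Ck_add oU H1 H2) => x /set_mem Ux /=.
by rewrite deriveM //; [exact: df1 | exact: dg1].
Qed.

End Cn.

(* [param] is the inverse of the chart map; only its values on the open image
   of [cdom] matter. *)
Record chart (R : realType) (n : nat) (M : topologicalType) := Chart {
  cdom : set M;
  coord : M -> 'rV[R]_n;
  param : 'rV[R]_n -> M;
  cdom_open : open cdom;
  crange_open : open (coord @` cdom);
  paramK : forall p, cdom p -> param (coord p) = p;
  coord_cont : forall p, cdom p -> {for p, continuous coord};
  param_cont : forall x, (coord @` cdom) x -> {for x, continuous param}
}.

Record manifold (R : realType) (n : nat) := Manifold {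
  msort :> topologicalType;
  m_hausdorff : hausdorff_space msort;
  m_connected : connected [set: msort];
  m_second_countable : @second_countable msort;
  atlas : set (chart R n msort);
  atlas_cover : forall p : msort, exists2 c, atlas c & cdom c p;
  atlas_compat : forall c c', atlas c -> atlas c' -> forall i : 'I_n,
    csmooth (coord c @` (cdom c `&` cdom c'))
            (fun x => coord c' (param c x) ord0 i)
}.

Section Smooth.
Context {R : realType} {n : nat} {M : manifold R n}.
Implicit Types (U : set M) (f g : M -> R).

Definition smooth_on U f := forall c, atlas c ->
  csmooth (coord c @` (cdom c `&` U)) (f \o param c).

Lemma open_coord (c : chart R n M) U : open U ->
  open (coord c @` (cdom c `&` U)).
Proof.
move=> oU.
rewrite (_ : _ @` _ = (coord c @` cdom c) `&` (param c @^-1` U)); last first.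
  apply/seteqP; split=> x.
    by move=> [p [cp Up] <-]; split; [exists p | rewrite /= paramK].
  by move=> [[p cp <-]]; rewrite /= paramK // => Up; exists p.
rewrite openE => x [cx Ux]; apply: filterI.
  by apply: open_nbhs_nbhs; split=> //; exact: crange_open.
by apply: (param_cont cx); apply: open_nbhs_nbhs.
Qed.

Lemma smooth_on_cst U (a : R) : smooth_on U (fun=> a).
Proof. by move=> c _ k; exact: Ck_cst. Qed.

Lemma smooth_on_add U f g : open U ->
  smooth_on U f -> smooth_on U g -> smooth_on U (fun p => f p + g p).
Proof.
move=> oU sf sg c ac k.
exact: (Ck_add (open_coord oU) (sf c ac k) (sg c ac k)).
Qed.

Lemma smooth_on_mul U f g : open U ->
  smooth_on U f -> smooth_on U g -> smooth_on U (fun p => f p * g p).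
Proof.
move=> oU sf sg c ac k.
exact: (Ck_mul (open_coord oU) (sf c ac k) (sg c ac k)).
Qed.

Lemma smooth_on_opp U f : open U ->
  smooth_on U f -> smooth_on U (fun p => - f p).
Proof.
move=> oU sf; rewrite (_ : (fun p => _) = (fun p => -1 * f p)).
  by apply: smooth_on_mul => //; exact: smooth_on_cst.
by apply/funext => p; rewrite mulN1r.
Qed.

Lemma smooth_onS U U' f : open U -> open U' -> U' `<=` U -> smooth_on U f ->
  smooth_on U' f.
Proof.
move=> oU oU' UU' sf c ac k.
have sub : coord c @` (cdom c `&` U') `<=` coord c @` (cdom c `&` U).
  by apply: image_subset => p [cp /UU'].
move: (sf c ac k); move: (f \o param c).
elim: k => [|k IH] g [cg dg]; split=> //; first by move=> x /sub/cg.
  by move=> x /sub/cg.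
move=> i; have [d1 d2] := dg i; split; first by move=> x /sub/d1.
exact: IH.
Qed.

Definition smooth f := smooth_on setT f.

End Smooth.

Section Cinf_ring.
Context {R : realType} {n : nat} (M : manifold R n).

Definition smooth_pred : {pred M -> R} := fun f => `[< smooth f >].

Fact smooth_subring : subring_closed smooth_pred.
Proof.
split=> [|f g /asboolP sf /asboolP sg|f g /asboolP sf /asboolP sg];
  apply/asboolP.
- exact: smooth_on_cst.
- apply: (smooth_on_add openT sf (smooth_on_opp openT sg)).
- exact: (smooth_on_mul openT sf sg).
Qed.
HB.instance Definition _ := GRing.isSubringClosed.Build (M -> R) smooth_pred
  smooth_subring.

Record Cinf := CInf { Cinf_fun :> M -> R; _ : Cinf_fun \in smooth_pred }.

HB.instance Definition _ := [isSub for Cinf_fun].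
HB.instance Definition _ := [Choice of Cinf by <:].
HB.instance Definition _ := GRing.SubChoice_isSubComPzRing.Build (M -> R)
  smooth_pred Cinf smooth_subring.

Lemma Cinf_smooth (f : Cinf) : smooth f.
Proof. exact: (asboolP _ (valP f)). Qed.

Definition mkCinf (f : M -> R) (sf : smooth f) : Cinf := CInf (asboolT sf).

Definition Cinf_scale (a : R) (f : Cinf) : Cinf :=
  mkCinf (smooth_on_cst setT a) * f.

Fact Cinf_scaleA a b f :
  Cinf_scale a (Cinf_scale b f) = Cinf_scale (a * b) f.
Proof. by rewrite /Cinf_scale mulrA; congr (_ * _); exact: val_inj. Qed.
Fact Cinf_scale1 : left_id 1 Cinf_scale.
Proof.
by move=> f; rewrite -[RHS]mul1r; congr (_ * _); exact: val_inj.
Qed.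
Fact Cinf_scaleDr : right_distributive Cinf_scale +%R.
Proof. by move=> a f g; exact: mulrDr. Qed.
Fact Cinf_scaleDl f : {morph Cinf_scale^~ f : a b / a + b}.
Proof.
by move=> a b; rewrite /Cinf_scale -mulrDl; congr (_ * _); exact: val_inj.
Qed.
HB.instance Definition _ := GRing.Zmodule_isLmodule.Build R Cinf
  Cinf_scaleA Cinf_scale1 Cinf_scaleDr Cinf_scaleDl.

End Cinf_ring.

Section Tangent.
Context {R : realType} {n : nat} (M : manifold R n).

(* Tangent vectors at [p] are the derivations at [p] of C^oo(M), and vector
   fields are the derivations of C^oo(M); [vf_at X p] is the value of [X] at
   [p].  A family of derivations at the points of [M] is a smooth vector field
   exactly when it maps smooth functions to smooth functions, so this is the
   module of smooth sections of the tangent bundle. *)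
Definition point_deriv_pred (p : M) : {pred Cinf M -> R} := fun v =>
  `[< (forall a f g, v (a *: f + g) = a * v f + v g) /\
      (forall f g, v (f * g) = f p * v g + g p * v f) >].

Fact point_deriv_zmod p : zmod_closed (point_deriv_pred p).
Proof.
split=> [|u v /asboolP[lu du] /asboolP[lv dv]]; apply/asboolP; split.
- by move=> a f g; rewrite [LHS]/= mulr0 addr0.
- by move=> f g; rewrite !mulr0 addr0.
- move=> b f g; rewrite !fctE lu lv; ring.
- move=> f g; rewrite !fctE du dv; ring.
Qed.
HB.instance Definition _ p := GRing.isZmodClosed.Build (Cinf M -> R)
  (point_deriv_pred p) (point_deriv_zmod p).

Record Tan (p : M) := MkTan {
  Tan_fun :> Cinf M -> R;
  _ : Tan_fun \in point_deriv_pred p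
}.
HB.instance Definition _ p := [isSub for @Tan_fun p].
HB.instance Definition _ p := [Choice of Tan p by <:].
HB.instance Definition _ p := [SubChoice_isSubZmodule of Tan p by <:].

Lemma TanP p (v w : Tan p) : (forall f, v f = w f) -> v = w.
Proof. by move=> vw; apply: val_inj; exact/funext. Qed.

Lemma Tan_linear p (v : Tan p) a f g : v (a *: f + g) = a * v f + v g.
Proof. by have /asboolP[h _] := valP v; exact: h. Qed.

Lemma Tan_leibniz p (v : Tan p) f g : v (f * g) = f p * v g + g p * v f.
Proof. by have /asboolP[_ h] := valP v; exact: h. Qed.

Fact TanZ_subproof p a (v : Tan p) : (fun f => a * v f) \in point_deriv_pred p.
Proof.
apply/asboolP; split=> [b f g|f g]; rewrite (Tan_linear, Tan_leibniz); ring.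
Qed.
Definition TanZ p a (v : Tan p) : Tan p := MkTan (TanZ_subproof a v).

Fact TanZA p a b (v : Tan p) : TanZ a (TanZ b v) = TanZ (a * b) v.
Proof. by apply: TanP => f; exact: mulrA. Qed.
Fact TanZ1 p : left_id 1 (@TanZ p).
Proof. by move=> v; apply: TanP => f; exact: mul1r. Qed.
Fact TanZDr p : right_distributive (@TanZ p) +%R.
Proof. by move=> a v w; apply: TanP => f; exact: mulrDr. Qed.
Fact TanZDl p v : {morph (@TanZ p)^~ v : a b / a + b}.
Proof. by move=> a b; apply: TanP => f; exact: mulrDl. Qed.
HB.instance Definition _ p := GRing.Zmodule_isLmodule.Build R (Tan p)
  (@TanZA p) (@TanZ1 p) (@TanZDr p) (@TanZDl p).

Definition deriv_pred : {pred Cinf M -> Cinf M} := fun X =>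
  `[< (forall (a : R) f g, X (a *: f + g) = a *: X f + X g) /\
      (forall f g, X (f * g) = f * X g + g * X f) >].

Fact deriv_zmod : zmod_closed deriv_pred.
Proof.
split=> [|u v /asboolP[lu du] /asboolP[lv dv]]; apply/asboolP; split.
- by move=> a f g; rewrite [LHS]/= scaler0 addr0.
- by move=> f g; rewrite !mulr0 addr0.
- by move=> b f g; rewrite !fctE lu lv scalerBr addrACA opprD.
- move=> f g; rewrite !fctE du dv; ring.
Qed.
HB.instance Definition _ := GRing.isZmodClosed.Build (Cinf M -> Cinf M)
  deriv_pred deriv_zmod.

Record vfield := MkVfield {
  vfield_fun :> Cinf M -> Cinf M;
  _ : vfield_fun \in deriv_pred
}.
HB.instance Definition _ := [isSub for vfield_fun].
HB.instance Definition _ := [Choice of vfield by <:].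
HB.instance Definition _ := [SubChoice_isSubZmodule of vfield by <:].

Lemma vfieldP (X Y : vfield) : (forall f, X f = Y f) -> X = Y.
Proof. by move=> XY; apply: val_inj; exact/funext. Qed.

Lemma vfield_linear (X : vfield) (a : R) f g :
  X (a *: f + g) = a *: X f + X g.
Proof. by have /asboolP[h _] := valP X; exact: h. Qed.

Lemma vfieldD (X : vfield) f g : X (f + g) = X f + X g.
Proof. by have := vfield_linear X 1 f g; rewrite !scale1r. Qed.

Lemma vfield_leibniz (X : vfield) f g : X (f * g) = f * X g + g * X f.
Proof. by have /asboolP[_ h] := valP X; exact: h. Qed.

Lemma Cinf_scaleAr (a : R) (f g : Cinf M) : a *: (f * g) = f * (a *: g).
Proof. exact: mulrCA. Qed.

Fact vfieldZ_subproof (f : Cinf M) (X : vfield) :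
  (fun g => f * X g) \in deriv_pred.
Proof.
apply/asboolP; split=> [b g k|g k].
  by rewrite vfield_linear mulrDr Cinf_scaleAr.
by rewrite vfield_leibniz; ring.
Qed.
Definition vfieldZ f X : vfield := MkVfield (vfieldZ_subproof f X).

Fact vfieldZA f g X : vfieldZ f (vfieldZ g X) = vfieldZ (f * g) X.
Proof. by apply: vfieldP => k; exact: mulrA. Qed.
Fact vfieldZ1 : left_id 1 vfieldZ.
Proof. by move=> X; apply: vfieldP => k; exact: mul1r. Qed.
Fact vfieldZDr : right_distributive vfieldZ +%R.
Proof. by move=> f X Y; apply: vfieldP => k; exact: mulrDr. Qed.
Fact vfieldZDl X : {morph vfieldZ^~ X : f g / f + g}.
Proof. by move=> f g; apply: vfieldP => k; exact: mulrDl. Qed.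
HB.instance Definition _ := GRing.Zmodule_isLmodule.Build (Cinf M) vfield
  vfieldZA vfieldZ1 vfieldZDr vfieldZDl.

Fact vf_at_subproof (X : vfield) (p : M) :
  (fun f => X f p) \in point_deriv_pred p.
Proof.
by apply/asboolP; split=> [a f g|f g];
  rewrite (vfield_linear, vfield_leibniz).
Qed.
Definition vf_at X p : Tan p := MkTan (vf_at_subproof X p).

Lemma vf_at_linear (f : Cinf M) X Y p :
  vf_at (f *: X + Y) p = f p *: vf_at X p + vf_at Y p.
Proof. exact: TanP. Qed.

Fact bracket_subproof (X Y : vfield) :
  (fun f => X (Y f) - Y (X f)) \in deriv_pred.
Proof.
apply/asboolP; split=> [a f g|f g].
  by rewrite !vfield_linear scalerBr addrACA opprD.
rewrite !vfield_leibniz !vfieldD !vfield_leibniz; ring.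
Qed.
Definition bracket X Y : vfield := MkVfield (bracket_subproof X Y).

End Tangent.

Arguments vf_at {R n M} X p.

(* The total space is given by its fibres, its local trivializations and their
   smooth transition matrices (acting on row vectors). *)
Record vbundle (R : realType) (n : nat) (M : manifold R n) (r : nat) :=
  VBundle {
  fib : M -> lmodType R;
  triv : Type;
  tdom : triv -> set M;
  tmap : forall (i : triv) (p : M), {linear fib p -> 'rV[R]_r};
  tdom_open : forall i, open (tdom i);
  tdom_cover : forall p, exists i, tdom i p;
  tmap_bij : forall i p, tdom i p -> bijective (tmap i p);
  tmap_trans : forall i j, exists g : M -> 'M[R]_r,
    (forall k l, smooth_on (tdom i `&` tdom j) (fun p => g p k l)) /\
    (forall p, tdom i p -> tdom j p ->
       forall x, tmap j p x = tmap i p x *m g p)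
}.

Section Sections.
Context {R : realType} {n : nat} {M : manifold R n} {r : nat}.
Variable T : vbundle M r.

Definition smooth_section_pred : {pred forall p, fib T p} := fun s =>
  `[< forall (i : triv T) (k : 'I_r),
        smooth_on (tdom i) (fun p => tmap i p (s p) ord0 k) >].

Record section := MkSection {
  section_fun :> forall p, fib T p;
  _ : section_fun \in smooth_section_pred
}.
HB.instance Definition _ := [isSub for section_fun].
HB.instance Definition _ := [Choice of section by <:].

Lemma sectionP (s t : section) : (forall p, s p = t p) -> s = t.
Proof. by move=> st; apply: val_inj; exact: functional_extensionality_dep. Qed.

Fact section0_subproof : (fun=> 0) \in smooth_section_pred.
Proof.
apply/asboolP => i k.
rewrite (_ : (fun p => _) = fun=> 0); first exact: smooth_on_cst.
by apply/funext => p; rewrite linear0 mxE.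
Qed.

Fact sectionD_subproof (s t : section) :
  (fun p => s p + t p) \in smooth_section_pred.
Proof.
apply/asboolP => i k; have /asboolP ss := valP s; have /asboolP st := valP t.
rewrite (_ : (fun p => _) =
    fun p => tmap i p (s p) ord0 k + tmap i p (t p) ord0 k).
  exact: (smooth_on_add (tdom_open i) (ss i k) (st i k)).
by apply/funext => p; rewrite linearD mxE.
Qed.

Fact sectionZ_subproof (f : Cinf M) (s : section) :
  (fun p => f p *: s p) \in smooth_section_pred.
Proof.
apply/asboolP => i k; have /asboolP ss := valP s.
rewrite (_ : (fun p => _) = fun p => f p * tmap i p (s p) ord0 k).
  apply: (smooth_on_mul (tdom_open i) _ (ss i k)).
  exact: (smooth_onS openT (tdom_open i) (@subsetT _ _) (Cinf_smooth f)).
by apply/funext => p; rewrite linearZ mxE.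
Qed.

Definition section0 := MkSection section0_subproof.
Definition sectionD s t := MkSection (sectionD_subproof s t).
Definition sectionZ f s := MkSection (sectionZ_subproof f s).

Fact sectionDA : associative sectionD.
Proof. by move=> s t u; apply: sectionP => p; exact: addrA. Qed.
Fact sectionDC : commutative sectionD.
Proof. by move=> s t; apply: sectionP => p; exact: addrC. Qed.
Fact section0D : left_id section0 sectionD.
Proof. by move=> s; apply: sectionP => p; exact: add0r. Qed.
Fact sectionND : left_inverse section0 (sectionZ (-1)) sectionD.
Proof.
by move=> s; apply: sectionP => p; rewrite /= scaleN1r addNr.
Qed.
HB.instance Definition _ := GRing.isZmodule.Build section
  sectionDA sectionDC section0D sectionND.

Fact sectionZA f g s : sectionZ f (sectionZ g s) = sectionZ (f * g) s.
Proof. by apply: sectionP => p; exact: scalerA. Qed.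
Fact sectionZ1 : left_id 1 sectionZ.
Proof. by move=> s; apply: sectionP => p; exact: scale1r. Qed.
Fact sectionZDr : right_distributive sectionZ +%R.
Proof. by move=> f s t; apply: sectionP => p; exact: scalerDr. Qed.
Fact sectionZDl s : {morph sectionZ^~ s : f g / f + g}.
Proof. by move=> f g; apply: sectionP => p; exact: scalerDl. Qed.
HB.instance Definition _ := GRing.Zmodule_isLmodule.Build (Cinf M) section
  sectionZA sectionZ1 sectionZDr sectionZDl.

End Sections.

(* [S] is the module of smooth sections of a vector bundle: [section T] for a
   [vbundle], or [An tau] below. *)
Section Connection.
Context {R : realType} {n : nat} {M : manifold R n} {S : lmodType (Cinf M)}.
Variable nabla : vfield M -> S -> S.

Definition is_connection : Prop :=
  [/\ forall (f : Cinf M) (V W : vfield M) s,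
        nabla (f *: V + W) s = f *: nabla V s + nabla W s,
      forall (V : vfield M) s t, nabla V (s + t) = nabla V s + nabla V t
    & forall (V : vfield M) (f : Cinf M) s,
         nabla V (f *: s) = V f *: s + f *: nabla V s].

Definition is_metric (g : S -> S -> Cinf M) : Prop :=
  forall (V : vfield M) s t, V (g s t) = g (nabla V s) t + g s (nabla V t).

Definition curvature V W s : S :=
  nabla V (nabla W s) - nabla W (nabla V s) - nabla (bracket V W) s.

End Connection.

(* A tensor field is smooth when its values on smooth vector fields are smooth;
   likewise for one-forms and bundle metrics below. *)
Record lightlike (R : realType) (n : nat) (N : manifold R n) := Lightlike {
  lh : forall p : N, Tan p -> Tan p -> R;
  lh_sym : forall p (v w : Tan p), lh v w = lh w v;
  lh_linear : forall p (v : Tan p), scalar (lh v);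
  lh_ge0 : forall p (v : Tan p), 0 <= lh v v;
  lh_smooth : forall V W : vfield N, smooth (fun p => lh (vf_at V p) (vf_at W p));
  lZ : vfield N;
  lZ_neq0 : forall p, vf_at lZ p != 0;
  lh_rad : forall p (v : Tan p),
    (forall w, lh v w = 0) <-> exists a, v = a *: vf_at lZ p
}.

(* Finite-dimensional spaces only: the relation is empty when [V] has no
   finite basis. *)
Definition is_basis (K : fieldType) (V : lmodType K) (k : nat) (b : 'I_k -> V) :=
  forall v, exists! c : 'I_k -> K, v = \sum_i c i *: b i.

Definition is_trace (K : fieldType) (V : lmodType K) (f : V -> V) (t : K) : Prop :=
  linear f /\
  exists k (b : 'I_k -> V) (A : 'M[K]_k),
    [/\ is_basis b, forall j, f (b j) = \sum_i A i j *: b i & t = \tr A].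

Section Screen.
Context {R : realType} {n : nat} {N : manifold R n} (L : lightlike N).

Definition rad_pred (p : N) : {pred Tan p} := fun v =>
  `[< forall w : Tan p, lh L v w = 0 >].

Lemma lhDl p (u v w : Tan p) : lh L (u + v) w = lh L u w + lh L v w.
Proof.
have := lh_linear L w 1 u v; rewrite scale1r => e.
by rewrite lh_sym e mul1r !(lh_sym L w).
Qed.

Lemma lhZl p a (v w : Tan p) : lh L (a *: v) w = a * lh L v w.
Proof.
have l0 : lh L w 0 = 0.
  have := lh_linear L w (-1) 0 0.
  by rewrite scaler0 addr0 mulN1r addNr.
by have := lh_linear L w a v 0; rewrite !addr0 l0 addr0 lh_sym (lh_sym L v).
Qed.

Fact rad_submod p : submod_closed (@rad_pred p).
Proof.
split=> [|a u v /asboolP ru /asboolP rv]; apply/asboolP => w.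
  by rewrite -(scale0r 0) lhZl mul0r.
by rewrite lhDl lhZl ru rv mulr0 addr0.
Qed.
HB.instance Definition _ p := GRing.isSubmodClosed.Build R (Tan p)
  (@rad_pred p) (@rad_submod p).

(* The fibre of E = TN / Rad(h). *)
Definition screen (p : N) := {ideal_quot (@rad_pred p)}.
HB.instance Definition _ p := GRing.Zmodule.on (screen p).
HB.instance Definition _ p :=
  EqQuotient.copy (screen p) {ideal_quot (@rad_pred p)}.

Definition cls (p : N) (v : Tan p) : screen p := \pi_(screen p)%qT v.

Lemma cls_repr p (x : screen p) : cls (repr x) = x.
Proof. exact: reprK. Qed.

Lemma cls_eq p (v w : Tan p) :
  cls v = cls w <-> forall u : Tan p, lh L (v - w) u = 0.
Proof.
have -> : (cls v = cls w) <-> (v - w \in @rad_pred p).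
  by rewrite Quotient.idealrBE; split=> [/eqP|/eqP].
by split=> [/asboolP|h]; [|apply/asboolP].
Qed.

Lemma clsD p (v w : Tan p) : cls (v + w) = cls v + cls w.
Proof. exact: (@Quotient.pi_add _ (@rad_pred p) v w). Qed.

Definition screenZ p (a : R) (x : screen p) : screen p := cls (a *: repr x).

Lemma clsZ p a (v : Tan p) : cls (a *: v) = screenZ a (cls v).
Proof.
apply/cls_eq => u; rewrite -scalerBr lhZl.
by move: ((cls_eq v (repr (cls v))).1 (esym (cls_repr _)) u) => ->; rewrite mulr0.
Qed.

Fact screenZA p a b (x : screen p) : screenZ a (screenZ b x) = screenZ (a * b) x.
Proof. by rewrite -[x]cls_repr -!clsZ scalerA. Qed.
Fact screenZ1 p : left_id 1 (@screenZ p).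
Proof. by move=> x; rewrite -[x]cls_repr -clsZ scale1r. Qed.
Fact screenZDr p : right_distributive (@screenZ p) +%R.
Proof.
move=> a x y; rewrite -[x]cls_repr -[y]cls_repr -clsD -!clsZ -clsD.
by rewrite scalerDr.
Qed.
Fact screenZDl p x : {morph (@screenZ p)^~ x : a b / a + b}.
Proof. by move=> a b; rewrite -[x]cls_repr -!clsZ -clsD scalerDl. Qed.
HB.instance Definition _ p := GRing.Zmodule_isLmodule.Build R (screen p)
  (@screenZA p) (@screenZ1 p) (@screenZDr p) (@screenZDl p).

Definition screen_metric p (x y : screen p) : R := lh L (repr x) (repr y).

Lemma screen_metricE p (v w : Tan p) :
  screen_metric (cls v) (cls w) = lh L v w.
Proof.
have h (u u' : Tan p) : lh L (repr (cls u)) u' = lh L u u'.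
  have := (cls_eq (repr (cls u)) u).1 (cls_repr _) u'.
  by rewrite lhDl -scaleN1r lhZl mulN1r => /subr0_eq.
by rewrite /screen_metric h lh_sym h lh_sym.
Qed.

(* h(V, W) as a smooth function. *)
Definition hfun (V W : vfield N) : Cinf N := mkCinf (lh_smooth L V W).

Definition lie_deriv (X V W : vfield N) : Cinf N :=
  X (hfun V W) - hfun (bracket X V) W - hfun V (bracket X W).

Definition is_shape_operator (A : forall p, {linear screen p -> screen p}) :=
  forall (V W : vfield N) p,
    lie_deriv (lZ L) V W p =
    2 * screen_metric (A p (cls (vf_at V p))) (cls (vf_at W p)).

End Screen.

Record one_form (R : realType) (n : nat) (N : manifold R n) := OneForm {
  form_fun :> forall p : N, Tan p -> R;
  form_linear : forall p, scalar (@form_fun p);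
  form_smooth : forall V : vfield N, smooth (fun p => form_fun (vf_at V p))
}.

(* S(N, h, Z). *)
Record SForm (R : realType) (n : nat) (N : manifold R n) (L : lightlike N) :=
  MkSForm {
  sform :> one_form N;
  sformZ : forall p, sform p (vf_at (lZ L) p) = 1
}.

Section Transversal.
Context {R : realType} {n : nat} {N : manifold R n} {L : lightlike N}.
Variable tau : SForm L.

Definition form_app (V : vfield N) : Cinf N := mkCinf (form_smooth tau V).

Definition An_pred : {pred vfield N} := fun X => `[< form_app X = 0 >].

Fact form_app_linear f V W :
  form_app (f *: V + W) = f * form_app V + form_app W.
Proof.
apply: val_inj; apply/funext => p /=; rewrite vf_at_linear.
exact: form_linear.
Qed.

Fact An_submod : submod_closed An_pred.
Proof.
split=> [|f X Y /asboolP hX /asboolP hY]; apply/asboolP.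
  by have := form_app_linear (-1) 0 0; rewrite scaler0 addr0 mulN1r addNr.
by rewrite form_app_linear hX hY mulr0 addr0.
Qed.
HB.instance Definition _ := GRing.isSubmodClosed.Build (Cinf N) (vfield N)
  An_pred An_submod.

(* The smooth sections of the bundle ker tau. *)
Record An := MkAn { An_val :> vfield N; _ : An_val \in An_pred }.
HB.instance Definition _ := [isSub for An_val].
HB.instance Definition _ := [Choice of An by <:].
HB.instance Definition _ := [SubChoice_isSubLmodule of An by <:].

Fact proj_subproof (V : vfield N) : V - form_app V *: lZ L \in An_pred.
Proof.
apply/asboolP; rewrite addrC -scaleNr form_app_linear.
suff -> : form_app (lZ L) = 1 by rewrite mulr1 addNr.
by apply: val_inj; apply/funext => p; exact: sformZ.
Qed.
Definition proj V : An := MkAn (proj_subproof V).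

(* [X + _] is taken in [An tau], and [bracket X Y] coerces [X], [Y] to vector
   fields. *)
Definition is_nabla_tau (nabla : vfield N -> An -> An) : Prop :=
  [/\ is_connection nabla,
      is_metric nabla (fun X Y => hfun L X Y),
      forall X : An, nabla (lZ L) X = X + proj (bracket (lZ L) X)
    & forall X Y : An, nabla X Y - nabla Y X - proj (bracket X Y) = 0].

Definition D_solvable (nabla : vfield N -> An -> An) : Prop :=
  exists D : An, forall X Y : An,
    hfun L X Y *: D - hfun L Y D *: X = curvature nabla (lZ L) X Y.

End Transversal.

Section LightlikeExtension.
Context {R : realType} {n : nat}.

(* In [ext_h_lorentz] the family [e] has as many elements as the rank, so it is
   an orthonormal basis of signature (-, +, ..., +). *)
(* [ext_Phi] is not additional data: [ext_PhiE] determines it. *)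
Record lightlike_ext (N : manifold R n) := LightlikeExt {
  ext_bun :> vbundle N n.+1;
  ext_h : forall p, fib ext_bun p -> fib ext_bun p -> R;
  ext_h_sym : forall p (x y : fib ext_bun p), ext_h x y = ext_h y x;
  ext_h_linear : forall p (x : fib ext_bun p), scalar (ext_h x);
  ext_h_smooth : forall s t : section ext_bun,
    smooth (fun p => ext_h (s p) (t p));
  ext_h_lorentz : forall p, exists e : 'I_n.+1 -> fib ext_bun p,
    forall i j, ext_h (e i) (e j) =
      if i == j then (if i == ord0 then -1 else 1) else 0;
  ext_nabla : vfield N -> section ext_bun -> section ext_bun;
  ext_connection : is_connection ext_nabla;
  ext_metric : is_metric ext_nabla (fun s t => mkCinf (ext_h_smooth s t));
  ext_xi : section ext_bun;
  ext_xi_null : forall p, ext_h (ext_xi p) (ext_xi p) = 0;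
  ext_xi_neq0 : forall p, ext_xi p != 0;
  ext_Phi : forall p, {linear Tan p -> fib ext_bun p};
  ext_PhiE : forall W p, ext_Phi p (vf_at W p) = ext_nabla W ext_xi p;
  ext_Phi_inj : forall p, injective (ext_Phi p)
}.

Context {N : manifold R n}.

Definition ext_for (L : lightlike N) (T : lightlike_ext N) : Prop :=
  (forall p (v w : Tan p), lh L v w = ext_h (ext_Phi T p v) (ext_Phi T p w)) /\
  (forall p, ext_Phi T p (vf_at (lZ L) p) = ext_xi T p).

(* [F] is smooth since it maps smooth sections to smooth sections. *)
Definition ext_iso (T1 T2 : lightlike_ext N) : Prop :=
  exists (F : forall p, {linear fib T1 p -> fib T2 p})
         (G : section T1 -> section T2),
    [/\ forall p, bijective (F p),
        forall s p, G s p = F p (s p),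
        forall p (x y : fib T1 p), ext_h (F p x) (F p y) = ext_h x y,
        forall V s, G (ext_nabla V s) = ext_nabla V (G s)
      & G (ext_xi T1) = ext_xi T2].

Definition collinear_xi (T : lightlike_ext N) (s : section T) : Prop :=
  exists f : N -> R, forall p, s p = f p *: ext_xi T p.

Definition ext_curv (T : lightlike_ext N) :
  vfield N -> vfield N -> section T -> section T :=
  curvature (@ext_nabla N T).

Definition curv_xi_collinear (T : lightlike_ext N) : Prop :=
  forall V W : vfield N, collinear_xi (ext_curv V W (ext_xi T)).

Definition curv_Z_collinear (L : lightlike N) (T : lightlike_ext N) : Prop :=
  forall V W : vfield N,
    collinear_xi (ext_curv (lZ L) V (ext_nabla W (ext_xi T))).

(* calW([U], [V])[W] = [Phi^-1 (R(U, V) Phi(W))]; the preimage under the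
   injective map [Phi] is required to exist. *)
Definition is_calW (L : lightlike N) (T : lightlike_ext N)
    (calW : forall p, screen L p -> screen L p -> screen L p -> screen L p) :=
  forall (U V W : vfield N) p, exists2 x : Tan p,
    ext_Phi T p x = ext_curv U V (ext_nabla W (ext_xi T)) p &
    calW p (cls L (vf_at U p)) (cls L (vf_at V p)) (cls L (vf_at W p)) =
      cls L x.

Definition ricci_calW_zero (L : lightlike N) (T : lightlike_ext N) : Prop :=
  exists2 calW, @is_calW L T calW &
    forall p (v w : screen L p), is_trace (fun u => calW p u v w) 0.

End LightlikeExtension.

(* Main.v *)
From HB Require Import structures.
From mathcomp Require Import all_boot all_order all_algebra.
From mathcomp Require Import ring lra.
From mathcomp Require Import all_classical all_reals all_analysis.
Require Import Defs.
Set Implicit Arguments.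
Unset Strict Implicit.
Unset Printing Implicit Defensive.
Import Order.TTheory GRing.Theory Num.Theory.
Import numFieldNormedType.Exports.
Local Open Scope classical_set_scope.
Local Open Scope ring_scope.

(* Fix a form tau with tau(Z) = 1.  In any extension there is a unique null
   section eta with h(eta, xi) = 1 orthogonal to Phi(An tau), so sections are
   Phi S + a eta and the connection is determined by the induced connection nab
   on An tau and by the An-component B of nabla eta.  The curvature of this
   normal form shows that (1) says that nab is nabla^tau, unique by a Koszul
   argument; that (2) says that D = B Z solves the displayed equation; and that
   (3) is the equation (m - 2) h(X, B Y) + h(X, Y) tr B = Ric(X, Y) on An tau,
   which has exactly one solution as m >= 3.  Hence any two extensions are
   isomorphic, and a solution D yields B and thereby an extension on TN + R. *)

(** * Smooth functions on R^n *)

(** Tangent vectors and vector fields are derivations of global smooth functions, so their locality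
    and the existence of local frames have to be derived; bump functions and Hadamard's lemma serve
    that purpose. Global frames need not exist: eta, traces and decompositions are chosen point by
    point, and uniqueness or independence of the frame makes smooth local candidates glue. Since
    R(V, W) xi = nabla_V Phi W - nabla_W Phi V - Phi [V, W], condition (1) is a torsion identity;
    its An-component contains both the rule for nabla^tau_Z and torsion-freeness on An tau. By
    metricity it also keeps R(U, V) Phi(W) inside Phi(TN). In (3) the factor m - 2 collects m from
    the trace of the identity and -2 from two contractions. Tracing once more gives (m - 2) + m = 2
    (m - 1), so the equation determines first tr B and then B. Uniqueness and the converse direction
    each use one form tau, so S(N, h, Z) must be shown to be nonempty. *)

Section C1.
Context {R : realType} {n : nat}.
Implicit Types (U : set 'rV[R]_n) (f g : 'rV[R]_n -> R^o) (x y z : 'rV[R]_n).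

(** Both difference quotients are the same function of h, so one-variable calculus applies along
    lines. *)
Lemma is_derive_line f z v (t : R) : derivable f (t *: v + z) v ->
  is_derive t 1 (fun s : R => f (s *: v + z)) ('D_v f (t *: v + z)).
Proof.
have E : (fun h : R => h^-1 *: (((fun s : R => f (s *: v + z)) \o shift t) (h *: (1:R))
     - f (t *: v + z))) = (fun h => h^-1 *: ((f \o shift (t *: v + z)) (h *: v) - f (t *: v + z))).
  apply/funext => h /=; congr (_ *: (f _ - _)).
  by rewrite scalerDl addrA [h *: 1]mulr1.
by move=> df; split; rewrite /derivable /derive E.
Qed.

Lemma is_derive_mulr (c t : R) : is_derive t (1 : R) ( *%R^~ c) c.
Proof.
apply: is_derive_eq (is_deriveM (is_derive_id t 1) (is_derive_cst c t 1)) _.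
by rewrite scaler0 add0r /GRing.scale /= mulr1.
Qed.

Lemma le_coord_norm x i : `|x ord0 i| <= `|x|.
Proof.
rewrite [leRHS]/Num.norm /= mx_normrE; apply/bigmax_geP; right => /=.
by exists (ord0, i).
Qed.

Lemma norm_le_coord x (e : R) : 0 <= e -> (forall i, `|x ord0 i| <= e) -> `|x| <= e.
Proof.
move=> e0 h; rewrite [leLHS]/Num.norm /= mx_normrE.
by apply/bigmax_leP; split=> // -[i j] _ /=; rewrite (ord1 i).
Qed.

(* Mean value theorem along the edges of the box between [x] and [x + y]. *)
Lemma edge_increment f x y (d e : R) (l : 'I_n -> R) : `|y| < d ->
  (forall z, `|z| < d -> forall i, derivable f (x + z) (delta_mx 0 i) /\
     `|'D_(delta_mx 0 i) f (x + z) - l i| <= e) ->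
  `|f (x + y) - f x - \sum_i l i * y ord0 i| <= n%:R * e * `|y|.
Proof.
move=> yd H.
(* [z k] has the first k coordinates of y and zeros after them, so consecutive points differ along a
   single axis. *)
pose z k : 'rV[R]_n := \row_j (if (j < k)%N then y ord0 j else 0).
have d0 : 0 < d by apply: le_lt_trans yd.
have e0 (i : 'I_n) : 0 <= e.
  have z0d : `|0 : 'rV[R]_n| < d by rewrite normr0.
  by have [_] := H 0 z0d i; apply: le_trans.
have step (k : 'I_n) :
  `|f (x + z k.+1) - f (x + z k) - l k * y ord0 k| <= e * `|y|.
  set b : 'rV[R]_n := delta_mx 0 k; set c := y ord0 k.
  have zE : z k.+1 = c *: b + z k.
    apply/rowP => j; rewrite !mxE eqxx /= ltnS leq_eqVlt.
    case: eqP => [jk|njk]; last by rewrite (_ : (j == k) = false) ?mulr0 ?add0r //; apply/eqP => /(congr1 val).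
    have -> : j = k by exact: val_inj.
    by rewrite eqxx ltnn mulr1 addr0.
  have inb (t : R) : 0 <= t <= 1 -> `|(t * c) *: b + z k| < d.
    move=> /andP[t0 t1]; apply: le_lt_trans yd.
    apply: norm_le_coord => // j; rewrite !mxE eqxx /=.
    have [->|_] := eqVneq j k; last first.
      rewrite mulr0 add0r; case: ifP => _; first exact: le_coord_norm.
      by rewrite normr0.
    rewrite ltnn mulr1 addr0 normrM (ger0_norm t0).
    by apply: le_trans (le_coord_norm y k); rewrite ler_piMl.
  pose F (s : R) := f (s *: b + (x + z k)).
  have HF (t : R) : 0 <= t <= 1 ->
      is_derive (t * c) 1 F ('D_b f (x + ((t * c) *: b + z k))).
    move=> t01; have [dd _] := H _ (inb t t01) k.
    by move: dd; rewrite addrCA => dd; exact: is_derive_line.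
  (* Running along the edge with parameter t in [0, 1], scaled by c, treats both signs of c in one
     application of the mean value theorem. *)
  have HG (t : R) : 0 <= t <= 1 -> is_derive t 1 (F \o ( *%R^~ c))
       ('D_b f (x + ((t * c) *: b + z k)) * c).
    move=> t01; have := HF t t01 => hF.
    apply: is_derive1_comp.
    exact: is_derive_mulr.
  have cG : {within `[0, 1], continuous (F \o ( *%R^~ c))}.
    by apply: derivable_within_continuous => t; rewrite in_itv /= => /HG[].
  have dG (t : R) : t \in `]0, 1[%R -> is_derive t 1 (F \o ( *%R^~ c))
      ('D_b f (x + ((t * c) *: b + z k)) * c).
    by rewrite in_itv /= => /andP[t0 t1]; apply: HG; rewrite !ltW.
  have [t t01] := MVT_segment ler01 dG cG; move: t01; rewrite in_itv /= => t01.
  rewrite /F /= mul0r mul1r scale0r add0r subr0 mulr1 addrCA -zE => ->.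
  rewrite -mulrBl normrM -/c.
  apply: ler_pM => //; last exact: le_coord_norm.
  by have [_] := H _ (inb t t01) k.
have z0 : z 0%N = 0 by apply/rowP => j; rewrite !mxE.
have zn : z n = y by apply/rowP => j; rewrite !mxE ltn_ord.
have -> : f (x + y) - f x - \sum_i l i * y ord0 i =
   \sum_(k < n) (f (x + z k.+1) - f (x + z k) - l k * y ord0 k).
  rewrite [RHS]sumrB; congr (_ - _).
  have := @telescope_sumr _ 0 n (fun k => f (x + z k)) (leq0n _).
  by rewrite big_mkord zn z0 addr0 => ->.
apply: le_trans (ler_norm_sum _ _ _) _.
apply: le_trans (ler_sum _ (fun k _ => step k)) _.
by rewrite sumr_const card_ord -mulrA mulr_natl.
Qed.

Definition row_linear (l : 'I_n -> R) (y : 'rV[R]_n) : R^o :=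
  \sum_i l i * y ord0 i.

Fact row_linear_subproof (l : 'I_n -> R) : linear (row_linear l).
Proof.
move=> a u v; rewrite /row_linear scaler_sumr -big_split; apply: eq_bigr => i _ /=.
by rewrite !mxE mulrDr mulrCA.
Qed.
HB.instance Definition _ l := GRing.isLinear.Build R 'rV[R]_n R^o _
  (row_linear l) (row_linear_subproof l).

Lemma row_linear_continuous (l : 'I_n -> R) : continuous (row_linear l).
Proof.
apply: continuous_big => [|i _ y]; first exact: add_continuous.
by apply: continuousM; [exact: cst_continuous | exact: coord_continuous].
Qed.

Lemma cvg_add0 x : (x + z) @[z --> (0 : 'rV[R]_n)] --> x.
Proof.
rewrite -[X in _ --> X]addr0.
apply: (@cvgD _ _ _ (nbhs (0 : 'rV[R]_n)) _ (cst x) id x 0); first exact: cvg_cst.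
exact: cvg_id.
Qed.

Lemma C1_differentiable U f x : open U -> U x ->
  (forall y, U y -> forall i, derivable f y (delta_mx 0 i)) ->
  (forall i, {for x, continuous ('D_(delta_mx 0 i) f)}) ->
  differentiable f x /\
  ('d f x : _ -> _) = (fun v => \sum_i 'D_(delta_mx 0 i) f x * v ord0 i).
Proof.
move=> oU Ux df cf.
pose LL := row_linear (fun i => 'D_(delta_mx 0 i) f x).
have cL : continuous LL by exact: row_linear_continuous.
have key e : 0 < e -> \forall y \near (0 : 'rV[R]_n),
    `|f (y + x) - f x - LL y| <= e * `|y|.
  move=> e0.
  (* [edge_increment] costs a factor n; the denominator n + 1 is nonzero even for n = 0. *)
  pose e' := e / n.+1%:R; have e'0 : 0 < e' by exact: divr_gt0.
  have ne' : n%:R * e' <= e.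
    rewrite /e' mulrCA ler_piMr ?(ltW e0) //.
    by rewrite ler_pdivrMr ?ltr0n // mul1r ler_nat.
  have H i : \forall z \near (0 : 'rV[R]_n), U (x + z) /\
       `|'D_(delta_mx 0 i) f (x + z) - 'D_(delta_mx 0 i) f x| <= e'.
    have sh := @cvg_add0 x.
    apply: filterI.
      by apply: sh; exact: open_nbhs_nbhs.
    have := cvg_comp _ _ sh (cf i) => /cvgrPdist_le /(_ _ e'0).
    by apply: filterS => z /=; rewrite distrC.
  have : \forall z \near (0 : 'rV[R]_n), forall i, U (x + z) /\
       `|'D_(delta_mx 0 i) f (x + z) - 'D_(delta_mx 0 i) f x| <= e'.
    exact (filter_forall _ H).
  move=> /nbhs_norm0P [d /= d0 dP].
  apply/nbhs_norm0P; exists d => // y /= yd.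
  rewrite [y + x]addrC; apply: le_trans (ler_wpM2r _ ne') => //.
  apply: edge_increment yd _ => z zd i.
  by have [Uz Dz] := dP z zd i; split=> //; apply: df.
have dE : 'd f x = LL :> (_ -> _).
  apply: diff_unique => //; apply/eqaddoP => e /key; apply: filterS => y.
  by rewrite !fctE /= opprD addrA.
split; last by rewrite dE.
apply/diff_locallyP; rewrite dE; split=> //.
apply/eqaddoP => e /key; apply: filterS => y.
by rewrite !fctE /= opprD addrA.
Qed.

End C1.

(** * Calculus of C^k functions: locality, composition, inverse square roots *)

Section CkTools.
Context {R : realType}.

Lemma CkS n k (U V : set 'rV[R]_n) f : V `<=` U -> Ck k U f -> Ck k V f.
Proof.
move=> VU; elim: k f => [|k IH] f [cf df]; split=> //; try by move=> x /VU/cf.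
by move=> i; have [d1 d2] := df i; split; [move=> x /VU/d1 | exact: IH].
Qed.

Lemma Ck_local n k (U : set 'rV[R]_n) f :
  (forall x, U x -> exists2 V, open V /\ V x & Ck k V f) -> Ck k U f.
Proof.
elim: k f => [|k IH] f H.
  by split=> // x /H[V [_ Vx] [cf _]]; exact: cf.
split=> [x /H[V [_ Vx] [cf _]]|i]; first exact: cf.
split=> [x /H[V [_ Vx] [_ /(_ i)[df _]]]|]; first exact: df.
by apply: IH => x /H[V oV [_ /(_ i)[_ df]]]; exists V.
Qed.

Lemma Ck_differentiable n k (U : set 'rV[R]_n) (f : 'rV[R]_n -> R^o) x :
  open U -> Ck k.+1 U f -> U x ->
  differentiable f x /\
  ('d f x : _ -> _) = (fun v => \sum_i 'D_(delta_mx 0 i) f x * v ord0 i).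
Proof.
move=> oU [_ df] Ux; apply: (C1_differentiable oU Ux).
  by move=> y Uy i; exact: (df i).1.
by move=> i; exact: Ck_cont (df i).2 _ Ux.
Qed.

Lemma Ck_sum n k (U : set 'rV[R]_n) m (f : 'I_m -> 'rV[R]_n -> R^o) : open U ->
  (forall i, Ck k U (f i)) -> Ck k U (fun x => \sum_i f i x).
Proof.
move=> oU; elim: m f => [|m IH] f H.
  rewrite (_ : (fun _ => _) = fun=> 0); first exact: Ck_cst.
  by apply/funext => x; rewrite big_ord0.
rewrite (_ : (fun _ => _) = (fun x => \sum_(i < m) f (widen_ord (leqnSn m) i) x)
   \+ f ord_max); last by apply/funext => x; rewrite big_ord_recr.
by apply: Ck_add => //; apply: IH.
Qed.

Lemma is_derive_coord n (x : 'rV[R]_n) (i j : 'I_n) :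
  is_derive x (delta_mx 0 j) (fun x : 'rV[R]_n => x ord0 i : R^o) (j == i)%:R.
Proof.
have dc := differentiable_coord x ord0 i.
split; first exact: diff_derivable.
rewrite deriveE //.
rewrite (_ : 'd _ x = (fun M : 'rV[R]_n => M ord0 i : R^o) :> (_ -> _)); last first.
  pose F := row_linear (fun j => (j == i)%:R : R).
  have FE : F = (fun M : 'rV[R]_n => M ord0 i : R^o) :> (_ -> _).
    apply/funext => M; rewrite /F /row_linear (bigD1 i) //= eqxx mul1r.
    by rewrite big1 ?addr0 // => l /negbTE ->; rewrite mul0r.
  rewrite -FE; apply: diff_lin; exact: row_linear_continuous.
by rewrite mxE eqxx /= eq_sym.
Qed.

Lemma Ck_coord n k (U : set 'rV[R]_n) (i : 'I_n) : Ck k U (fun x => x ord0 i).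
Proof.
case: k => [|k]; (split; first by move=> x _; exact: coord_continuous) => // j.
split=> [x _|]; first exact: (@ex_derive _ _ _ _ _ _ _ (is_derive_coord x i j)).
rewrite (_ : 'D_ _ _ = (fun=> (j == i)%:R : R^o) :> ('rV[R]_n -> R^o)); first exact: Ck_cst.
by apply/funext => x; have [_ ->] := is_derive_coord x i j.
Qed.

Lemma row_cvg n (T : Type) (F : set_system T) (FF : Filter F) (g : T -> 'rV[R]_n)
    (l : 'rV[R]_n) :
  (forall i, (fun t => g t ord0 i) @ F --> l ord0 i) -> g @ F --> l.
Proof.
move=> H; apply/cvgrPdist_le => e e0.
have K i : \forall t \near F, `|l ord0 i - g t ord0 i| <= e.
  by have /cvgrPdist_le/(_ e e0) := H i.
have K' : \forall t \near F, forall i, `|l ord0 i - g t ord0 i| <= e.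
  exact (filter_forall _ K).
apply: filterS K' => t ht.
apply: norm_le_coord; first exact: ltW.
by move=> i; rewrite !mxE.
Qed.

(** Induction on k: by the chain rule a partial derivative of the composite is a sum of products of
    D_j f composed with g, covered by the induction hypothesis, and partial derivatives of g. *)
Lemma Ck_comp n m k (U : set 'rV[R]_n) (V : set 'rV[R]_m) (f : 'rV[R]_m -> R^o)
    (g : 'rV[R]_n -> 'rV[R]_m) : open U -> open V ->
  (forall x, U x -> V (g x)) ->
  (forall i, Ck k U (fun x => g x ord0 i)) -> Ck k V f -> Ck k U (f \o g).
Proof.
move=> oU oV UV; elim: k f => [|k IH] f Hg Hf.
all: have cfg x : U x -> {for x, continuous (f \o g)}.
1,3: move=> Ux; apply: continuous_comp; last exact: Ck_cont Hf _ (UV _ Ux).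
1,2: by apply: (@row_cvg _ _ _ (nbhs_filter x)) => i; exact: Ck_cont (Hg i) _ Ux.
  by split.
split=> // i.
have dg x j : U x -> differentiable (fun x => g x ord0 j : R^o) x.
  by move=> Ux; exact: (Ck_differentiable oU (Hg j) Ux).1.
(* Only the coordinates of g are known to be smooth; as a combination of fixed basis rows g itself
   becomes differentiable. *)
have gE : g = fun x => \sum_j g x ord0 j *: delta_mx 0 j.
  by apply/funext => x; exact: row_sum_delta.
have dgx x : U x -> differentiable g x /\
   forall v, 'd g x v = \sum_j ('D_v (fun x => g x ord0 j : R^o) x) *: delta_mx 0 j.
  move=> Ux.
  have dgj j : is_diff x (fun x => g x ord0 j *: (delta_mx 0 j : 'rV[R]_m))
     (fun v => 'd (fun x => g x ord0 j : R^o) x v *: delta_mx 0 j).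
    split; first by apply: differentiableZl; exact: dg.
    by rewrite diffZl //; exact: dg.
  have gE' : g = \sum_j (fun x => g x ord0 j *: (delta_mx 0 j : 'rV[R]_m)).
    by rewrite {1}gE; apply/funext => y; rewrite fct_sumE.
  have dd : differentiable g x.
    by rewrite gE'; apply: differentiable_sum => j; exact: ex_diff.
  split=> // v; rewrite -deriveE //.
  transitivity ('D_v (\sum_j (fun x => g x ord0 j *: (delta_mx 0 j : 'rV[R]_m))) x).
    by rewrite -gE'.
  rewrite derive_sum.
    apply: eq_bigr => j _; rewrite deriveE; last exact: ex_diff.
    by rewrite diff_val -deriveE //; exact: dg.
  by move=> j; apply: diff_derivable; exact: ex_diff.
have D x : U x -> is_derive x (delta_mx 0 i) (f \o g)
  (\sum_j 'D_(delta_mx 0 j) f (g x) * 'D_(delta_mx 0 i) (fun x => g x ord0 j : R^o) x).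
  move=> Ux; have [df dfE] := Ck_differentiable oV Hf (UV _ Ux).
  have [dgd dgE] := dgx x Ux.
  have dfg : differentiable (f \o g) x by exact: differentiable_comp.
  split; first exact: diff_derivable.
  rewrite deriveE // diff_comp // /= dfE; apply: eq_bigr => j _.
  congr (_ * _); rewrite dgE summxE (bigD1 j) //= !mxE !eqxx mulr1.
  rewrite big1 ?addr0 // => l lj; rewrite !mxE eqxx /=.
  by rewrite eq_sym (negbTE lj) mulr0.
split=> [x Ux|]; first exact: (@ex_derive _ _ _ _ _ _ _ (D x Ux)).
apply: (Ck_ext oU (f := fun x => \sum_j ('D_(delta_mx 0 j) f \o g) x *
   'D_(delta_mx 0 i) (fun x => g x ord0 j : R^o) x)).
  by move=> x /set_mem /D[_ ->].
apply: Ck_sum => // j; apply: (@Ck_mul _ _ k U ('D_(delta_mx 0 j) f \o g)) => //.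
  by apply: IH; [move=> l; exact: CkW | exact: (Hf.2 j).2].
exact: ((Hg j).2 i).2.
Qed.

Lemma is_derive_line0 n (f : 'rV[R]_n -> R^o) x v d :
  is_derive (0 : R) (1 : R) (fun h : R => f (h *: v + x)) d -> is_derive x v f d.
Proof.
have E : (fun h : R => h^-1 *: (((fun s : R => f (s *: v + x)) \o shift 0) (h *: (1:R))
     - f (0 *: v + x))) = (fun h => h^-1 *: ((f \o shift x) (h *: v) - f x)).
  apply/funext => h /=; rewrite scale0r add0r addr0; congr (_ *: (f _ - _)).
  by rewrite [h *: 1]mulr1.
by move=> [d1 d2]; split; move: d1 d2; rewrite /derivable /derive E.
Qed.

(** A set [P] of one-variable functions closed under differentiation on [D] replaces explicit
    formulas for higher derivatives. It is applied to the functions c t^(-m/2) on t > 0 and to the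
    functions [flat p]. *)
Lemma Ck_post n k (U : set 'rV[R]_n) (f : 'rV[R]_n -> R^o) (D : set R)
    (P : set (R -> R)) : open U ->
  (forall g, P g -> exists2 dg, P dg &
     forall t, D t -> is_derive t (1 : R) g (dg t)) ->
  (forall x, U x -> D (f x)) -> Ck k U f -> forall g, P g -> Ck k U (g \o f).
Proof.
move=> oU HP UD; elim: k => [|k IH] Hf g Pg.
all: have [dg Pdg gdg] := HP _ Pg.
all: have cfg x : U x -> {for x, continuous (g \o f)}.
1,3: move=> Ux; apply: continuous_comp; first exact: Ck_cont Hf _ Ux.
1,2: have [dd _] := gdg _ (UD _ Ux).
1,2: exact/differentiable_continuous/derivable1_diffP.
  by split.
split=> // i.
have DE x : U x -> is_derive x (delta_mx 0 i) (g \o f)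
    (dg (f x) * 'D_(delta_mx 0 i) f x).
  move=> Ux; apply: is_derive_line0.
  apply: (@is_derive1_comp R g (fun h : R => f (h *: delta_mx 0 i + x)) 0).
    by rewrite scale0r add0r; exact/gdg/UD.
  have [df _] := Hf.2 i.
  have := @is_derive_line R n f x (delta_mx 0 i) 0.
  by rewrite scale0r add0r; apply; exact: df.
split=> [x Ux|]; first exact: (@ex_derive _ _ _ _ _ _ _ (DE x Ux)).
apply: (Ck_ext oU (f := (dg \o f) \* 'D_(delta_mx 0 i) f)).
  by move=> x /set_mem /DE[_ ->].
apply: Ck_mul => //; last exact: (Hf.2 i).2.
by apply: IH => //; exact: CkW.
Qed.

Lemma Ck_invsqrt n k (U : set 'rV[R]_n) (f : 'rV[R]_n -> R^o) : open U ->
  (forall x, U x -> 0 < f x) -> Ck k U f -> Ck k U (fun x => (Num.sqrt (f x))^-1).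
Proof.
move=> oU f0 Hf.
pose P : set (R -> R) := [set g | exists c m, g = fun t => c * (Num.sqrt t)^-1 ^+ m].
apply: (Ck_post (g := fun t => (Num.sqrt t)^-1) (D := [set t | 0 < t]) (P := P) oU _ f0 Hf).
  move=> _ [c [m ->]].
  (* With s = t^(-1/2), the derivative of c s^m is - c (m / 2) s^(m + 2). *)
  exists (fun t => c * - (m%:R / 2) * (Num.sqrt t)^-1 ^+ m.+2).
    by exists (c * - (m%:R / 2)), m.+2.
  move=> t t0.
  have st : Num.sqrt t != 0 by rewrite gt_eqF // sqrtr_gt0.
  have ds := is_derive1_sqrt t0.
  have dv := is_deriveV st ds.
  have dX := @is_deriveX _ _ _ m t 1 _ dv.
  have := is_deriveZ c dX.
  rewrite (_ : c \*: _ = fun t : R => c * (Num.sqrt t)^-1 ^+ m); last first.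
    by apply/funext => s /=; rewrite exprfctE.
  move=> dd; apply: is_derive_eq dd _; rewrite /GRing.scale /=.
  case: m {dX} => [|m]; first by rewrite !mul0r mulr0 oppr0 mulr0 mul0r.
  rewrite succnK -[X in _ = _ * _ ^+ X]addn3 exprD.
  set u := _ ^+ m; by field; rewrite st.
by exists 1, 1%N; apply/funext => t; rewrite mul1r expr1.
Qed.

End CkTools.

(** * Flat functions and bump functions on R^n *)

Section Bump.
Context {R : realType}.
Implicit Types p : {poly R}.

(* Every derivative of [exp (- 1 / t)] on the half-line [t > 0] is of this form. *)
Definition flat p (t : R) : R :=
  if 0 < t then p.[t^-1] * expR (- t^-1) else 0.

(** The exponential series gives (1/t)^(i + 1) <= (i + 1)! exp (1/t), so the monomial of degree i
    contributes at most a multiple of t. *)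
Lemma flat_bound p : exists C : R, forall t, `|flat p t| <= C * `|t|.
Proof.
exists (\sum_(i < size p) `|p`_i| * (i.+1)`!%:R) => t.
rewrite /flat; case: ifPn => [t0|_]; last first.
  by rewrite normr0 mulr_ge0 //; apply: sumr_ge0 => i _; rewrite mulr_ge0.
have s0 : 0 < t^-1 by rewrite invr_gt0.
rewrite (gtr0_norm t0) horner_coef mulr_suml mulr_suml.
apply: le_trans (ler_norm_sum _ _ _) _; apply: ler_sum => i _.
rewrite -mulrA normrM -mulrA ler_wpM2l //.
have H : t^-1 ^+ i.+1 <= (i.+1)`!%:R * expR t^-1.
  have := expR_ge1Dxn i (ltW s0); rewrite -ler_pdivrMl ?ltr0n ?fact_gt0 // => h.
  by rewrite mulrC; apply: le_trans h; rewrite lerDr.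
rewrite ger0_norm; last by rewrite mulr_ge0 ?expR_ge0 // exprn_ge0 // ltW.
rewrite expRN ler_pdivrMr ?expR_gt0 //.
have -> : t^-1 ^+ i = t * t^-1 ^+ i.+1 by rewrite exprS mulrA divff ?mul1r // gt_eqF.
by rewrite -mulrA mulrCA ler_pM2l.
Qed.

(** With s = 1/t one has ds/dt = - s^2, so p(s) exp (- s) has the derivative s^2 (p - p')(s) exp (-
    s) in t. *)
Definition dflat p : {poly R} := 'X^2 * (p - p^`()).

Lemma is_derive_flat p t : is_derive t (1 : R) (flat p) (flat (dflat p) t).
Proof.
case: (ltrgt0P t) => [t0|t0|->].
- rewrite {2}/flat t0.
  apply: (@near_eq_is_derive _ _ _ (fun s : R => p.[s^-1] * expR (- s^-1))).
    near=> s; rewrite /flat; suff -> : 0 < s by [].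
    by near: s; exact: lt_nbhsr.
  have tn0 : t != 0 by rewrite gt_eqF.
  have dv := is_deriveV tn0 (is_derive_id t 1).
  have d1 := is_derive1_comp (is_derive_poly p t^-1) dv.
  have d2 := @is_derive1_comp R expR (fun s => - s^-1) t _ _ (is_derive_expR _) (is_deriveN dv).
  apply: is_derive_eq (is_deriveM d1 d2) _.
  rewrite /GRing.scale /= /dflat hornerM hornerXn hornerD hornerN; field.
  by rewrite tn0.
- rewrite {2}/flat ltNge (ltW t0) /=.
  have H0 : is_derive t (1 : R) (cst 0 : R -> R^o) 0 by exact: is_derive_cst.
  apply: near_eq_is_derive H0.
  near=> s; rewrite /flat; suff -> : 0 < s = false by [].
  by apply/negbTE; rewrite -leNgt ltW //; near: s; exact: lt_nbhsl.
- rewrite {2}/flat ltxx.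
  (* The difference quotient of [flat p] at 0 is [flat ('X * p)], since division by h multiplies by
     the variable 1/h; the linear bound makes it tend to 0. *)
  have [C HC] := flat_bound ('X * p).
  have key : (fun h : R => h^-1 *: ((flat p \o shift 0) (h *: (1 : R)) - flat p 0))
     @ 0^' --> (0 : R).
    apply/cvgr0Pnorm_le => e e0.
    have C0 : 0 <= C by have := HC 1; rewrite normr1 mulr1; apply: le_trans.
    near=> h.
    rewrite /= addr0 [h *: 1]mulr1 [flat p 0]/flat ltxx subr0.
    have hn0 : h != 0 by near: h; exact: nbhs_dnbhs_neq.
    have -> : h^-1 *: flat p h = flat ('X * p) h.
      rewrite /flat; case: ifP => // _; last by rewrite scaler0.
      by rewrite /GRing.scale /= hornerM hornerX mulrA.
    apply: le_trans (HC h) _.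
    have : `|h| <= e / (C + 1).
      near: h; apply: dnbhs0_le; rewrite divr_gt0 // ltr_wpDl //.
    rewrite ler_pdivlMr ?ltr_wpDl // => hh.
    by apply: le_trans hh; rewrite mulrC ler_wpM2l // lerDl.
  split; first by apply/cvg_ex; exists 0.
  exact: cvg_lim key.
Unshelve. all: by end_near. Qed.

Lemma Ck_flat n k (U : set 'rV[R]_n) (f : 'rV[R]_n -> R^o) p : open U ->
  Ck k U f -> Ck k U (flat p \o f).
Proof.
move=> oU Hf.
apply: (Ck_post (D := setT) (P := [set g | exists q, g = flat q]) oU _ _ Hf) => //.
  by move=> _ [q ->]; exists (flat (dflat q)); [exists (dflat q)|move=> t _; exact: is_derive_flat].
by exists p.
Qed.

Lemma Ck_inv n k (U : set 'rV[R]_n) (f : 'rV[R]_n -> R^o) : open U ->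
  (forall x, U x -> 0 < f x) -> Ck k U f -> Ck k U (fun x => (f x)^-1).
Proof.
move=> oU f0 Hf.
have H := Ck_invsqrt oU f0 Hf.
apply: Ck_ext oU _ (Ck_mul oU H H) => x /set_mem Ux /=.
by rewrite -invfM -expr2 sqr_sqrtr // ltW // f0.
Qed.

Definition step (t : R) : R := flat 1 t / (flat 1 t + flat 1 (1 - t)).

Lemma flat1_ge0 t : 0 <= flat 1 t.
Proof. by rewrite /flat; case: ifP => // _; rewrite hornerC mul1r expR_ge0. Qed.

Lemma flat1_gt0 t : 0 < t -> 0 < flat 1 t.
Proof. by rewrite /flat => ->; rewrite hornerC mul1r expR_gt0. Qed.

Lemma flat_le0 p t : t <= 0 -> flat p t = 0.
Proof. by rewrite /flat ltNge => ->. Qed.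

Lemma step_den_gt0 t : 0 < flat 1 t + flat 1 (1 - t).
Proof.
have [t0|t0] := ltP 0 t.
  by rewrite ltr_wpDr ?flat1_ge0 ?flat1_gt0.
by rewrite ltr_wpDl ?flat1_ge0 ?flat1_gt0 // subr_gt0 (le_lt_trans t0).
Qed.

Lemma step0 t : t <= 0 -> step t = 0.
Proof. by move=> t0; rewrite /step flat_le0 ?mul0r. Qed.

Lemma step1 t : 1 <= t -> step t = 1.
Proof.
move=> t1; rewrite /step (flat_le0 1 (t := 1 - t)) ?subr_le0 // addr0 divff //.
by rewrite gt_eqF // flat1_gt0 // (lt_le_trans ltr01).
Qed.

Lemma Ck_step n k (U : set 'rV[R]_n) (f : 'rV[R]_n -> R^o) : open U ->
  Ck k U f -> Ck k U (step \o f).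
Proof.
move=> oU Hf; apply: Ck_mul => //; first exact: Ck_flat.
apply: Ck_inv => //; first by move=> x _; exact: step_den_gt0.
apply: Ck_add => //; first exact: Ck_flat.
have H : Ck k U (cst 1 \+ (cst (-1) \* f)).
  by apply: Ck_add => //; [exact: Ck_cst|apply: Ck_mul => //; exact: Ck_cst].
apply: (Ck_ext oU _ (Ck_flat 1 oU H)) => x _ /=.
by rewrite mulN1r.
Qed.

Lemma Ck_prod n k (U : set 'rV[R]_n) m (f : 'I_m -> 'rV[R]_n -> R^o) : open U ->
  (forall i, Ck k U (f i)) -> Ck k U (fun x => \prod_i f i x).
Proof.
move=> oU; elim: m f => [|m IH] f H.
  rewrite (_ : (fun _ => _) = fun=> 1); first exact: Ck_cst.
  by apply/funext => x; rewrite big_ord0.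
rewrite (_ : (fun _ => _) = (fun x => \prod_(i < m) f (widen_ord (leqnSn m) i) x)
   \* f ord_max); last by apply/funext => x; rewrite big_ord_recr.
by apply: Ck_mul => //; apply: IH.
Qed.

Lemma norm_lt_coord n (x : 'rV[R]_n) (e : R) : 0 < e ->
  (forall i, `|x ord0 i| < e) -> `|x| < e.
Proof.
move=> e0 h; rewrite [ltLHS]/Num.norm /= mx_normrE.
by apply/bigmax_ltP; split=> // -[i j] _ /=; rewrite (ord1 i).
Qed.

(** The norm on rows is the maximum of the coordinates, so a product of one-variable cut-offs, one
    per coordinate, is 1 on the ball and 0 off the ball of twice the radius. *)
Lemma Ck_bump n (x0 : 'rV[R]_n) (e : R) : 0 < e ->
  exists b : 'rV[R]_n -> R^o, [/\ forall k, Ck k setT b,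
    forall x, `|x - x0| < e -> b x = 1 & forall x, 2 * e <= `|x - x0| -> b x = 0].
Proof.
move=> e0.
pose u i (x : 'rV[R]_n) : R := e^-1 * (x ord0 i - x0 ord0 i).
pose b x := \prod_i (step (2 - u i x) * step (2 + u i x)).
exists b; split.
- move=> k; apply: Ck_prod => [|i]; first exact: openT.
  have Hu : Ck k setT (u i : 'rV[R]_n -> R^o).
    apply: Ck_mul; [exact: openT|exact: Ck_cst|].
    apply: Ck_add; [exact: openT|exact: Ck_coord|exact: Ck_cst].
  have H2 c : Ck k setT (cst 2 \+ (cst c \* u i) : 'rV[R]_n -> R^o).
    apply: Ck_add; [exact: openT|exact: Ck_cst|].
    apply: Ck_mul; [exact: openT|exact: Ck_cst|exact: Hu].
  apply: Ck_mul; first exact: openT.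
    apply: (Ck_ext openT _ (Ck_step openT (H2 (-1)))) => x _ /=.
    by rewrite mulN1r.
  apply: (Ck_ext openT _ (Ck_step openT (H2 1))) => x _ /=.
  by rewrite mul1r.
- move=> x xe; rewrite /b big1 // => i _.
  have : `|u i x| < 1.
    rewrite normrM gtr0_norm ?invr_gt0 // ltr_pdivrMl // mulr1.
    by apply: le_lt_trans xe; have := le_coord_norm (x - x0) i; rewrite !mxE.
  by rewrite ltr_norml => /andP[u1 u2]; rewrite !step1 ?mulr1 //; lra.
- move=> x xe.
  have [i Hi] : exists i, 2 * e <= `|x ord0 i - x0 ord0 i|.
    apply/not_existsP => H; move: xe; rewrite leNgt => /negP; apply.
    apply: norm_lt_coord => [|i]; first by rewrite mulr_gt0.
    by rewrite !mxE ltNge; apply/negP; exact: H.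
  rewrite /b (bigD1 i) //=.
  have : 2 <= `|u i x|.
    by rewrite normrM gtr0_norm ?invr_gt0 // ler_pdivlMl // mulrC.
  rewrite ler_normr => /orP[h|h].
    by rewrite (@step0 (2 - u i x)) ?mul0r //; lra.
  by rewrite (@step0 (2 + u i x)) ?mulr0 ?mul0r //; lra.
Qed.

End Bump.

(** * Hadamard's lemma *)

Section Hadamard.
Context {R : realType} {n : nat}.
Notation mu := (@lebesgue_measure R).
Implicit Types (F : 'rV[R]_n -> R^o) (x y : 'rV[R]_n).

Lemma I01 : measurable (`[0, 1]%classic : set (measurableTypeR R)).
Proof. exact: measurable_itv. Qed.

(** Differentiation in x brings out a factor t, so the weights t^a make the family closed under
    partial derivatives; a = 0 gives the Hadamard coefficients. *)
Definition ray_int a F x : R :=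
  \int[mu]_(t in `[0, 1]) (t ^+ a * F (t *: x)).

Lemma continuous_integrable01 (f : R -> R^o) : continuous f ->
  mu.-integrable `[0, 1] (EFin \o f).
Proof.
move=> cf; apply: continuous_compact_integrable; first exact: segment_compact.
exact: continuous_subspaceT.
Qed.

Lemma ray_comp_continuous F x : continuous F ->
  continuous (fun t : R => F (t *: x)).
Proof.
by move=> cF t; exact: (continuous_comp (@scalel_continuous _ _ x t) (cF (t *: x))).
Qed.

Lemma ray_continuous a F x : continuous F ->
  continuous (fun t : R => t ^+ a * F (t *: x) : R^o).
Proof.
move=> cF t.
apply: (@continuousM R R (fun t => t ^+ a) (fun t => F (t *: x)) t).
  exact: exprn_continuous.
exact: ray_comp_continuous.
Qed.

Lemma ray_integrable a F x : continuous F ->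
  mu.-integrable `[0, 1] (EFin \o (fun t : R => t ^+ a * F (t *: x))).
Proof. by move=> cF; apply: continuous_integrable01; exact: ray_continuous. Qed.

Lemma Rint01_cst (c : R) : \int[mu]_(t in `[0, 1]) c = c.
Proof.
rewrite Rintegral_cst; last exact: I01.
have E : mu (`[0, 1]%classic : set R) = 1%E.
  by rewrite lebesgue_measure_itv /= lte01 sube0.
by rewrite [fine _](congr1 fine E) mulr1.
Qed.

Lemma Rint01_le (f : R -> R) (c : R) : mu.-integrable `[0, 1] (EFin \o f) ->
  (forall t, 0 <= t <= 1 -> `|f t| <= c) -> `|\int[mu]_(t in `[0, 1]) f t| <= c.
Proof.
move=> intf fc.
have h := le_normr_Rintegral I01 intf; apply: (le_trans h).
rewrite -[leRHS]Rint01_cst; apply: le_Rintegral => [||| t /=].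
- exact: I01.
- exact: integrable_norm.
- by apply: (@continuous_integrable01 (cst c)) => x; exact: cst_continuous.
- by rewrite in_itv /=; exact: fc.
Qed.

Lemma Rint01_sum m (f : 'I_m -> R -> R^o) : (forall i, continuous (f i)) ->
  \int[mu]_(t in `[0, 1]) (\sum_i f i t) = \sum_i \int[mu]_(t in `[0, 1]) f i t.
Proof.
elim: m f => [|m IH] f cf.
  rewrite big_ord0 -[RHS]Rint01_cst; apply: eq_Rintegral => t _.
  by rewrite big_ord0.
rewrite big_ord_recr /= -IH // -RintegralD; [| exact: I01| |exact: continuous_integrable01].
  by apply: eq_Rintegral => t _; rewrite big_ord_recr.
apply: (@continuous_integrable01 (fun t => \sum_(i < m) f (widen_ord (leqnSn m) i) t)).
by apply: continuous_big => // z; exact: add_continuous.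
Qed.

Lemma continuous_bounded_ball F (r : R) : continuous F ->
  exists2 M, 0 <= M & forall x, `|x| <= r -> `|F x| <= M.
Proof.
move=> cF; pose B : set 'rV[R]_n := [set x | `|x| <= r].
have cB : compact B.
  apply: bounded_closed_compact.
    exists r; split; first exact: num_real.
    by move=> s rs x /= xr; apply: le_trans xr (ltW rs).
  apply: (@preimage_closed _ _ (fun x : 'rV[R]_n => `|x|) [set t | t <= r]).
    by move=> x _; exact: norm_continuous.
  exact: closed_le.
have cD : {within B, continuous F} by exact: continuous_subspaceT.
have [M [_ HM]] := compact_bounded (continuous_compact cD cB).
exists (`|M| + 1); first by rewrite addr_ge0.
move=> x Bx; apply: (HM (`|M| + 1)).
  by rewrite (le_lt_trans (ler_norm M)) // ltrDl.
by exists x.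
Qed.

Lemma C1_lipschitz F (r : R) : Ck 1 setT F ->
  exists2 K, 0 <= K & forall x y, `|x| <= r -> `|y - x| < 1 ->
    `|F y - F x| <= K * `|y - x|.
Proof.
move=> [cF dF].
have H i : exists2 M, 0 <= M & forall x, `|x| <= r + 1 -> `|'D_(delta_mx 0 i) F x| <= M.
  by apply: continuous_bounded_ball => x; exact: (dF i).2.1.
pose M i := s2val (cid2 (H i)).
have M0 i : 0 <= M i by exact: (s2valP (cid2 (H i))).
exists (n%:R * \sum_i M i); first by rewrite mulr_ge0 // sumr_ge0.
move=> x y xr yx.
(* With slopes 0 the edge estimate becomes a Lipschitz bound; the sum of all [M i] bounds every
   partial derivative at once. *)
have := @edge_increment R n F x (y - x) 1 (\sum_i M i) (fun=> 0) yx.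
have -> : \sum_i 0 * (y - x) ord0 i = 0 by apply: big1 => i _; rewrite mul0r.
rewrite [x + _]addrC subrK [_ - F x - 0]subr0; apply => z z1 i; split; first exact: (dF i).1.
rewrite subr0; apply: (@le_trans _ _ (M i)); last first.
  by rewrite (bigD1 i) //= lerDl sumr_ge0.
apply: (s2valP' (cid2 (H i))); apply: le_trans (ler_normD _ _) _.
by apply: lerD => //; exact: ltW.
Qed.

Lemma ray_int_continuous a F : Ck 1 setT F -> continuous (ray_int a F : _ -> R^o).
Proof.
move=> HF.
have cF : continuous F by move=> z; exact: Ck_cont HF _ I.
suff Hx : forall x : 'rV[R]_n, {for x, continuous (ray_int a F : _ -> R^o)}.
  by move=> x; exact: Hx.
move=> x.
have [K K0 HK] := C1_lipschitz `|x| HF.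
apply/(@cvgrPdist_le _ _ _ _ (nbhs_filter x)) => e e0.
pose d := Num.min 1 (e / (K + 1)).
have d0 : 0 < d by rewrite lt_min ltr01 divr_gt0 // ltr_wpDl.
have HB : nbhs x (ball x d) by exact: nbhsx_ballx.
apply: filterS HB => y; rewrite -ball_normE /= distrC lt_min => /andP[xy1 xye].
rewrite distrC /ray_int -RintegralB; [|exact: I01|exact: ray_integrable..].
apply: Rint01_le.
  apply: (@continuous_integrable01 (fun t => t ^+ a * F (t *: y) - t ^+ a * F (t *: x))).
  move=> t.
  exact: (@cvgB _ _ _ _ (nbhs_filter t) _ _ _ _ (@ray_continuous a F y cF t) (@ray_continuous a F x cF t)).
move=> t /andP[t0 t1]; rewrite -mulrBr normrM.
have ta : `|t ^+ a| <= 1 by rewrite ger0_norm ?exprn_ge0 // exprn_ile1.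
have txx : `|t *: x| <= `|x| by rewrite normrZ ger0_norm // ler_piMl.
have tyx : `|t *: y - t *: x| <= `|y - x|.
  by rewrite -scalerBr normrZ ger0_norm // ler_piMl.
have h := HK (t *: x) (t *: y) txx (le_lt_trans tyx xy1).
apply: le_trans (_ : _ <= `|F (t *: y) - F (t *: x)|) _; first exact: ler_piMl.
apply: le_trans h _; apply: le_trans (ler_wpM2l K0 tyx) _.
move: (ltW xye); rewrite ler_pdivlMr ?ltr_wpDl //; apply: le_trans.
by rewrite mulrC ler_wpM2l // lerDl.
Qed.

Lemma ray_int_is_derive a F x i : Ck 1 setT F ->
  is_derive x (delta_mx 0 i) (ray_int a F : _ -> R^o)
    (ray_int a.+1 ('D_(delta_mx 0 i) F) x).
Proof.
move=> HF; apply: is_derive_line0.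
set v := delta_mx 0 i.
have cF : continuous F by move=> z; exact: Ck_cont HF _ I.
have cDF : continuous ('D_v F) by move=> z; exact: (HF.2 i).2.1.
pose f (h t : R) : R := t ^+ a * F (t *: (h *: v + x)).
have D h t : is_derive h (1 : R) (f ^~ t) (t ^+ a.+1 * 'D_v F (t *: (h *: v + x))).
  have E : t *: (h *: v + x) = (h * t) *: v + t *: x.
    by rewrite scalerDr scalerA mulrC.
  have d1 : is_derive (h * t) (1 : R) (fun s : R => F (s *: v + t *: x))
     ('D_v F ((h * t) *: v + t *: x)).
    by apply: is_derive_line; exact: (HF.2 i).1.
  have d2 := @is_derive1_comp R (fun s : R => F (s *: v + t *: x)) ( *%R^~ t) h _ _ d1 (is_derive_mulr t h).
  have d3 := is_deriveZ (t ^+ a) d2.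
  rewrite (_ : f ^~ t = t ^+ a \*: ((fun s => F (s *: v + t *: x)) \o *%R^~ t)).
    by apply: is_derive_eq d3 _; rewrite E exprSr /GRing.scale /=; ring.
  by apply/funext => s; rewrite /f /= scalerDr scalerA [t * s]mulrC.
(* For |h| < 1 and t in [0, 1] the point t (h v + x) stays in this ball, so the constant M dominates
   the derivative of the integrand. *)
have [M M0 HM] := continuous_bounded_ball (`|x| + 1) cDF.
have P1 h t : partial1of2 f h t = t ^+ a.+1 * 'D_v F (t *: (h *: v + x)).
  by rewrite /partial1of2 derive1E; exact: derive_val.
have I0 : `](-1 : R), 1[%classic 0 by rewrite /= in_itv /= ltrN10 ltr01.
have H1 h : `](-1 : R), 1[%classic h -> mu.-integrable `[0, 1] (EFin \o f h).
  by move=> _; exact: ray_integrable.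
have H2 h t : `](-1 : R), 1[%classic h -> `[(0 : R), 1]%classic t -> derivable (f ^~ t) h 1.
  by move=> _ _; exact: (@ex_derive _ _ _ _ _ _ _ (D h t)).
have H3 : mu.-integrable `[0, 1] (EFin \o (cst M : R -> R^o)).
  by apply: continuous_integrable01 => z; exact: cst_continuous.
have H4 h t : `](-1 : R), 1[%classic h -> `[(0 : R), 1]%classic t ->
    `|partial1of2 f h t| <= cst M t.
  rewrite /= !in_itv /= => /andP[h1 h2] /andP[t0 t1].
  rewrite P1 normrM -[leRHS]mul1r; apply: ler_pM => //.
    by rewrite ger0_norm ?exprn_ge0 // exprn_ile1.
  apply: HM; rewrite normrZ ger0_norm //.
  apply: le_trans (ler_piMl _ t1) _ => //.
  rewrite addrC; apply: le_trans (ler_normD _ _) _; rewrite lerD2l.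
  apply: norm_le_coord => // j; rewrite !mxE eqxx /= normrM.
  have h1' : `|h| <= 1 by rewrite ler_norml !ltW.
  by case: (j == i); rewrite ?normr1 ?mulr1 // normr0 mulr0.
have Md (t : R) : 0 <= cst M t by [].
split; first exact (derivable_under_integral I01 I0 H1 H2 Md H3 H4).
rewrite -derive1E (differentiation_under_integral I01 I0 H1 H2 Md H3 H4).
rewrite /ray_int; apply: eq_Rintegral => t _.
by rewrite P1 scale0r add0r.
Qed.

Lemma ray_int_Ck a F : csmooth setT F -> csmooth setT (ray_int a F : _ -> R^o).
Proof.
move=> HF k; elim: k a F HF => [|k IH] a F HF.
  by split=> // x _; exact: ray_int_continuous (HF 1%N) x.
split=> [x _|i]; first exact: ray_int_continuous (HF 1%N) x.
split=> [x _|].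
  exact: (@ex_derive _ _ _ _ _ _ _ (ray_int_is_derive a x i (HF 1%N))).
rewrite (_ : 'D_ _ _ = (ray_int a.+1 ('D_(delta_mx 0 i) F) : _ -> R^o)).
  by apply: IH => l; exact: ((HF l.+1).2 i).2.
by apply/funext => x; have [_ ->] := ray_int_is_derive a x i (HF 1%N).
Qed.

(** Fundamental theorem of calculus for t -> F(t x) on [0, 1]; the chain rule brings out the
    coordinates of x as factors. *)
Lemma hadamard0 F x : csmooth setT F ->
  F x = F 0 + \sum_i x ord0 i * ray_int 0 ('D_(delta_mx 0 i) F) x.
Proof.
move=> HF.
pose df t := \sum_i x ord0 i * 'D_(delta_mx 0 i) F (t *: x).
have D t : is_derive t (1 : R) (fun t : R => F (t *: x)) (df t).
  have [dF dFE] := Ck_differentiable openT (HF 1%N) (I : setT (t *: x)).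
  have dl := @is_derive_line R n F 0 x t.
  have dl' : derivable F (t *: x + 0) x by rewrite addr0; exact: diff_derivable.
  move: {dl dl'} (dl dl'); rewrite addr0 deriveE // dFE.
  rewrite (_ : (fun s : R => F (s *: x + 0)) = fun s : R => F (s *: x)); last first.
    by apply/funext => s; rewrite addr0.
  by move=> h; apply: is_derive_eq h _; apply: eq_bigr => i _; rewrite mulrC.
have cdf i : continuous (fun t : R => x ord0 i * 'D_(delta_mx 0 i) F (t *: x) : R^o).
  move=> t; apply: (@continuousM R R (fun=> x ord0 i) (fun t => 'D_(delta_mx 0 i) F (t *: x)) t).
    exact: cst_continuous.
  have cD : continuous ('D_(delta_mx 0 i) F) by move=> z; exact: ((HF 1%N).2 i).2.1.
  exact: (@ray_comp_continuous _ x cD t).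
have cF : continuous (fun t : R => F (t *: x)).
  by move=> t; apply/differentiable_continuous/derivable1_diffP; exact: ex_derive.
have cdfs : continuous (df : R -> R^o).
  by apply: continuous_big => // z; exact: add_continuous.
have fE : \int[mu]_(t in `[0, 1]) df t = F x - F 0.
  have := @continuous_FTC2 R df (fun t : R => F (t *: x)) 0 1 ltr01.
  rewrite /Rintegral scale1r scale0r => ->.
  - by rewrite -EFinB.
  - exact: continuous_subspaceT.
  - split; first by move=> t _; exact: ex_derive.
      by apply: cvg_at_right_filter; exact: cF.
    by apply: cvg_at_left_filter; exact: cF.
  - by move=> t _; rewrite derive1E; exact: derive_val.
rewrite -[LHS](subrK (F 0)) addrC -fE; congr (_ + _).
rewrite Rint01_sum //; apply: eq_bigr => i _.
rewrite RintegralZl; [|exact: I01|].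
  by congr (_ * _); apply: eq_Rintegral => t _; rewrite expr0 mul1r.
apply: (@continuous_integrable01 (fun t => 'D_(delta_mx 0 i) F (t *: x))).
have cD : continuous ('D_(delta_mx 0 i) F) by move=> z; exact: ((HF 1%N).2 i).2.1.
exact: (@ray_comp_continuous _ x cD).
Qed.

(** Translation moves the centre from 0 to y. The values of the coefficients at y are what
    identifies a derivation with a combination of partial derivatives in [frame_span]. *)
Lemma hadamard F y : csmooth setT F -> exists g : 'I_n -> 'rV[R]_n -> R^o,
  [/\ forall i, csmooth setT (g i),
      forall x, F x = F y + \sum_i (x ord0 i - y ord0 i) * g i x
    & forall i, g i y = 'D_(delta_mx 0 i) F y].
Proof.
move=> HF.
have shC (c : 'rV[R]_n) (G : 'rV[R]_n -> R^o) :
    csmooth setT G -> csmooth setT (fun x => G (x + c)).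
  move=> HG k; apply: (Ck_comp openT openT (f := G) (g := fun x => x + c)) => // i.
  rewrite (_ : (fun _ => _) = (fun x : 'rV[R]_n => x ord0 i : R^o) \+ cst (c ord0 i)).
    apply: Ck_add; [exact: openT|exact: Ck_coord|exact: Ck_cst].
  by apply/funext => x; rewrite mxE.
pose G x : R^o := F (x + y).
have HG : csmooth setT G by exact: shC.
have DG i x : 'D_(delta_mx 0 i) G x = 'D_(delta_mx 0 i) F (x + y).
  rewrite /derive (_ : (fun h : R => h^-1 *: ((G \o shift x) (h *: delta_mx 0 i) - G x))
     = fun h : R => h^-1 *: ((F \o shift (x + y)) (h *: delta_mx 0 i) - F (x + y))) //.
  by apply/funext => h; rewrite /G /= addrA.
exists (fun i x => ray_int 0 ('D_(delta_mx 0 i) G) (x + - y)); split.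
- move=> i; apply: shC; apply: ray_int_Ck => k; exact: ((HG k.+1).2 i).2.
- move=> x; have := hadamard0 (x - y) HG; rewrite /G subrK add0r => ->.
  by congr (_ + _); apply: eq_bigr => i _; rewrite !mxE.
- move=> i; rewrite subrr /ray_int -[RHS]Rint01_cst; apply: eq_Rintegral => t _.
  by rewrite expr0 mul1r scaler0 DG add0r.
Qed.

End Hadamard.

(** * Bump functions and local frames on manifolds *)

Section Charts.
Context {R : realType} {n : nat} {M : manifold R n}.
Implicit Types (c : chart R n M) (p q : M) (f g : Cinf M).

Lemma coordK c x : (coord c @` cdom c) x -> coord c (param c x) = x.
Proof. by move=> [q cq <-]; rewrite paramK. Qed.

Lemma param_cdom c x : (coord c @` cdom c) x -> cdom c (param c x).
Proof. by move=> [q cq <-]; rewrite paramK. Qed.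

Lemma smooth_on_local (U : set M) (f : M -> R) : open U ->
  (forall p, U p -> exists2 V, open V /\ V p & smooth_on V f) -> smooth_on U f.
Proof.
move=> oU H c ac k; apply: Ck_local => _ [p [cp Up] <-].
have [V [oV Vp] sV] := H p Up.
exists (coord c @` (cdom c `&` V)); last exact: sV.
by split; [exact: open_coord|exists p].
Qed.

Lemma smooth_on_ext (U : set M) (f g : M -> R) : open U ->
  {in U, f =1 g} -> smooth_on U f -> smooth_on U g.
Proof.
move=> oU fg sf c ac k; apply: Ck_ext (sf c ac k); first exact: open_coord.
move=> _ /set_mem [p [cp Up] <-] /=; rewrite paramK //.
by apply: fg; exact/mem_set.
Qed.

Lemma smooth_near (f : M -> R) :
  (forall p, exists2 g : M -> R, smooth g & \forall q \near p, f q = g q) -> smooth f.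
Proof.
move=> H; apply: smooth_on_local => [|p _]; first exact: openT.
have [g sg /=] := H p; rewrite /prop_near1 nbhsE => -[V [oV Vp] VE].
exists V => //; apply: (@smooth_on_ext _ g) => // [q /set_mem /VE -> //|].
exact: smooth_onS openT oV (@subsetT _ _) sg.
Qed.

Lemma chart_bump c (W : set M) p : open W -> cdom c p -> W p ->
  exists (b : 'rV[R]_n -> R^o) (e : R), [/\ 0 < e, csmooth setT b,
    forall x, `|x - coord c p| < e -> b x = 1,
    forall x, 2 * e <= `|x - coord c p| -> b x = 0 &
    forall x, `|x - coord c p| <= 2 * e -> (coord c @` (cdom c `&` W)) x].
Proof.
move=> oW cp Wp.
have : nbhs (coord c p) (coord c @` (cdom c `&` W)).
  by apply: open_nbhs_nbhs; split; [exact: open_coord|exists p].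
move=> /nbhs_ballP[d /= d0 dP].
(* A third of the radius leaves the closed ball of radius 2 d / 3 inside the open ball of radius
   d. *)
have e0 : 0 < d / 3 by rewrite divr_gt0.
have [b [b1 b2 b3]] := Ck_bump (coord c p) e0.
exists b, (d / 3); split=> // x xd; apply: dP.
rewrite -ball_normE /= distrC; apply: le_lt_trans xd _; lra.
Qed.

(* The cut-off of a function given in the chart [c], extended by zero. *)
Definition hat c (b g : 'rV[R]_n -> R) q : R :=
  if `[< cdom c q >] then b (coord c q) * g (coord c q) else 0.

Lemma closed_norm_ball (x0 : 'rV[R]_n) (r : R) : closed [set x | `|x - x0| <= r].
Proof.
apply: (@preimage_closed _ _ (fun x : 'rV[R]_n => `|x - x0|) [set t | t <= r]).
  have H (x : 'rV[R]_n) : (fun y : 'rV[R]_n => `|y - x0|) @ x --> `|x - x0|.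
    apply: (@cvg_norm _ _ _ _ (nbhs_filter x)).
    apply: (@cvgB _ _ _ _ (nbhs_filter x) id (cst x0)); first exact: cvg_id.
    exact: cvg_cst.
  by move=> x _; exact: H.
exact: closed_le.
Qed.

(** The image is compact, hence closed because the manifold is Hausdorff; this is what makes
    extension by zero smooth across the boundary of a chart. *)
Lemma closed_ball_image c (W : set M) p (r : R) : open W ->
  (forall x, `|x - coord c p| <= r -> (coord c @` (cdom c `&` W)) x) ->
  closed (param c @` [set x | `|x - coord c p| <= r]).
Proof.
move=> oW Br; apply: compact_closed; first exact: m_hausdorff.
apply: continuous_compact.
  apply: continuous_in_subspaceT => x /set_mem /= /Br [q [cq Wq] <-].
  by apply: param_cont; exists q.
apply: bounded_closed_compact.
  exists (r + `|coord c p|); split; first exact: num_real.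
  move=> s rs x /= xr; apply: le_trans (ltW rs).
  rewrite -[x in leLHS](subrK (coord c p)); apply: le_trans (ler_normD _ _) _.
  by rewrite lerD2r.
exact: closed_norm_ball.
Qed.

Lemma hat_near0 c (W : set M) p (b g : 'rV[R]_n -> R) (r : R) q : open W ->
  (forall x, r <= `|x - coord c p| -> b x = 0) ->
  (forall x, `|x - coord c p| <= r -> (coord c @` (cdom c `&` W)) x) ->
  ~ W q -> exists2 V, open V /\ V q & forall q', V q' -> hat c b g q' = 0.
Proof.
move=> oW b0 Br Wq.
exists (~` (param c @` [set x | `|x - coord c p| <= r])).
  split; first by apply: closed_openC; exact: closed_ball_image Br.
  by move=> [x /= /Br [q' [cq' Wq'] <-]]; rewrite paramK // => E; rewrite E in Wq'.
move=> q' H; rewrite /hat; case: asboolP => // cq'.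
rewrite b0 ?mul0r // leNgt; apply/negP => h; apply: H.
by exists (coord c q'); [exact: ltW|exact: paramK].
Qed.

(** At points of [W] in the chart, any other chart sees b g composed with a smooth transition map;
    near every other point the function is zero by [hat_near0]. *)
Lemma hat_smooth c (W : set M) p (b g : 'rV[R]_n -> R) (r : R) : atlas c -> open W ->
  (forall x, r <= `|x - coord c p| -> b x = 0) ->
  (forall x, `|x - coord c p| <= r -> (coord c @` (cdom c `&` W)) x) ->
  csmooth setT (b : _ -> R^o) -> csmooth (coord c @` (cdom c `&` W)) (g : _ -> R^o) ->
  smooth (hat c b g).
Proof.
move=> ac oW b0 Br sb sg; apply: smooth_on_local => [|q _]; first exact: openT.
have [[cq Wq]|] := pselect ((cdom c `&` W) q); last first.
  move=> H; have Wq : ~ (cdom c `&` W) q by [].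
  have Br' x : `|x - coord c p| <= r -> (coord c @` (cdom c `&` (cdom c `&` W))) x.
    by move=> /Br [q' [? ?] <-]; exists q'.
  have oW' : open (cdom c `&` W) by apply: openI => //; exact: cdom_open.
  have [V oV V0] := hat_near0 g oW' b0 Br' Wq.
  exists V => //; apply: (@smooth_on_ext _ (fun=> 0)) => [|q' /set_mem/V0 -> //|]; first by case: oV.
  exact: smooth_on_cst.
exists (cdom c `&` W); first by split=> //; apply: openI => //; exact: cdom_open.
move=> c' ac' k.
have oD : open (coord c' @` (cdom c' `&` (cdom c `&` W))).
  by apply: open_coord; apply: openI => //; exact: cdom_open.
have oI : open (coord c @` (cdom c `&` W)) by exact: open_coord.
apply: (Ck_ext oD (f := (b \* g) \o (fun x => coord c (param c' x)))).
  move=> _ /set_mem [q' [c'q' [cq' Wq']] <-] /=.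
  by rewrite /hat paramK //; case: asboolP.
apply: Ck_comp oD oI _ _ _.
- by move=> _ [q' [c'q' [cq' Wq']] <-]; rewrite paramK //; exists q'.
- move=> i; apply: (CkS (U := coord c' @` (cdom c' `&` cdom c))).
    by apply: image_subset => q' [? []].
  exact: atlas_compat.
- by apply: Ck_mul; [exact: open_coord|exact: CkS (@subsetT _ _) (sb k)|].
Qed.

Lemma bump p (W : set M) : open W -> W p -> exists phi : Cinf M,
  (\forall q \near p, phi q = 1) /\
  (forall q, ~ W q -> \forall q' \near q, phi q' = 0).
Proof.
move=> oW Wp; have [c ac cp] := atlas_cover p.
have [b [e [e0 sb b1 b0 Br]]] := chart_bump oW cp Wp.
have sH : smooth (hat c b (fun=> 1)).
  by apply: hat_smooth ac oW b0 Br sb _ => k; exact: Ck_cst.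
exists (mkCinf sH); split=> [|q Wq]; last first.
  have [V [oV Vq] V0] := hat_near0 (fun=> 1) oW b0 Br Wq.
  apply: filterS V0 _; exact: open_nbhs_nbhs.
have nb : nbhs p (cdom c `&` coord c @^-1` (ball (coord c p) e)).
  apply: filterI; first by apply: open_nbhs_nbhs; split=> //; exact: cdom_open.
  by apply: (coord_cont cp); exact: nbhsx_ballx.
apply: filterS nb => q [cq]; rewrite -ball_normE /= distrC => h.
by rewrite /hat; case: asboolP => // _; rewrite b1 // mulr1.
Qed.

Lemma CinfDE f g q : (f + g) q = f q + g q. Proof. by []. Qed.
Lemma CinfBE f g q : (f - g) q = f q - g q. Proof. by []. Qed.
Lemma CinfNE f q : (- f) q = - f q. Proof. by []. Qed.
Lemma CinfME f g q : (f * g) q = f q * g q. Proof. by []. Qed.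
Lemma Cinf_sumE m (f : 'I_m -> Cinf M) q : (\sum_i f i) q = \sum_i f i q.
Proof. by apply: (big_morph (fun f : Cinf M => f q)). Qed.

Lemma Tan0 p (v : Tan p) (a : R) : v (mkCinf (smooth_on_cst setT a)) = 0.
Proof.
have one : v 1 = 0.
  have := Tan_leibniz v 1 1; rewrite mulr1 mul1r => h.
  by apply: (@addrI _ (v 1)); rewrite addr0 -h.
have zero : v 0 = 0.
  by have := Tan_linear v (-1) 0 0; rewrite scaler0 addr0 mulN1r addNr.
have -> : mkCinf (smooth_on_cst setT a) = (a *: (1 : Cinf M) + 0 : Cinf M).
  by rewrite addr0; apply: val_inj; apply/funext => q /=; rewrite [RHS]mulr1.
by rewrite Tan_linear one zero mulr0 addr0.
Qed.

Lemma TanD p (v : Tan p) f g : v (f + g) = v f + v g.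
Proof. by have := Tan_linear v 1 f g; rewrite scale1r mul1r. Qed.

Lemma TanB p (v : Tan p) f g : v (f - g) = v f - v g.
Proof. by have := Tan_linear v (-1) g f; rewrite scaleN1r mulN1r addrC => ->; rewrite addrC. Qed.

Lemma Tan_sum p (v : Tan p) m (f : 'I_m -> Cinf M) : v (\sum_i f i) = \sum_i v (f i).
Proof.
apply: (big_morph v); first exact: TanD.
by have := TanB v 0 0; rewrite !subrr.
Qed.

Lemma sum_TanE p m (v : 'I_m -> Tan p) f : (\sum_i v i : Tan p) f = \sum_i v i f.
Proof. by apply: (big_morph (fun v : Tan p => v f)). Qed.

(** A bump function phi at p with phi (f - g) = 0 reduces the Leibniz rule to v (f - g) = 0.
    Derivations act on global functions, so locality has to be proved. *)
Lemma Tan_local p (v : Tan p) f g : (\forall q \near p, f q = g q) -> v f = v g.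
Proof.
move=> fg; apply/subr0_eq; rewrite -TanB.
move: fg; rewrite /prop_near1 nbhsE => -[V [oV Vp] VE].
have [phi [phi1 phi0]] := bump oV Vp.
have : phi * (f - g) = 0.
  apply: val_inj; apply/funext => q /=.
  have [Vq|/phi0 Vq] := pselect (V q); first by rewrite [RHS]/= [_ * _]/= !fctE VE // subrr mulr0.
  by rewrite fctE (nbhs_singleton Vq) mul0r.
move=> /(congr1 v); rewrite Tan_leibniz (nbhs_singleton phi1) mul1r.
have -> : (f - g) p = 0 by rewrite /= !fctE VE ?subrr.
by rewrite mul0r addr0 => ->; have := TanB v 0 0; rewrite !subrr.
Qed.

Section Frame.
Variables (c : chart R n M) (b : 'rV[R]_n -> R^o) (e : R) (p : M).
Hypotheses (ac : atlas c) (cp : cdom c p) (e0 : 0 < e) (sb : csmooth setT b)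
  (b1 : forall x, `|x - coord c p| < e -> b x = 1)
  (b0 : forall x, 2 * e <= `|x - coord c p| -> b x = 0)
  (Br : forall x, `|x - coord c p| <= 2 * e -> (coord c @` (cdom c `&` setT)) x).

Lemma hat_smooth_setT (g : 'rV[R]_n -> R^o) : csmooth (coord c @` cdom c) g ->
  smooth (hat c b g).
Proof.
move=> sg; apply: (hat_smooth ac openT b0 Br sb).
by rewrite setIT.
Qed.

Lemma param_smooth f : csmooth (coord c @` cdom c) (f \o param c).
Proof. by have := Cinf_smooth f ac; rewrite setIT. Qed.

Lemma hat_near (g : 'rV[R]_n -> R) q : cdom c q -> `|coord c q - coord c p| < e ->
  hat c b g q = g (coord c q).
Proof. by move=> cq h; rewrite /hat; case: asboolP => // _; rewrite b1 // mul1r. Qed.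

Let pd i f : 'rV[R]_n -> R^o := 'D_(delta_mx 0 i) (f \o param c).

Lemma pd_smooth i f : csmooth (coord c @` cdom c) (pd i f).
Proof. by move=> k; exact: ((param_smooth f k.+1).2 i).2. Qed.

(** Coordinate derivations exist only on the chart; the cut-off extends them to global functions and
    changes nothing on [frame_dom]. *)
Let Efun i f : Cinf M := mkCinf (hat_smooth_setT (pd_smooth i f)).

Lemma Efun_deriv i : Efun i \in @deriv_pred R n M.
Proof.
have D f x : (coord c @` cdom c) x -> derivable (f \o param c : _ -> R^o) x (delta_mx 0 i).
  by move=> cx; exact: ((param_smooth f 1%N).2 i).1.
apply/asboolP; split=> [a f g|f g]; apply: val_inj; apply/funext => q /=;
  rewrite !fctE /hat; case: asboolP => cq; rewrite ?mulr0 ?addr0 //.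
  have cx : (coord c @` cdom c) (coord c q) by exists q.
  rewrite /pd (_ : _ \o param c = (a \*: (f \o param c)) \+ (g \o param c) :> (_ -> R^o)) //.
  rewrite deriveD; [|exact: derivableZ (D _ _ cx)|exact: D].
  by rewrite deriveZ; [rewrite mulrDr mulrCA|exact: D].
have cx : (coord c @` cdom c) (coord c q) by exists q.
rewrite /pd (_ : _ \o param c = (f \o param c) * (g \o param c) :> (_ -> R^o)) //.
rewrite deriveM; [|exact: D|exact: D].
by rewrite /GRing.scale /= paramK // mulrDr; congr (_ + _); rewrite mulrCA.
Qed.

Definition frame_vf i : vfield M := MkVfield (Efun_deriv i).

Lemma csmooth_coord i : csmooth (coord c @` cdom c) (fun x : 'rV[R]_n => x ord0 i : R^o).
Proof. by move=> k; exact: Ck_coord. Qed.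

Definition frame_coord i : Cinf M := mkCinf (hat_smooth_setT (csmooth_coord i)).

Definition frame_dom : set M := [set q | cdom c q /\ `|coord c q - coord c p| < e].

Lemma frame_dom_nbhs q : frame_dom q -> nbhs q frame_dom.
Proof.
move=> [cq qe]; apply: filterI.
  by apply: open_nbhs_nbhs; split=> //; exact: cdom_open.
have [d d0 dE] : exists2 d, 0 < d & `|coord c q - coord c p| + d = e.
  by exists (e - `|coord c q - coord c p|); [rewrite subr_gt0|rewrite addrC subrK].
have nb : nbhs q (coord c @^-1` ball (coord c q) d).
  by apply: (coord_cont cq); exact: nbhsx_ballx.
apply: filterS nb => q' /=.
rewrite -ball_normE /= distrC -dE => h.
rewrite -[coord c q' in ltLHS](subrK (coord c q)) -addrA.
by rewrite (le_lt_trans (ler_normD _ _)) // [ltLHS]addrC ltrD2l.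
Qed.

Lemma frame_dom_open : open frame_dom.
Proof. by rewrite openE => q /frame_dom_nbhs. Qed.

Lemma near_range q : frame_dom q ->
  \forall x \near coord c q, (coord c @` cdom c) x /\ `|x - coord c p| < e.
Proof.
move=> Uq; have := frame_dom_open; move/(@open_coord _ _ _ c) => oD.
have : nbhs (coord c q) (coord c @` (cdom c `&` frame_dom)).
  by apply: open_nbhs_nbhs; split=> //; exists q => //; split=> //; case: Uq.
by apply: filterS => _ [q' [cq' [_ h]] <-]; split=> //; exists q'.
Qed.

Lemma frame_dual q i j : frame_dom q -> frame_vf i (frame_coord j) q = (i == j)%:R.
Proof.
move=> Uq; have [cq qe] := Uq.
rewrite /= hat_near // /pd.
rewrite (@near_eq_derive _ _ _ _ (fun x : 'rV[R]_n => x ord0 j : R^o)).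
  by have [_ ->] := is_derive_coord (coord c q) j i.
apply: filterS (near_range Uq) => x [cx xe] /=.
by rewrite hat_near ?coordK //; exact: param_cdom.
Qed.

(** By Hadamard's lemma f is, near q, a constant plus products of functions vanishing at q with
    smooth functions; the Leibniz rule leaves only the values of v on the coordinates. *)
Lemma frame_span q (v : Tan q) : frame_dom q ->
  v = \sum_i v (frame_coord i) *: vf_at (frame_vf i) q.
Proof.
move=> Uq; have [cq qe] := Uq; apply: TanP => f; rewrite sum_TanE.
(* [hadamard] requires smoothness on all of R^n; the cut-off provides it and does not change f near
   q. *)
pose F : 'rV[R]_n -> R^o := b \* (f \o param c).
have sF : csmooth setT F.
  move=> k; apply: Ck_local => x _.
  have [h|h] := leP `|x - coord c p| (2 * e).
    exists (coord c @` cdom c); first split; first exact: crange_open.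
      by have := Br h; rewrite setIT.
    apply: Ck_mul; [exact: crange_open|exact: CkS (@subsetT _ _) (sb k)|exact: param_smooth].
  have oV : open (~` [set x | `|x - coord c p| <= 2 * e]).
    by apply: closed_openC; exact: closed_norm_ball.
  exists (~` [set x | `|x - coord c p| <= 2 * e]).
    by split=> //=; apply/negP; rewrite -ltNge.
  apply: (Ck_ext oV (f := fun=> 0)); last exact: Ck_cst.
  by move=> z /set_mem /= /negP; rewrite -ltNge /F /= => /ltW/b0 ->; rewrite mul0r.
have [g [sg gE gy]] := hadamard (coord c q) sF.
have sg' i : csmooth (coord c @` cdom c) (g i).
  by move=> k; exact: CkS (@subsetT _ _) (sg i k).
pose h i : Cinf M := mkCinf (hat_smooth_setT (sg' i)).
pose cst_ a : Cinf M := mkCinf (smooth_on_cst setT a).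
have -> : v f = v (cst_ (f q) + \sum_i (frame_coord i - cst_ (coord c q ord0 i)) * h i).
  apply: Tan_local; apply: filterS (frame_dom_nbhs Uq) => q' [cq' q'e].
  rewrite CinfDE Cinf_sumE.
  have E i : ((frame_coord i - cst_ (coord c q ord0 i)) * h i) q' =
      (coord c q' ord0 i - coord c q ord0 i) * g i (coord c q').
    by rewrite CinfME CinfBE /= !hat_near.
  rewrite (eq_bigr _ (fun i _ => E i)).
  by have := gE (coord c q'); rewrite /F /= !b1 // !mul1r !paramK.
rewrite TanD Tan0 add0r Tan_sum; apply: eq_bigr => i _.
rewrite Tan_leibniz TanB Tan0 subr0 /= !fctE !hat_near // subrr mul0r add0r.
rewrite mulrC; congr (_ * _); rewrite gy /pd; apply: near_eq_derive.
apply: filterS (near_range Uq) => x [cx xe] /=.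
by rewrite /F /= b1 // mul1r.
Qed.

End Frame.

Lemma local_frame p : exists (U : set M) (f : 'I_n -> Cinf M) (E : 'I_n -> vfield M),
  [/\ open U, U p, forall q i j, U q -> E i (f j) q = (i == j)%:R &
     forall q (v : Tan q), U q -> v = \sum_i v (f i) *: vf_at (E i) q].
Proof.
have [c ac cp] := atlas_cover p.
have [b [e [e0 sb b1 b0 Br]]] := @chart_bump c setT p openT cp I.
exists (frame_dom c e p), (frame_coord ac sb b0 Br), (frame_vf ac sb b0 Br).
split.
- exact: frame_dom_open.
- by split=> //; rewrite subrr normr0.
- by move=> q i j Uq; exact: frame_dual.
- by move=> q v Uq; exact: frame_span.
Qed.

End Charts.

(** * Gluing, germs and tensoriality *)

Section Glue.
Context {R : realType} {n : nat} {M : manifold R n}.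
Implicit Types (p q : M) (f g : Cinf M) (X Y : vfield M).

Lemma CinfP f g : (forall q, f q = g q) -> f = g.
Proof. by move=> fg; apply: val_inj; exact/funext. Qed.

Lemma vfield_at X Y : (forall q, vf_at X q = vf_at Y q) -> X = Y.
Proof.
move=> XY; apply: vfieldP => f; apply: CinfP => q.
by have := congr1 (fun v : Tan q => v f) (XY q).
Qed.

Lemma vf_at0 q : vf_at (0 : vfield M) q = 0. Proof. exact: TanP. Qed.
Lemma vf_atD X Y q : vf_at (X + Y) q = vf_at X q + vf_at Y q. Proof. exact: TanP. Qed.
Lemma vf_atB X Y q : vf_at (X - Y) q = vf_at X q - vf_at Y q. Proof. exact: TanP. Qed.
Lemma vf_atN X q : vf_at (- X) q = - vf_at X q. Proof. exact: TanP. Qed.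
Lemma vf_atZ f X q : vf_at (f *: X) q = f q *: vf_at X q. Proof. exact: TanP. Qed.

Lemma vf_at_sum m (X : 'I_m -> vfield M) q :
  vf_at (\sum_i X i) q = \sum_i vf_at (X i) q.
Proof. by apply: (big_morph (fun X => vf_at X q)); [move=> ? ?; exact: vf_atD|exact: vf_at0]. Qed.

Definition cst_fun (a : R) : Cinf M := mkCinf (smooth_on_cst setT a).

Lemma Tan_ext q (v : Tan q) : exists X, vf_at X q = v.
Proof.
have [U [f [E [oU Uq _ sp]]]] := local_frame q.
exists (\sum_i cst_fun (v (f i)) *: E i).
rewrite vf_at_sum [RHS](sp q v Uq); apply: eq_bigr => i _.
by rewrite vf_atZ.
Qed.

Lemma mk_vfield (v : forall q, Tan q) : (forall f, smooth (fun q => v q f)) ->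
  exists X, forall q, vf_at X q = v q.
Proof.
move=> sv; pose F f : Cinf M := mkCinf (sv f).
have dF : F \in @deriv_pred R n M.
  apply/asboolP; split=> [a f g|f g]; apply: CinfP => q /=.
    exact: Tan_linear.
  exact: Tan_leibniz.
by exists (MkVfield dF) => q; apply: TanP.
Qed.

Lemma glue_vfield (v : forall q, Tan q) :
  (forall p, exists X, \forall q \near p, v q = vf_at X q) ->
  exists X, forall q, vf_at X q = v q.
Proof.
move=> H; apply: mk_vfield => f; apply: smooth_near => p.
have [X HX] := H p; exists (X f); first exact: Cinf_smooth.
by apply: filterS HX => q ->.
Qed.

Lemma glue_Cinf (u : M -> R) : (forall p, exists f, \forall q \near p, u q = f q) ->
  exists f, forall q, f q = u q.
Proof.
move=> H; have su : smooth u.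
  by apply: smooth_near => p; have [f Hf] := H p; exists f => //; exact: Cinf_smooth.
by exists (mkCinf su).
Qed.

Lemma smooth_on_Cinf (U : set M) f : open U -> smooth_on U f.
Proof. by move=> oU; exact: smooth_onS openT oU (@subsetT _ _) (Cinf_smooth f). Qed.

Lemma cutoff_smooth (phi : Cinf M) (U : set M) (u : M -> R) : open U ->
  (forall q, ~ U q -> \forall q' \near q, phi q' = 0) -> smooth_on U u ->
  smooth (fun q => phi q * u q).
Proof.
move=> oU phi0 su; apply: smooth_on_local => [|q _]; first exact: openT.
have [Uq|/phi0] := pselect (U q).
  exists U => //; apply: smooth_on_mul => //; exact: smooth_on_Cinf.
rewrite /prop_near1 nbhsE => -[V [oV Vq] VE]; exists V => //.
apply: (@smooth_on_ext _ _ _ _ (fun=> 0)) => //; last exact: smooth_on_cst.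
by move=> q' /set_mem/VE ->; rewrite mul0r.
Qed.

Lemma germ_extend (U : set M) (u : M -> R) p : open U -> U p -> smooth_on U u ->
  exists f, \forall q \near p, f q = u q.
Proof.
move=> oU Up su; have [phi [phi1 phi0]] := bump oU Up.
exists (mkCinf (cutoff_smooth oU phi0 su)).
by apply: filterS phi1 => q /= ->; rewrite mul1r.
Qed.

Lemma Cinf_continuous f : continuous f.
Proof.
move=> p; have [c ac cp] := atlas_cover p.
have cx : (coord c @` (cdom c `&` setT)) (coord c p) by exists p.
have := Ck_cont (Cinf_smooth f ac 0) cx.
move=> cf; have H : (f \o param c) \o coord c @ p --> f p.
  rewrite -[X in _ --> f X](paramK cp).
  by apply: (@continuous_comp _ _ _ (coord c) (f \o param c)); [exact: coord_cont|exact: cf].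
apply: cvg_trans H; apply: near_eq_cvg.
have : nbhs p (cdom c) by apply: open_nbhs_nbhs; split=> //; exact: cdom_open.
by apply: filterS => q cq /=; rewrite paramK.
Qed.

Lemma open_gt0 f : open [set q | 0 < f q].
Proof.
rewrite openE => p /= fp.
have := Cinf_continuous (lt_nbhsr fp).
by apply.
Qed.

(** Members of [Cinf] are defined on the whole manifold, so an inverse root is represented only near
    a point where f is positive. It normalizes vectors in [on_exists_k]. *)
Lemma invsqrt_germ f p : 0 < f p ->
  exists g, \forall q \near p, g q ^+ 2 * f q = 1.
Proof.
move=> fp.
have [g Hg] : exists g, \forall q \near p, g q = (Num.sqrt (f q))^-1.
  apply: (germ_extend (open_gt0 f) fp) => c ac k.
  apply: (@Ck_invsqrt _ _ k (coord c @` (cdom c `&` [set q | 0 < f q])) (f \o param c)).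
  - by apply: open_coord; exact: open_gt0.
  - by move=> _ [q [cq fq] <-] /=; rewrite paramK.
  - exact: smooth_on_Cinf (open_gt0 f) _ ac k.
exists g; have f0 : nbhs p [set q | 0 < f q].
  by apply: open_nbhs_nbhs; split=> //; exact: open_gt0.
apply: filterS2 Hg f0 => q -> /= fq.
by rewrite exprVn sqr_sqrtr ?ltW // mulVf // gt_eqF.
Qed.

Lemma inv_germ f p : f p != 0 -> exists g, \forall q \near p, g q * f q = 1.
Proof.
move=> fp; have f2 : 0 < (f * f) p by rewrite CinfME -expr2 exprn_even_gt0.
have [g Hg] := invsqrt_germ f2; exists (g * g * f).
by apply: filterS Hg => q; rewrite !CinfME => <-; rewrite expr2 !mulrA.
Qed.

Section Tensor.
Variables (S : lmodType (Cinf M)) (W : lmodType R) (p : M) (ev : S -> W).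
Hypothesis evL : forall f s t, ev (f *: s + t) = f p *: ev s + ev t.

Lemma ev0 : ev 0 = 0.
Proof.
have := evL (-1) 0 0; rewrite scaler0 addr0 => ->.
by rewrite CinfNE /= scaleN1r addNr.
Qed.

Lemma evZ f s : ev (f *: s) = f p *: ev s.
Proof. by rewrite -[f *: s]addr0 evL ev0 addr0. Qed.

Lemma evD s t : ev (s + t) = ev s + ev t.
Proof. by rewrite -[s]scale1r evL !scale1r. Qed.

Lemma ev_sum m (s : 'I_m -> S) : ev (\sum_i s i) = \sum_i ev (s i).
Proof. by apply: (big_morph ev); [exact: evD|exact: ev0]. Qed.

(** Multiplied by a bump function, X is a combination of frame fields whose coefficients vanish at
    p; linearity over smooth functions then makes the value at p vanish. [ev] plays the role of
    evaluation at p. *)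
Lemma tensorial (F : vfield M -> S) X :
  (forall f X Y, F (f *: X + Y) = f *: F X + F Y) -> vf_at X p = 0 -> ev (F X) = 0.
Proof.
move=> FL Xp.
have F0 : F 0 = 0.
  by have := FL (-1) 0 0; rewrite scaler0 addr0 scaleN1r addNr.
have FZ f Y : F (f *: Y) = f *: F Y by rewrite -[f *: Y]addr0 FL F0 addr0.
have [U [f [E [oU Up _ sp]]]] := local_frame p.
have [phi [phi1 phi0]] := bump oU Up.
have XE : phi *: X = \sum_i (phi * X (f i)) *: E i.
  apply: vfield_at => q; rewrite vf_atZ vf_at_sum.
  have [Uq|/phi0/nbhs_singleton phiq] := pselect (U q); last first.
    by rewrite phiq scale0r big1 // => i _; rewrite vf_atZ CinfME phiq mul0r scale0r.
  rewrite {1}(sp q (vf_at X q) Uq) scaler_sumr; apply: eq_bigr => i _.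
  by rewrite vf_atZ CinfME scalerA.
have FD Y Y' : F (Y + Y') = F Y + F Y' by have := FL 1 Y Y'; rewrite !scale1r.
have := congr1 (fun Y => ev (F Y)) XE; rewrite /= FZ evZ (nbhs_singleton phi1) scale1r => ->.
rewrite (big_morph F FD F0) ev_sum big1 // => i _.
by rewrite FZ evZ CinfME (_ : X (f i) p = vf_at X p (f i)) // Xp mulr0 scale0r.
Qed.

End Tensor.

End Glue.

(** * Existence of a form tau with tau(Z) = 1 *)

Section TauExists.
Context {R : realType} {n : nat} {N : manifold R n} (L : lightlike N).

(** A countable base is injected into nat. An index coding a base set contained in some [V p]
    selects one such p; all other indices give [None]. *)
Lemma lindelof (V : N -> set N) : (forall p, open (V p) /\ V p p) ->
  exists s : nat -> option N, forall q, exists k p, s k = Some p /\ V p q.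
Proof.
move=> oV; have [B /countable_injP[g ginj] [Bo Bb]] := @m_second_countable R n N.
pose P k p := exists W, [/\ B W, g W = k & W `<=` V p].
exists (fun k => if pselect (exists p, P k p) is left h then Some (projT1 (cid h)) else None).
move=> q; have [oVq Vq] := oV q.
have [W [BW Wq] WV] := Bb q (V q) (open_nbhs_nbhs (conj oVq Vq)).
have PW : P (g W) q by exists W.
exists (g W); case: pselect => [h|[]]; last by exists q.
case: (cid h) => p /= [W' [BW' gW' W'V]]; exists p; split=> //; apply: W'V.
by rewrite (ginj W' W) ?inE.
Qed.

(* Where Z f != 0 the form df / Z f is a local solution; with phi_k = 1 near the
   k-th point and the products prod_{j<k} (1 - phi_j) as weights, the sum of the
   local solutions is locally finite and needs no paracompactness. *)
Lemma SForm_exists : exists tau : SForm L, True.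
Proof.
pose Z := lZ L.
have H p : exists fr : Cinf N * Cinf N * set N,
    [/\ open fr.2, fr.2 p & forall q, fr.2 q -> fr.1.2 q * Z fr.1.1 q = 1].
  have [f Zf] : exists f, Z f p != 0.
    apply/not_existsP => h; case/eqP: (lZ_neq0 L p); apply: TanP => f.
    by have /negP := h f; rewrite negbK => /eqP.
  have [r] := inv_germ Zf; rewrite /prop_near1 nbhsE => -[V [oV Vp] VE].
  by exists (f, r, V).
pose D p := projT1 (cid (H p)); pose f p := (D p).1.1; pose r p := (D p).1.2.
have DP p := projT2 (cid (H p)).
have [s sP] := @lindelof (fun p => (D p).2) (fun p => let: And3 a b _ := DP p in conj a b).
pose rho k : Cinf N := if s k is Some p then r p else 0.
pose ff k : Cinf N := if s k is Some p then f p else 0.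
pose phi k : Cinf N := rho k * Z (ff k).
pose S K q (v : Tan q) : R :=
  \sum_(k < K) (\prod_(j < k) (1 - phi j q)) * rho k q * v (ff k).
have SS K q (v : Tan q) :
    S K.+1 q v = S K q v + \prod_(j < K) (1 - phi j q) * rho K q * v (ff K).
  by rewrite /S big_ord_recr.
have phi1 (q : N) : exists k, (\forall q' \near q, phi k q' = 1).
  have [k [p [skp Vq]]] := sP q; exists k.
  have [oV _ h] := DP p.
  have : nbhs q (D p).2 by exact: open_nbhs_nbhs.
  by apply: filterS => q' /h; rewrite /phi /rho /ff skp.
have stab k K q (v : Tan q) : phi k q = 1 -> (k < K)%N -> S K q v = S k.+1 q v.
  move=> phik; elim: K => // K IH; rewrite ltnS leq_eqVlt => /predU1P[->//|kK].
  have P0 : \prod_(j < K) (1 - phi j q) = 0.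
    by apply/eqP/prodf_eq0; exists (Ordinal kK) => //; rewrite subr_eq0 eq_sym; apply/eqP.
  by rewrite SS IH // P0 !mul0r addr0.
pose k q := projT1 (cid (phi1 q)).
have kP q : \forall q' \near q, phi (k q) q' = 1 := projT2 (cid (phi1 q)).
pose form q (v : Tan q) := S (k q).+1 q v.
have formE j q (v : Tan q) : phi j q = 1 -> form q v = S j.+1 q v.
  move=> pj; have pk := nbhs_singleton (kP q).
  rewrite /form.
  by rewrite -(@stab (k q) (maxn (k q) j).+1) ?ltnS ?leq_maxl // -(@stab j (maxn (k q) j).+1) ?ltnS ?leq_maxr.
have lin q : scalar (@form q).
  move=> a u v; rewrite /form /S mulr_sumr -big_split; apply: eq_bigr => i _ /=.
  by rewrite fctE mulrDr; congr (_ + _); rewrite mulrCA.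
have smo (V : vfield N) : smooth (fun q => form q (vf_at V q)).
  apply: smooth_near => p.
  exists (\sum_(i < (k p).+1) (\prod_(j < i) (1 - phi j)) * rho i * V (ff i)); first exact: Cinf_smooth.
  apply: filterS (kP p) => q h; rewrite (formE _ _ _ h) Cinf_sumE; apply: eq_bigr => i _.
  rewrite !CinfME; congr (_ * _ * _).
  by rewrite (big_morph (fun f : Cinf N => f q) (id1 := 1) (op1 := *%R)).
pose tau := OneForm lin smo.
have tau1 q : tau q (vf_at Z q) = 1.
  rewrite /= /form.
  (* The weights telescope: the sum over k < K of phi_k prod_{j<k} (1 - phi_j) is 1 - prod_{j<K} (1
     - phi_j), and the last product vanishes once some phi_j equals 1. *)
  have E K : S K q (vf_at Z q) = 1 - \prod_(j < K) (1 - phi j q).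
    elim: K => [|K IH]; first by rewrite /S !big_ord0 subrr.
    have PP : \prod_(j < K.+1) (1 - phi j q) = \prod_(j < K) (1 - phi j q) * (1 - phi K q).
      by rewrite big_ord_recr.
    by rewrite SS IH PP -mulrA (_ : rho K q * _ = phi K q) //; ring.
  have P0 : \prod_(j < (k q).+1) (1 - phi j q) = 0.
    apply/eqP/prodf_eq0; exists ord_max => //; rewrite subr_eq0 eq_sym; apply/eqP.
    exact: (nbhs_singleton (kP q)).
  by rewrite E P0 subr0.
by exists (MkSForm tau1).
Qed.

End TauExists.

(** * Orthonormal frames and the forms tau *)

Section Dimension.
Context {R : realType} {V : lmodType R} {n : nat}.
Variable phi : {linear V -> 'rV[R]_n}.

Lemma mul_row_comb k (u : 'I_k -> V) (c : 'rV[R]_k) :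
  c *m (\matrix_i phi (u i)) = phi (\sum_i c ord0 i *: u i).
Proof.
rewrite linear_sum mulmx_sum_row; apply: eq_bigr => i _.
by rewrite linearZ rowK.
Qed.

(** The injection bounds the dimension of V by n: the square matrix of the images of n independent
    vectors is invertible. *)
Lemma free_spans (u : 'I_n -> V) : injective phi ->
  (forall c : 'I_n -> R, \sum_i c i *: u i = 0 -> forall i, c i = 0) ->
  forall v, exists c : 'I_n -> R, v = \sum_i c i *: u i.
Proof.
move=> inj free v; set A := \matrix_i phi (u i).
have rf : row_free A.
  apply: inj_row_free => c; rewrite mul_row_comb => /eqP.
  rewrite -(linear0 phi) => /eqP/inj/free H; apply/rowP => i.
  by rewrite H linear0 mxE.
have /submxP[c cE] : (phi v <= A)%MS by apply: submx_full; rewrite row_full_unit -row_free_unit.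
exists (c ord0); apply: inj; rewrite cE; exact: mul_row_comb.
Qed.

Lemma not_spans k (u : 'I_k -> V) : (k < n)%N -> (forall r, exists v, phi v = r) ->
  exists v, forall c : 'I_k -> R, v <> \sum_i c i *: u i.
Proof.
move=> kn surj; apply/not_existsP => H.
pose A := \matrix_i phi (u i).
have : row_full A.
  rewrite -sub1mx; apply/row_subP => i.
  have [v vE] := surj (row i 1%:M).
  have /existsNP[c /contrapT cE] := H v.
  apply/submxP; exists (\row_i c i); rewrite -vE cE mul_row_comb; congr (phi _).
  by apply: eq_bigr => j _; rewrite mxE.
rewrite /row_full => /eqP rA; have := rank_leq_row A; rewrite rA.
by rewrite leqNgt kn.
Qed.

End Dimension.

Section TanIso.
Context {R : realType} {n : nat} {M : manifold R n}.

Lemma Tan_iso (q : M) : exists phi : {linear Tan q -> 'rV[R]_n},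
  injective phi /\ forall r, exists v, phi v = r.
Proof.
have [U [f [E [_ Uq d sp]]]] := local_frame q.
pose F (v : Tan q) : 'rV[R]_n := \row_i v (f i).
have lF : linear F by move=> a u v; apply/rowP => i; rewrite !mxE.
pose isL := GRing.isLinear.Build R (Tan q) 'rV[R]_n _ F lF.
pose phi : {linear Tan q -> 'rV[R]_n} := HB.pack F isL.
exists phi; split.
  move=> u v /rowP uv; rewrite (sp q u Uq) (sp q v Uq); apply: eq_bigr => i _.
  by have := uv i; rewrite !mxE => ->.
move=> r; exists (\sum_i r ord0 i *: vf_at (E i) q); apply/rowP => j.
rewrite mxE sum_TanE (bigD1 j) //= [X in _ * X]d // eqxx mulr1 big1 ?addr0 // => i ij.
by rewrite [X in _ * X]d // (negbTE ij) mulr0.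
Qed.

End TanIso.

Section Lightlike.
Context {R : realType} {n : nat} {N : manifold R n} (L : lightlike N).
Implicit Types (p q : N) (V W X Y : vfield N) (f : Cinf N).
Notation h := (hfun L).
Notation Z := (lZ L).

Lemma hC V W : h V W = h W V.
Proof. by apply: CinfP => q; exact: lh_sym. Qed.

Lemma h_linear f V W Y : h (f *: V + W) Y = f * h V Y + h W Y.
Proof. by apply: CinfP => q; rewrite /= vf_atD vf_atZ lhDl lhZl. Qed.

Lemma hDl V W Y : h (V + W) Y = h V Y + h W Y.
Proof. by have := h_linear 1 V W Y; rewrite scale1r mul1r. Qed.
Lemma h0l Y : h 0 Y = 0.
Proof. by have := h_linear (-1) 0 0 Y; rewrite scaler0 addr0 mulN1r addNr. Qed.
Lemma hZl f V Y : h (f *: V) Y = f * h V Y.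
Proof. by have := h_linear f V 0 Y; rewrite h0l !addr0. Qed.
Lemma hNl V Y : h (- V) Y = - h V Y.
Proof. by rewrite -scaleN1r hZl mulN1r. Qed.
Lemma hBl V W Y : h (V - W) Y = h V Y - h W Y.
Proof. by rewrite hDl hNl. Qed.
Lemma hDr V W Y : h Y (V + W) = h Y V + h Y W.
Proof. by rewrite hC hDl !(hC Y). Qed.
Lemma h0r Y : h Y 0 = 0.
Proof. by rewrite hC h0l. Qed.
Lemma hZr f V Y : h Y (f *: V) = f * h Y V.
Proof. by rewrite hC hZl (hC Y). Qed.
Lemma hNr V Y : h Y (- V) = - h Y V.
Proof. by rewrite hC hNl (hC Y). Qed.
Lemma hBr V W Y : h Y (V - W) = h Y V - h Y W.
Proof. by rewrite hDr hNr. Qed.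

Lemma lh_Z q (w : Tan q) : lh L (vf_at Z q) w = 0.
Proof.
have H := (lh_rad L (vf_at Z q)).2 (ex_intro _ 1 (esym (scale1r _))).
exact: H.
Qed.

Lemma hZ0l V : h Z V = 0. Proof. by apply: CinfP => q; exact: lh_Z. Qed.
Lemma hZ0r V : h V Z = 0. Proof. by rewrite hC hZ0l. Qed.

Lemma lhDr q (u v w : Tan q) : lh L w (u + v) = lh L w u + lh L w v.
Proof. by rewrite lh_sym lhDl !(lh_sym L w). Qed.
Lemma lhZr q a (v w : Tan q) : lh L w (a *: v) = a * lh L w v.
Proof. by rewrite lh_sym lhZl (lh_sym L w). Qed.
Lemma lh_suml q k (v : 'I_k -> Tan q) w : lh L (\sum_i v i) w = \sum_i lh L (v i) w.
Proof.
apply: (big_morph (fun v => lh L v w)); first by move=> ? ?; exact: lhDl.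
by rewrite -(scale0r 0) lhZl mul0r.
Qed.

(** Cauchy-Schwarz argument: if h(v, w) were nonzero, then h(t v + w, t v + w) = 2 t h(v, w) + h(w,
    w), and t is chosen to make this -1. *)
Lemma lh_null q (v : Tan q) : lh L v v = 0 -> exists a, v = a *: vf_at Z q.
Proof.
move=> v0; apply/lh_rad => w; apply/eqP/contraT => vw.
pose t := - (lh L w w + 1) / (2 * lh L v w).
have := lh_ge0 L (t *: v + w).
rewrite lhDl !lhDr !lhZl !lhZr v0 !mulr0 add0r (lh_sym L w v).
suff -> : t * lh L v w + (t * lh L v w + lh L w w) = -1 by rewrite ler0N1.
by rewrite /t; field.
Qed.

End Lightlike.

Section Tau.
Context {R : realType} {m : nat} {N : manifold R m.+1} {L : lightlike N}.
Variable tau : SForm L.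
Implicit Types (p q : N) (V W : vfield N) (X Y : An tau) (f : Cinf N).
Notation h := (hfun L).
Notation Z := (lZ L).
Notation t := (form_app tau).
Notation P := (proj tau).

Lemma An_inj X Y : (X : vfield N) = Y -> X = Y.
Proof. exact: val_inj. Qed.

Lemma tD V W : t (V + W) = t V + t W.
Proof. by have := form_app_linear tau 1 V W; rewrite scale1r mul1r. Qed.
Lemma t0 : t 0 = 0.
Proof. by have := form_app_linear tau (-1) 0 0; rewrite scaler0 addr0 mulN1r addNr. Qed.
Lemma tS f V : t (f *: V) = f * t V.
Proof. by have := form_app_linear tau f V 0; rewrite t0 !addr0. Qed.
Lemma tZ : t Z = 1. Proof. by apply: CinfP => q; exact: sformZ. Qed.
Lemma tAn X : t X = 0. Proof. by case: X => X /= /asboolP. Qed.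

Lemma AnD X Y : (X + Y : An tau) = (X : vfield N) + Y :> vfield N. Proof. by []. Qed.
Lemma AnB X Y : (X - Y : An tau) = (X : vfield N) - Y :> vfield N. Proof. by []. Qed.
Lemma AnZ f X : (f *: X : An tau) = f *: (X : vfield N) :> vfield N. Proof. by []. Qed.
Lemma An0 : (0 : An tau) = 0 :> vfield N. Proof. by []. Qed.
Lemma An_sum k (X : 'I_k -> An tau) : (\sum_i X i : An tau) = \sum_i (X i : vfield N) :> vfield N.
Proof. by apply: (big_morph (fun X : An tau => (X : vfield N))). Qed.

Lemma projE V : P V = V - t V *: Z :> vfield N. Proof. by []. Qed.
Lemma proj_linear f V W : P (f *: V + W) = f *: P V + P W.
Proof.
apply: An_inj; rewrite AnD AnZ !projE tD tS scalerDl scalerBr scalerA opprD.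
by rewrite addrACA.
Qed.
Lemma projAn X : P X = X.
Proof. by apply: An_inj; rewrite projE tAn scale0r subr0. Qed.
Lemma projZ : P Z = 0.
Proof. by apply: An_inj; rewrite projE tZ scale1r subrr. Qed.
Lemma projD V W : P (V + W) = P V + P W.
Proof. by have := proj_linear 1 V W; rewrite !scale1r. Qed.
Lemma proj0 : P 0 = 0.
Proof. by have := proj_linear (-1) 0 0; rewrite scaler0 addr0 scaleN1r addNr. Qed.
Lemma projS f V : P (f *: V) = f *: P V.
Proof. by have := proj_linear f V 0; rewrite proj0 !addr0. Qed.
Lemma projN V : P (- V) = - P V.
Proof. by rewrite -scaleN1r projS scaleN1r. Qed.
Lemma projB V W : P (V - W) = P V - P W.
Proof. by rewrite projD projN. Qed.
Lemma projK V : V = (P V : vfield N) + t V *: Z.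
Proof. by rewrite projE subrK. Qed.
Lemma h_projl V W : h (P V) W = h V W.
Proof. by rewrite projE hBl hZl hZ0l mulr0 subr0. Qed.
Lemma h_projr V W : h V (P W) = h V W.
Proof. by rewrite hC h_projl hC. Qed.

Lemma tau_An q X : tau q (vf_at X q) = 0.
Proof. by have := congr1 (fun f : Cinf N => f q) (tAn X). Qed.

(** The condition is at one point because elements of [An tau] are global fields, and in general
    they can be orthonormal only near a given point. *)
Definition onat k (e : 'I_k -> An tau) q :=
  forall a b, h (e a) (e b) q = (a == b)%:R.

Lemma tau_linear q a (u v : Tan q) : tau q (a *: u + v) = a * tau q u + tau q v.
Proof. exact: form_linear. Qed.
Lemma tauD q (u v : Tan q) : tau q (u + v) = tau q u + tau q v.
Proof. by have := tau_linear 1 u v; rewrite scale1r mul1r. Qed.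
Lemma tau0 q : tau q 0 = 0.
Proof. by have := @tau_linear q (-1) 0 0; rewrite scaler0 addr0 mulN1r addNr. Qed.
Lemma tauZ q a (u : Tan q) : tau q (a *: u) = a * tau q u.
Proof. by have := tau_linear a u 0; rewrite tau0 !addr0. Qed.
Lemma tau_sum q k (v : 'I_k -> Tan q) : tau q (\sum_i v i) = \sum_i tau q (v i).
Proof. by apply: (big_morph (tau q)); [move=> ? ?; exact: tauD|exact: tau0]. Qed.

Lemma on_coord k (e : 'I_k -> An tau) q (c : 'I_k -> R) b : onat e q ->
  lh L (\sum_a c a *: vf_at (e a) q) (vf_at (e b) q) = c b.
Proof.
move=> on; rewrite lh_suml (bigD1 b) //= lhZl [lh _ _ _](on b b) eqxx mulr1.
rewrite big1 ?addr0 // => a ab.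
by rewrite lhZl [lh _ _ _](on a b) (negbTE ab) mulr0.
Qed.

Definition ztuple k (e : 'I_k -> An tau) q (i : 'I_k.+1) : Tan q :=
  if unlift ord0 i is Some a then vf_at (e a) q else vf_at Z q.

Lemma ztuple_sum k (e : 'I_k -> An tau) q (c : 'I_k.+1 -> R) :
  \sum_i c i *: ztuple e q i =
  c ord0 *: vf_at Z q + \sum_a c (lift ord0 a) *: vf_at (e a) q.
Proof.
rewrite big_ord_recl /ztuple unlift_none; congr (_ + _).
by apply: eq_bigr => a _; rewrite liftK.
Qed.

(** Z and the m vectors of the frame are independent, hence a basis by dimension; tau reads off the
    first coefficient and h the others. *)
Lemma on_span (e : 'I_m -> An tau) q : onat e q -> forall v : Tan q,
  v = tau q v *: vf_at Z q + \sum_a lh L v (vf_at (e a) q) *: vf_at (e a) q.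
Proof.
move=> on v; have [phi [inj _]] := Tan_iso q.
have [c] : exists c : 'I_m.+1 -> R, v = \sum_i c i *: ztuple e q i.
  apply: (free_spans inj) => c; rewrite ztuple_sum => H.
  have cl a : c (lift ord0 a) = 0.
    have := congr1 (fun v => lh L v (vf_at (e a) q)) H.
    rewrite lhDl lhZl lh_Z mulr0 add0r (on_coord (fun a => c (lift ord0 a)) _ on) => ->.
    by rewrite -(scale0r 0) lhZl mul0r.
  have c0 : c ord0 = 0.
    move: H; rewrite big1 => [/eqP|a _]; last by rewrite cl scale0r.
    by rewrite addr0 scaler_eq0 (negbTE (lZ_neq0 L q)) orbF => /eqP.
  by move=> i; case: (unliftP ord0 i) => [a ->|->].
rewrite ztuple_sum => vE.
have E0 : tau q v = c ord0.
  rewrite vE tauD tauZ sformZ mulr1 tau_sum big1 ?addr0 // => a _.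
  by rewrite tauZ tau_An mulr0.
rewrite E0 {1}vE; congr (_ + _); apply: eq_bigr => a _; congr (_ *: _).
by rewrite vE lhDl lhZl lh_Z mulr0 add0r (on_coord (fun a => c (lift ord0 a)) _ on).
Qed.

(** Gram-Schmidt. As k + 1 < m + 1, some tangent vector at p lies outside the span of Z and the
    previous vectors; its orthogonal remainder has positive length at p, hence can be normalized
    near p. *)
Lemma on_exists_k p k : (k <= m)%N ->
  exists e : 'I_k -> An tau, \forall q \near p, onat e q.
Proof.
elim: k => [_|k IH km].
  by exists (fun _ => 0); apply: filterE => q [].
have [e eP] := IH (ltnW km).
have [phi [_ surj]] := Tan_iso p.
have [v Hv] := not_spans (ztuple e p) (km : (k.+1 < m.+1)%N) surj.
have [V VE] := Tan_ext v.
pose S : An tau := \sum_a h V (e a) *: e a.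
have SE : S = \sum_a h V (e a) *: (e a : vfield N) :> vfield N by exact: An_sum.
pose X : An tau := P V - S.
have XE q : vf_at X q = vf_at V q - (tau q (vf_at V q) *: vf_at Z q
     + \sum_a h V (e a) q *: vf_at (e a) q).
  have -> : (X : vfield N) = V - (t V *: Z + \sum_a h V (e a) *: (e a : vfield N)).
    by rewrite -SE opprD addrA.
  rewrite vf_atB vf_atD vf_at_sum vf_atZ; congr (_ - (_ + _)).
  by apply: eq_bigr => a _; rewrite vf_atZ.
(* If X were null at p it would be a multiple of Z there, and v would lie in the excluded span. *)
have Xp : 0 < h X X p.
  rewrite lt_def lh_ge0 andbT; apply/eqP => /lh_null[c cE].
  apply: (Hv (fun i => if unlift ord0 i is Some a then h V (e a) p else tau p v + c)).
  rewrite ztuple_sum unlift_none.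
  have -> : \sum_a (if unlift ord0 (lift ord0 a) is Some a0 then h V (e a0) p else tau p v + c)
     *: vf_at (e a) p = \sum_a h V (e a) p *: vf_at (e a) p.
    by apply: eq_bigr => a _; rewrite liftK.
  have G (a b : Tan p) : v = a + (v - (a + b)) + b by rewrite addrAC [RHS]addrC subrK.
  rewrite scalerDl -cE XE VE; exact: G.
have [g Hg] := invsqrt_germ Xp.
exists (fun i => if unlift ord_max i is Some a then e a else g *: X).
apply: filterS2 eP Hg => q on gq.
have XX a : h X (e a) q = 0.
  rewrite [LHS]/= XE lhDl -scaleN1r lhZl lhDl lhZl lh_Z mulr0 add0r.
  by rewrite (on_coord (fun a => h V (e a) q) _ on) mulN1r subrr.
move=> i j; case: (unliftP ord_max i) => [a ->|->]; case: (unliftP ord_max j) => [b ->|->].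
- by rewrite (inj_eq lift_inj); exact: on.
- by rewrite AnZ hZr CinfME hC XX mulr0 eq_sym (negbTE (neq_lift _ _)).
- by rewrite AnZ hZl CinfME XX mulr0 (negbTE (neq_lift _ _)).
- by rewrite eqxx AnZ hZl hZr !CinfME mulrA -expr2.
Qed.

Lemma on_exists p : exists e : 'I_m -> An tau, \forall q \near p, onat e q.
Proof. exact: on_exists_k. Qed.

End Tau.

(** * Connections on An(tau) *)

Section Conn.
Context {R : realType} {n : nat} {M : manifold R n} {S : lmodType (Cinf M)}.
Variable nabla : vfield M -> S -> S.
Hypothesis Hn : is_connection nabla.
Implicit Types (V W : vfield M) (s u : S) (f : Cinf M).

Lemma nabla_linear f V W s : nabla (f *: V + W) s = f *: nabla V s + nabla W s.
Proof. by have [h _ _] := Hn; exact: h. Qed.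
Lemma nablaD V s u : nabla V (s + u) = nabla V s + nabla V u.
Proof. by have [_ h _] := Hn; exact: h. Qed.
Lemma nablaZ V f s : nabla V (f *: s) = V f *: s + f *: nabla V s.
Proof. by have [_ _ h] := Hn; exact: h. Qed.
Lemma nabla_addV V W s : nabla (V + W) s = nabla V s + nabla W s.
Proof. by have := nabla_linear 1 V W s; rewrite !scale1r. Qed.
Lemma nabla0V s : nabla 0 s = 0.
Proof. by have := nabla_linear (-1) 0 0 s; rewrite scaler0 addr0 scaleN1r addNr. Qed.
Lemma nabla_scaleV f V s : nabla (f *: V) s = f *: nabla V s.
Proof. by have := nabla_linear f V 0 s; rewrite nabla0V !addr0. Qed.
Lemma nabla_oppV V s : nabla (- V) s = - nabla V s.
Proof. by have := nabla_scaleV (-1) V s; rewrite !scaleN1r. Qed.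
Lemma nabla0 V : nabla V 0 = 0.
Proof. by apply: (@addrI _ (nabla V 0)); rewrite -nablaD !addr0. Qed.

Lemma bracketE V W f : bracket V W f = V (W f) - W (V f). Proof. by []. Qed.

Lemma vfieldB V f g : V (f - g) = V f - V g.
Proof.
have h : V (- g) = - V g.
  by apply/eqP; rewrite -addr_eq0 -vfieldD addNr; have := vfield_linear V (-1) 0 0;
     rewrite scaler0 addr0 scaleN1r addNr => ->.
by rewrite vfieldD h.
Qed.

Lemma vfield0 V : V 0 = 0.
Proof. by have := vfieldB V 0 0; rewrite !subrr. Qed.

Lemma bracketC V W : bracket V W = - bracket W V.
Proof. by apply: vfieldP => f; rewrite /= !fctE /= opprB. Qed.

Lemma bracketDl V W U : bracket (V + W) U = bracket V U + bracket W U.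
Proof.
apply: vfieldP => f.
have E : U ((V + W) f) = U (V f) + U (W f) by exact: vfieldD.
by rewrite bracketE E (_ : (V + W) (U f) = V (U f) + W (U f)) // opprD addrACA.
Qed.

Lemma bracketZl f V U : bracket (f *: V) U = f *: bracket V U - U f *: V.
Proof.
apply: vfieldP => g.
have E : U ((f *: V) g) = f * U (V g) + V g * U f by exact: vfield_leibniz.
rewrite bracketE E (_ : (f *: V) (U g) = f * V (U g)) //.
rewrite (_ : (f *: bracket V U - U f *: V) g = f * (V (U g) - U (V g)) - U f * V g) //.
by ring.
Qed.

Lemma curv_skew V W s : curvature nabla V W s = - curvature nabla W V s.
Proof. by rewrite /curvature bracketC nabla_oppV !opprD !opprK [- _ + _]addrC. Qed.

End Conn.

(* Matching is purely syntactic: up to conversion, unification would unfold the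
   module structures of [vfield] and [An]. *)
Ltac vf_eval := repeat match goal with
  | |- context [@vfield_fun ?R ?n ?M (@An_val ?a ?b ?c ?d ?e ?S) ?f] =>
    let S' := constr:(@vfield_fun R n M (@An_val a b c d e S) f) in
    match S with
    | @Algebra.add _ ?X ?Y => change S' with (vfield_fun (@An_val a b c d e X) f + vfield_fun (@An_val a b c d e Y) f)
    | @Algebra.opp _ ?X => change S' with (- vfield_fun (@An_val a b c d e X) f)
    | @GRing.scale _ _ ?g ?X => change S' with (g * vfield_fun (@An_val a b c d e X) f)
    | @Algebra.zero _ => change S' with (0 : Cinf M)
    end
  | |- context [@vfield_fun ?R ?n ?M ?S ?f] =>
    let S' := constr:(@vfield_fun R n M S f) in
    match S with
    | @Algebra.add _ ?X ?Y => change S' with (@vfield_fun R n M X f + @vfield_fun R n M Y f)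
    | @Algebra.opp _ ?X => change S' with (- @vfield_fun R n M X f)
    | @GRing.scale _ _ ?g ?X => change S' with (g * @vfield_fun R n M X f)
    | @Algebra.zero _ => change S' with (0 : Cinf M)
    | @bracket _ _ _ ?X ?Y => change S' with (@vfield_fun R n M X (@vfield_fun R n M Y f) - @vfield_fun R n M Y (@vfield_fun R n M X f))
    end
  end.
Ltac cring := vf_eval; repeat match goal with
  | |- context [@vfield_fun ?R ?n ?M ?X ?f] =>
    let x := fresh "x" in generalize (@vfield_fun R n M X f); intro x
  | |- context [@hfun ?R ?n ?M ?L ?X ?Y] =>
    let x := fresh "x" in generalize (@hfun R n M L X Y); intro x
  | |- context [@form_app ?R ?n ?M ?L ?X ?Y] =>
    let x := fresh "x" in generalize (@form_app R n M L X Y); intro x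
  end; ring.

Section NablaTau.
Context {R : realType} {m : nat} {N : manifold R m.+1} {L : lightlike N}.
Variable tau : SForm L.
Implicit Types (U V W : vfield N) (X Y : An tau) (f g : Cinf N).
Notation h := (hfun L).
Notation Z := (lZ L).
Notation t := (form_app tau).
Notation P := (proj tau).

Lemma AnP X Y : (forall f, X f = Y f) -> X = Y.
Proof. by move=> H; apply: An_inj; exact: vfieldP. Qed.

Section Conn.
Variable nab : vfield N -> An tau -> An tau.
Hypothesis Hc : is_connection nab.

Lemma curv_linear1 f V V' W X : curvature nab (f *: V + V') W X =
  f *: curvature nab V W X + curvature nab V' W X.
Proof.
rewrite /curvature bracketDl bracketZl !(nabla_addV Hc, nabla_scaleV Hc, nabla_oppV Hc).
rewrite (nablaD Hc) (nablaZ Hc); apply: AnP => g; cring.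
Qed.

Lemma curv_linear2 f V V' W X : curvature nab W (f *: V + V') X =
  f *: curvature nab W V X + curvature nab W V' X.
Proof.
rewrite !(curv_skew Hc W) curv_linear1; apply: AnP => g; cring.
Qed.

Lemma curv_linear3 f V W X Y : curvature nab V W (f *: X + Y) =
  f *: curvature nab V W X + curvature nab V W Y.
Proof.
rewrite /curvature !(nablaD Hc, nablaZ Hc); apply: AnP => g; cring.
Qed.

Hypothesis Hm : is_metric nab (fun X Y => h X Y).

Lemma metricE V X Y : V (h X Y) = h (nab V X) Y + h X (nab V Y).
Proof. exact: Hm. Qed.

Lemma curv_metric V W X Y : h (curvature nab V W X) Y + h X (curvature nab V W Y) = 0.
Proof.
have e1 := metricE (bracket V W) X Y; rewrite bracketE !metricE !vfieldD !metricE in e1.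
rewrite /curvature !AnB !hBl !hBr.
move: e1; set a := h (nab V (nab W X)) Y; set b := h (nab W (nab V X)) Y.
set c := h (nab (bracket V W) X) Y; set d := h X (nab (bracket V W) Y).
move=> e1; have -> : c = (c + d) - d by ring.
by rewrite -e1; ring.
Qed.

End Conn.

Section Tors.
Variable nab : vfield N -> An tau -> An tau.
Hypothesis Hn : is_nabla_tau nab.

Let Hc : is_connection nab. Proof. by case: Hn. Qed.
Let Hm : is_metric nab (fun X Y => h X Y). Proof. by case: Hn. Qed.

Lemma nabZ X : nab Z X = X + P (bracket Z X).
Proof. by case: Hn. Qed.
Lemma nabXY X Y : P (bracket X Y) = nab X Y - nab Y X.
Proof. by have [_ _ _ /(_ X Y) /subr0_eq] := Hn. Qed.

Lemma bracket_split (X Y : vfield N) f g : bracket (X + f *: Z) (Y + g *: Z) =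
  bracket X Y + f *: bracket Z Y - g *: bracket Z X
  + (X g + f * Z g - Y f - g * Z f) *: Z.
Proof.
apply: vfieldP => u; vf_eval; rewrite !vfieldD !vfield_leibniz; cring.
Qed.

Lemma torsion_split X Y f g :
  nab ((X : vfield N) + f *: Z) Y - nab ((Y : vfield N) + g *: Z) X
    - P (bracket ((X : vfield N) + f *: Z) ((Y : vfield N) + g *: Z))
  = f *: Y - g *: X.
Proof.
rewrite bracket_split !projD projN !projS projZ scaler0 addr0.
rewrite !(nabla_addV Hc, nabla_scaleV Hc) nabXY !nabZ.
apply: AnP => u; cring.
Qed.

(** The rule for nabla_Z and torsion-freeness on An tau combine into one identity for arbitrary
    fields, since P kills the derivatives of coefficients that arise along Z. It is the An-component
    of condition (1). *)
Lemma torsion U V : nab U (P V) - nab V (P U) - P (bracket U V) = t U *: P V - t V *: P U.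
Proof. by have := torsion_split (P U) (P V) (t U) (t V); rewrite -!projK. Qed.

End Tors.

(** A vector orthogonal to everything is a multiple of Z, and tau, which vanishes on X, makes that
    multiple zero. *)
Lemma An_at0 q X : (forall Y, h X Y q = 0) -> vf_at X q = 0.
Proof.
move=> H; have /(lh_rad L)[a aE] : forall w, lh L (vf_at X q) w = 0.
  move=> w; have [W <-] := Tan_ext w.
  by have := H (P W); rewrite h_projr.
have := tau_An q X; rewrite aE tauZ sformZ mulr1 => ->.
by rewrite scale0r.
Qed.

Lemma An_at_inj X Y : (forall q, vf_at X q = vf_at Y q) -> X = Y.
Proof. by move=> H; apply: An_inj; exact: vfield_at. Qed.

Lemma An_eqP X Y : (forall W, h X W = h Y W) -> X = Y.
Proof.
move=> H; apply: An_at_inj => q; apply/subr0_eq; rewrite -vf_atB.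
apply: (An_at0 (X := X - Y)) => W.
by rewrite AnB hBl H subrr.
Qed.

Lemma nab_split nab : is_connection nab -> forall V X,
  nab V X = nab (P V) X + t V *: nab Z X.
Proof.
move=> c V X; rewrite {1}(projK tau V) (nabla_addV c) (nabla_scaleV c).
by [].
Qed.

Lemma An_eq_An X Y : (forall W : An tau, h X W = h Y W) -> X = Y.
Proof. by move=> H; apply: An_eqP => W; rewrite -(h_projr tau) H h_projr. Qed.

(** On An tau the difference of the two connections gives a trilinear form that is symmetric in two
    arguments and skew in another two, hence zero. In the direction Z both are prescribed. *)
Lemma koszul (nab1 nab2 : vfield N -> An tau -> An tau) :
  is_nabla_tau nab1 -> is_nabla_tau nab2 -> forall V X, nab1 V X = nab2 V X.
Proof.
move=> H1 H2; have [c1 m1 z1 _] := H1; have [c2 m2 z2 _] := H2.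
pose A V X : An tau := nab1 V X - nab2 V X.
have Asym X Y : A X Y = A Y X.
  apply/eqP; rewrite -subr_eq0; apply/eqP; rewrite /A.
  have := nabXY H1 X Y; rewrite (nabXY H2 X Y) => E.
  have -> : nab1 X Y - nab2 X Y - (nab1 Y X - nab2 Y X) =
    (nab1 X Y - nab1 Y X) - (nab2 X Y - nab2 Y X) by apply: AnP => f; cring.
  by rewrite E subrr.
have Askew V X Y : h (A V X) Y = - h (A V Y) X.
  have := metricE m1 V X Y; rewrite (metricE m2) => E.
  apply/eqP; rewrite -addr_eq0 /A !AnB !hBl !(hC L _ X) .
  apply/eqP; transitivity ((h (nab1 V X) Y + h X (nab1 V Y)) - (h (nab2 V X) Y + h X (nab2 V Y))).
    by ring.
  by rewrite E subrr.
have A0 X Y : A X Y = 0.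
  apply: An_eq_An => W; rewrite h0l.
  have E : h (A X Y) W = - h (A X Y) W.
    by rewrite [LHS](Askew X Y W) (Asym X W) (Askew W X Y) opprK (Asym W Y) (Askew Y W X) (Asym Y X).
  apply: CinfP => q; have := congr1 (fun f : Cinf N => f q) E.
  rewrite CinfNE => /eqP; rewrite -subr_eq0 opprK -mulr2n mulrn_eq0 /= => /eqP.
  by [].
move=> V X; rewrite (nab_split c1) (nab_split c2) z1 z2.
by rewrite (subr0_eq (A0 (P V) X)).
Qed.

Section Model.
Variable (nab : vfield N -> An tau -> An tau) (B : vfield N -> An tau).

(* [mod_nab V S a] and [mod_nab_eta V S a] are the components of
   nabla_V (Phi S + a eta), where eta is the null section with h(eta, xi) = 1
   orthogonal to Phi(An tau), [nab] is the connection induced on An tau and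
   [B V] is the An-component of nabla_V eta. *)
Definition mod_nab V (S : vfield N) (a : Cinf N) : vfield N :=
  (V (t S) - h S (B V)) *: Z + t S *: V + nab V (P S) + a *: (B V : vfield N).
Definition mod_nab_eta V (S : vfield N) (a : Cinf N) : Cinf N :=
  V a - a * t V - h S V.

(* The An-component of R(U, V) Phi X for [mod_nab]; see [proj_mod_curv]. *)
Definition curvK U V X : An tau :=
  curvature nab U V X - h X (B V) *: P U - h X V *: B U + h X (B U) *: P V + h X U *: B V.

Lemma proj_mod_nab V S a : P (mod_nab V S a) = t S *: P V + nab V (P S) + a *: B V.
Proof. by rewrite /mod_nab !projD !projS projZ scaler0 add0r !projAn. Qed.

Lemma t_mod_nab V S a : t (mod_nab V S a) = V (t S) - h S (B V) + t S * t V.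
Proof. by rewrite /mod_nab !tD !tS tZ !tAn mulr0 !addr0 mulr1. Qed.

Definition mod_curv U V S a : vfield N :=
  mod_nab U (mod_nab V S a) (mod_nab_eta V S a)
  - mod_nab V (mod_nab U S a) (mod_nab_eta U S a) - mod_nab (bracket U V) S a.
Definition mod_curv_eta U V S a : Cinf N :=
  mod_nab_eta U (mod_nab V S a) (mod_nab_eta V S a)
  - mod_nab_eta V (mod_nab U S a) (mod_nab_eta U S a) - mod_nab_eta (bracket U V) S a.

Hypothesis Hn : is_nabla_tau nab.
Let Hc : is_connection nab. Proof. by case: Hn. Qed.
Let Hm : is_metric nab (fun X Y => h X Y). Proof. by case: Hn. Qed.

(** The terms carrying t S add up to t S times the identity [torsion], so only P S survives. *)
Lemma proj_mod_curv U V S : P (mod_curv U V S 0) = curvK U V (P S).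
Proof.
rewrite /mod_curv !projB !proj_mod_nab !t_mod_nab !(nablaD Hc, nablaZ Hc).
rewrite /mod_nab_eta !vfield0 !mul0r !subr0 !sub0r.
have T := torsion Hn U V.
have -> : P (bracket U V) = nab U (P V) - nab V (P U) - (t U *: P V - t V *: P U).
  by rewrite -T; apply: AnP => f; cring.
rewrite /curvK /curvature !h_projl.
apply: AnP => f; cring.
Qed.

(** The reason is h(R(U, V) Phi S, xi) = - h(Phi S, R(U, V) xi), where R(U, V) xi is collinear with
    xi. The computation pairs the identity [torsion] with S. *)
Lemma eta_mod_curv U V S : mod_curv_eta U V S 0 = 0.
Proof.
have E (W S' Y : vfield N) : h (mod_nab W S' 0) Y = t S' * h W Y + h (nab W (P S')) Y.
  rewrite /mod_nab !hDl !hZl hZ0l; ring.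
rewrite /mod_curv_eta /mod_nab_eta !vfield0 !mul0r !subr0 !sub0r !E.
have N1 (W : vfield N) g : W (- g) = - W g by rewrite -[- g]sub0r vfieldB vfield0 sub0r.
rewrite ?N1.
have M1 W W' : W (h S W') = h (nab W (P S)) W' + h S (nab W (P W')).
  by rewrite -(h_projl tau S W') -(h_projr tau (P S) W') (metricE Hm) h_projr (h_projl tau S).
rewrite !M1.
have T := congr1 (fun X : An tau => h S X) (torsion Hn U V).
rewrite /= !(AnB, AnZ, hBr, hZr, h_projr, hZ0r, mulr0, subr0) in T.
have -> : h S (bracket U V) = h S (nab U (P V)) - h S (nab V (P U)) - (t U * h S V - t V * h S U).
  by rewrite -T; ring.
by rewrite (hC L V U); ring.
Qed.

Lemma curvK_Z U V : P (mod_curv U V Z 0) = 0.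
Proof.
rewrite proj_mod_curv projZ /curvK /curvature !(nabla0 Hc) !An0 !h0l !scale0r.
by apply: AnP => f; cring.
Qed.

End Model.

End NablaTau.

(** * Decomposition of a lightlike extension *)

Section Bundle.
Context {R : realType} {n r : nat} {M : manifold R n} (T : vbundle M r).
Implicit Types (p q : M) (s u : section T) (f : Cinf M).

Lemma secD s u p : (s + u) p = s p + u p. Proof. by []. Qed.
Lemma secN s p : (- s) p = - s p.
Proof. by apply/eqP; rewrite -addr_eq0 -secD addNr. Qed.
Lemma secB s u p : (s - u) p = s p - u p. Proof. by rewrite secD secN. Qed.
Lemma secZ f s p : (f *: s) p = f p *: s p. Proof. by []. Qed.
Lemma sec_sum k (s : 'I_k -> section T) p : (\sum_i s i) p = \sum_i s i p.
Proof. by apply: (big_morph (fun s : section T => s p)). Qed.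

Lemma fib_iso p : exists phi : {linear fib T p -> 'rV[R]_r},
  injective phi /\ forall x, exists v, phi v = x.
Proof.
have [i ip] := tdom_cover T p; exists (tmap i p).
have [g gK Kg] := tmap_bij ip; split; first exact: can_inj gK.
by move=> x; exists (g x).
Qed.

Lemma glue_section (s : forall p, fib T p) :
  (forall p, exists u, \forall q \near p, s q = u q) ->
  exists u, forall q, u q = s q.
Proof.
move=> H; have ss : s \in @smooth_section_pred R n M r T.
  apply/asboolP => i k; apply: smooth_on_local => [|p ip]; first exact: tdom_open.
  have [u] := H p; rewrite /prop_near1 nbhsE => -[V [oV Vp] VE].
  exists (tdom i `&` V); first by split=> //; apply: openI => //; exact: tdom_open.
  have oI : open (tdom i `&` V) by apply: openI => //; exact: tdom_open.
  apply: (@smooth_on_ext _ _ _ _ (fun q => tmap i q (u q) ord0 k)) => //.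
    by move=> q /set_mem[_ /VE ->].
  have /asboolP su := valP u.
  by apply: (smooth_onS (tdom_open i) oI _ (su i k)) => q [].
by exists (MkSection ss).
Qed.

Lemma smooth_on_sum (U : set M) k (f : 'I_k -> M -> R) : open U ->
  (forall i, smooth_on U (f i)) -> smooth_on U (fun q => \sum_i f i q).
Proof.
move=> oU sf c ac l; apply: Ck_sum; first exact: open_coord.
by move=> i; exact: sf.
Qed.

Lemma sec_ext p (x : fib T p) : exists s, s p = x.
Proof.
have [i ip] := tdom_cover T p.
have [phi [phi1 phi0]] := bump (tdom_open i) ip.
(* A trivialization is bijective only over its domain; the default 0 elsewhere is harmless because
   phi vanishes there. *)
have inv q : exists g : 'rV[R]_r -> fib T q, tdom i q -> cancel (tmap i q) g /\ cancel g (tmap i q).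
  have [iq|niq] := pselect (tdom i q); last by exists (fun=> 0).
  by have [g gK Kg] := tmap_bij iq; exists g.
pose g q := projT1 (cid (inv q)); have gP q := projT2 (cid (inv q)).
pose s q := phi q *: g q (tmap i p x).
have ss : s \in @smooth_section_pred R n M r T.
  apply/asboolP => j k; apply: smooth_on_local => [|q jq]; first exact: tdom_open.
  have [iq|niq] := pselect (tdom i q); last first.
    have := phi0 q niq; rewrite /prop_near1 nbhsE => -[V [oV Vq] VE].
    exists V => //; apply: (@smooth_on_ext _ _ _ _ (fun=> 0)) => //; last exact: smooth_on_cst.
    by move=> q' /set_mem/VE; rewrite /s => ->; rewrite scale0r linear0 mxE.
  have oI : open (tdom i `&` tdom j) by apply: openI; exact: tdom_open.
  exists (tdom i `&` tdom j) => //.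
  have [A [sA AE]] := tmap_trans i j.
  apply: (@smooth_on_ext _ _ _ _ (fun q => phi q * \sum_l (tmap i p x) ord0 l * A q l k)) => //.
    move=> q' /set_mem[iq' jq']; rewrite /s linearZ mxE; congr (_ * _).
    rewrite AE // mxE; apply: eq_bigr => l _.
    by have [_ ->] := gP q' iq'.
  apply: smooth_on_mul => //; first exact: smooth_on_Cinf.
  apply: smooth_on_sum => // l; apply: smooth_on_mul => //.
  exact: smooth_on_cst.
exists (MkSection ss); rewrite /= /s (nbhs_singleton phi1) scale1r.
exact: (gP p ip).1.
Qed.

End Bundle.

Section Ext.
Context {R : realType} {m : nat} {N : manifold R m.+1} {L : lightlike N}.
Variables (tau : SForm L) (T : lightlike_ext N).
Hypothesis HT : ext_for L T.
Implicit Types (p q : N) (V W S : vfield N) (X Y : An tau) (s u : section T) (f : Cinf N).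
Notation h := (hfun L).
Notation Z := (lZ L).
Notation t := (form_app tau).
Notation P := (proj tau).
Notation xi := (ext_xi T).
Notation D := (@ext_nabla _ _ _ T).

Definition hT s u : Cinf N := mkCinf (ext_h_smooth s u).
Definition Phi V : section T := D V xi.

Lemma PhiE V p : Phi V p = ext_Phi T p (vf_at V p).
Proof. by rewrite ext_PhiE. Qed.

Lemma Phi_linear f V W : Phi (f *: V + W) = f *: Phi V + Phi W.
Proof. exact: (nabla_linear (ext_connection T)). Qed.

Lemma Phi_inj V W : Phi V = Phi W -> V = W.
Proof.
move=> E; apply: vfield_at => q; apply: (@ext_Phi_inj _ _ _ T q).
by rewrite -!PhiE E.
Qed.

Lemma PhiZ : Phi Z = xi.
Proof. by apply: sectionP => p; rewrite PhiE; have [_ ->] := HT. Qed.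

Lemma eh_linear p (a : R) (x y z : fib T p) : ext_h x (a *: y + z) = a * ext_h x y + ext_h x z.
Proof. exact: ext_h_linear. Qed.
Lemma ehDr p (x y z : fib T p) : ext_h x (y + z) = ext_h x y + ext_h x z.
Proof. by have := eh_linear 1 x y z; rewrite scale1r mul1r. Qed.
Lemma eh0r p (x : fib T p) : ext_h x 0 = 0.
Proof. by have := eh_linear (-1) x 0 0; rewrite scaler0 addr0 mulN1r addNr. Qed.
Lemma ehZr p (a : R) (x y : fib T p) : ext_h x (a *: y) = a * ext_h x y.
Proof. by have := eh_linear a x y 0; rewrite eh0r !addr0. Qed.
Lemma ehDl p (x y z : fib T p) : ext_h (y + z) x = ext_h y x + ext_h z x.
Proof. by rewrite ext_h_sym ehDr !(ext_h_sym x). Qed.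
Lemma ehZl p (a : R) (x y : fib T p) : ext_h (a *: y) x = a * ext_h y x.
Proof. by rewrite ext_h_sym ehZr (ext_h_sym x). Qed.
Lemma ehBl p (x y z : fib T p) : ext_h (y - z) x = ext_h y x - ext_h z x.
Proof. by have := ehZl (-1) x z; rewrite scaleN1r mulN1r ehDl => ->. Qed.
Lemma eh0l p (x : fib T p) : ext_h 0 x = 0. Proof. by rewrite ext_h_sym eh0r. Qed.
Lemma eh_suml p k (y : 'I_k -> fib T p) x : ext_h (\sum_i y i) x = \sum_i ext_h (y i) x.
Proof. by apply: (big_morph (fun y => ext_h y x)); [move=> ? ?; exact: ehDl|exact: eh0l]. Qed.

Lemma hTC s u : hT s u = hT u s. Proof. by apply: CinfP => q; exact: ext_h_sym. Qed.
Lemma hTDl s u v : hT (s + u) v = hT s v + hT u v.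
Proof. by apply: CinfP => q; exact: ehDl. Qed.
Lemma hTZl f s u : hT (f *: s) u = f * hT s u.
Proof. by apply: CinfP => q; exact: ehZl. Qed.
Lemma hTDr s u v : hT v (s + u) = hT v s + hT v u.
Proof. by apply: CinfP => q; exact: ehDr. Qed.
Lemma hTZr f s u : hT u (f *: s) = f * hT u s.
Proof. by apply: CinfP => q; exact: ehZr. Qed.
Lemma hT_metric V s u : V (hT s u) = hT (D V s) u + hT s (D V u).
Proof. exact: ext_metric. Qed.
Lemma hT_Phi V W : hT (Phi V) (Phi W) = h V W.
Proof.
apply: CinfP => q; transitivity (ext_h (Phi V q) (Phi W q)); first by [].
by rewrite !PhiE; have [<- _] := HT.
Qed.
Lemma eh_Phi p (v w : Tan p) : ext_h (ext_Phi T p v) (ext_Phi T p w) = lh L v w.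
Proof. by have [-> _] := HT. Qed.
Lemma xi_at p : xi p = ext_Phi T p (vf_at Z p).
Proof. by have [_ ->] := HT. Qed.
Lemma eh_xi_Phi p (v : Tan p) : ext_h (xi p) (ext_Phi T p v) = 0.
Proof. by rewrite xi_at eh_Phi lh_Z. Qed.

(** The orthonormal family is independent and has as many members as the rank, so it is a basis, and
    pairing with it detects every coordinate. *)
Lemma ext_nondeg p (x : fib T p) : (forall y, ext_h x y = 0) -> x = 0.
Proof.
move=> H; have [l lE] := ext_h_lorentz T p; have [phi [inj _]] := fib_iso T p.
have lc (c : 'I_m.+2 -> R) j : ext_h (\sum_i c i *: l i) (l j) =
    c j * (if j == ord0 then -1 else 1).
  rewrite eh_suml (bigD1 j) //= ehZl lE eqxx big1 ?addr0 // => i ij.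
  by rewrite ehZl lE (negbTE ij) mulr0.
have n0 (j : 'I_m.+2) : (if j == ord0 then -1 else 1 : R) != 0.
  by case: ifP => _; rewrite ?oppr_eq0 oner_eq0.
have [c xE] : exists c : 'I_m.+2 -> R, x = \sum_i c i *: l i.
  apply: (free_spans inj) => c cE j.
  by have := lc c j; rewrite cE eh0l => /esym/eqP; rewrite mulf_eq0 (negbTE (n0 j)) orbF => /eqP.
rewrite xE big1 // => j _.
have := H (l j); rewrite xE lc => /eqP; rewrite mulf_eq0 (negbTE (n0 j)) orbF => /eqP ->.
by rewrite scale0r.
Qed.

Definition is_eta p (y : fib T p) := [/\ ext_h y y = 0, ext_h y (xi p) = 1 &
  forall X, ext_h y (Phi X p) = 0].

Lemma eta_Phi p (y : fib T p) (v : Tan p) : is_eta y -> ext_h y (ext_Phi T p v) = tau p v.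
Proof.
move=> [_ y1 yX]; have [V VE] := Tan_ext v.
rewrite -VE -PhiE (projK tau V) (_ : Phi _ = Phi (P V) + t V *: xi); last first.
  by rewrite addrC Phi_linear PhiZ addrC.
by rewrite secD secZ ehDr yX ehZr y1 mulr1 add0r -projK.
Qed.

(** xi and y are a hyperbolic pair orthogonal to the vectors [Phi (e a)], so the coefficient of each
    is the product with the other one. Independence and the count m + 2 give spanning. *)
Lemma fib_span p (y : fib T p) (e : 'I_m -> An tau) : is_eta y -> onat e p ->
  forall x, x = ext_Phi T p (ext_h x y *: vf_at Z p + \sum_a ext_h x (Phi (e a) p) *: vf_at (e a) p)
     + ext_h x (xi p) *: y.
Proof.
move=> ey on x; have [y0 y1 yX] := ey; have [phi [inj _]] := fib_iso T p.
pose w (i : 'I_m.+2) : fib T p :=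
  if unlift ord0 i is Some j then ext_Phi T p (ztuple e p j) else y.
have wsum (c : 'I_m.+2 -> R) : \sum_i c i *: w i = c ord0 *: y +
    ext_Phi T p (c (lift ord0 ord0) *: vf_at Z p + \sum_a c (lift ord0 (lift ord0 a)) *: vf_at (e a) p).
  rewrite big_ord_recl {1}/w unlift_none; congr (_ + _).
  rewrite -(ztuple_sum e p (fun j => c (lift ord0 j))) linear_sum; apply: eq_bigr => j _.
  by rewrite /w liftK linearZ.
have val c x' : x' = \sum_i c i *: w i -> [/\ c ord0 = ext_h x' (xi p),
    c (lift ord0 ord0) = ext_h x' y & forall a, c (lift ord0 (lift ord0 a)) = ext_h x' (Phi (e a) p)].
  rewrite wsum => ->; split.
  - by rewrite ehDl ehZl y1 [X in _ + X]ext_h_sym eh_xi_Phi mulr1 addr0.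
  - rewrite ehDl ehZl y0 [X in _ + X]ext_h_sym (eta_Phi _ ey) tauD tauZ sformZ mulr0 mulr1 add0r.
    by rewrite tau_sum big1 ?addr0 // => a _; rewrite tauZ tau_An mulr0.
  - move=> a; rewrite ehDl ehZl yX mulr0 add0r PhiE eh_Phi lhDl lhZl lh_Z mulr0 add0r.
    by rewrite (on_coord (fun a => c (lift ord0 (lift ord0 a))) _ on).
have [c xE] : exists c : 'I_m.+2 -> R, x = \sum_i c i *: w i.
  apply: (free_spans inj) => c /esym/val[c0 c1 c2] i.
  case: (unliftP ord0 i) => [j ->|->]; last by rewrite c0 eh0l.
  by case: (unliftP ord0 j) => [a ->|->]; rewrite ?c1 ?c2 eh0l.
have [<- <- cc] := val _ _ xE.
rewrite {1}xE wsum addrC; congr (ext_Phi T p (_ + _) + _).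
by apply: eq_bigr => a _; rewrite cc.
Qed.

(** The span formula gives y' = y + c xi, and then h(y', y') = 2 c forces c = 0. *)
Lemma eta_unique p (y y' : fib T p) : is_eta y -> is_eta y' -> y = y'.
Proof.
move=> ey ey'; have [e /nbhs_singleton on] := on_exists tau p.
have [z0 z1 zX] := ey'; have yE := fib_span ey on y'.
have S0 : \sum_a ext_h y' (Phi (e a) p) *: vf_at (e a) p = 0.
  by apply: big1 => a _; rewrite zX scale0r.
move: yE; rewrite S0 addr0 z1 scale1r linearZ_LR -xi_at => yE.
have := z0; rewrite {1}yE ehDl ehZl [ext_h (xi p) y']ext_h_sym z1 [ext_h y y']ext_h_sym => /eqP.
rewrite mulr1 -mulr2n mulrn_eq0 /= => /eqP c0.
by rewrite yE c0 scale0r add0r.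
Qed.

Lemma eta_local p : exists s, \forall q \near p, is_eta (s q).
Proof.
have [e onp] := on_exists tau p.
have [x xn0] : exists x, ext_h (xi p) x != 0.
  apply/not_existsP => H; have /eqP := ext_xi_neq0 T p; apply.
  by apply: ext_nondeg => y; have /negP := H y; rewrite negbK => /eqP.
have [X XE] := sec_ext x; have an0 : hT xi X p != 0 by rewrite /= XE.
have [g gP] := inv_germ an0.
pose X' : section T := g *: X; pose k a := hT X' (Phi (e a)).
(* After removal of the components along [Phi (e a)], subtracting c xi lowers the square by 2 c;
   this c is half of the remaining square. *)
pose c := cst_fun (2^-1) * (hT X' X' - \sum_a k a * k a).
exists (X' - (\sum_a k a *: Phi (e a) + c *: xi)).
apply: filterS2 onp gP => q on gq.
have x1 : ext_h (X' q) (xi q) = 1 by rewrite secZ ehZl [ext_h (X q) _]ext_h_sym.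
have ee a b : ext_h (Phi (e a) q) (Phi (e b) q) = (a == b)%:R by rewrite !PhiE eh_Phi; exact: on.
have ex a : ext_h (Phi (e a) q) (xi q) = 0 by rewrite PhiE ext_h_sym eh_xi_Phi.
set y := (X' - _) q.
have yE z : ext_h y z = ext_h (X' q) z - \sum_a k a q * ext_h (Phi (e a) q) z - c q * ext_h (xi q) z.
  rewrite /y secB ehBl secD ehDl secZ ehZl sec_sum eh_suml opprD addrA.
  by congr (_ - _ - _); apply: eq_bigr => a _; rewrite secZ ehZl.
have y1 : ext_h y (xi q) = 1.
  rewrite yE x1 ext_xi_null mulr0 subr0 big1 ?subr0 // => a _.
  by rewrite ex mulr0.
have ye b : ext_h y (Phi (e b) q) = 0.
  have xe : ext_h (xi q) (Phi (e b) q) = 0 by rewrite ext_h_sym ex.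
  rewrite yE xe mulr0 subr0 (bigD1 b) //= ee eqxx mulr1 big1 ?addr0 ?subrr //.
  by move=> a ab; rewrite ee (negbTE ab) mulr0.
have yX Y : ext_h y (Phi Y q) = 0.
  rewrite PhiE (on_span on (vf_at Y q)) tau_An scale0r add0r linear_sum.
  rewrite ext_h_sym eh_suml big1 // => a _.
  by rewrite linearZ ehZl ext_h_sym -PhiE ye mulr0.
split=> //.
have yx : ext_h (X' q) y = ext_h (X' q) (X' q) - \sum_a k a q * k a q - c q.
  rewrite ext_h_sym yE [ext_h (xi q) _]ext_h_sym x1 mulr1; congr (_ - _ - _).
  by apply: eq_bigr => a _; rewrite [ext_h (Phi _ _) _]ext_h_sym.
have S0 : \sum_a k a q * ext_h (Phi (e a) q) y = 0.
  by apply: big1 => a _; rewrite ext_h_sym ye mulr0.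
rewrite yE yx S0 [ext_h (xi q) y]ext_h_sym y1 mulr1 subr0.
have -> : c q = 2^-1 * (ext_h (X' q) (X' q) - \sum_a k a q * k a q).
  by rewrite CinfME CinfBE Cinf_sumE.
by field.
Qed.

(** By uniqueness the pointwise choice agrees near each point with the smooth local solution. *)
Lemma eta_exists : exists eta : section T, forall q, is_eta (eta q).
Proof.
have H q : exists y : fib T q, is_eta y.
  by have [s /nbhs_singleton] := eta_local q; exists (s q).
have [|eta E] := @glue_section _ _ _ _ T (fun q => projT1 (cid (H q))).
  move=> p; have [s sP] := eta_local p; exists s; apply: filterS sP => q sq.
  by apply: eta_unique (projT2 (cid (H q))) sq.
by exists eta => q; rewrite E; exact: (projT2 (cid (H q))).
Qed.

Section Eta.
Variable eta : section T.
Hypothesis Heta : forall q, is_eta (eta q).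

Lemma hT_Phi_xi V : hT (Phi V) xi = 0.
Proof. by rewrite -PhiZ hT_Phi hZ0r. Qed.
Lemma hT_eta_xi : hT eta xi = 1.
Proof. by apply: CinfP => q; have [_ h1 _] := Heta q. Qed.
Lemma hT_eta_eta : hT eta eta = 0.
Proof. by apply: CinfP => q; have [h0 _ _] := Heta q. Qed.
Lemma hT_eta_Phi V : hT eta (Phi V) = t V.
Proof.
apply: CinfP => q; transitivity (ext_h (eta q) (Phi V q)); first by [].
by rewrite PhiE (eta_Phi _ (Heta q)).
Qed.

Lemma decomp s : exists V, s = Phi V + hT s xi *: eta.
Proof.
have H q : exists v : Tan q, s q = ext_Phi T q v + ext_h (s q) (xi q) *: eta q.
  have [e /nbhs_singleton on] := on_exists tau q.
  by eexists; exact: (fib_span (Heta q) on (s q)).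
have [|V VE] := @glue_vfield _ _ _ (fun q => projT1 (cid (H q))).
  move=> p; have [e onp] := on_exists tau p.
  exists (hT s eta *: Z + \sum_a hT s (Phi (e a)) *: (e a : vfield N)).
  apply: filterS onp => q on; apply: (@ext_Phi_inj _ _ _ T q).
  apply: (@addIr _ (ext_h (s q) (xi q) *: eta q)).
  rewrite -(projT2 (cid (H q))) {1}(fib_span (Heta q) on (s q)).
  congr (ext_Phi T q _ + _); rewrite vf_atD vf_atZ vf_at_sum; congr (_ + _).
  by apply: eq_bigr => a _; rewrite vf_atZ.
exists V; apply: sectionP => q; rewrite secD secZ PhiE VE.
exact: (projT2 (cid (H q))).
Qed.

Definition Psi s : vfield N := projT1 (cid (decomp s)).
Definition Geta V f : section T := Phi V + f *: eta.

Lemma PsiE s : s = Geta (Psi s) (hT s xi).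
Proof. exact: (projT2 (cid (decomp s))). Qed.

Lemma PhiD V W : Phi (V + W) = Phi V + Phi W.
Proof. by have := Phi_linear 1 V W; rewrite !scale1r. Qed.
Lemma Phi0 : Phi 0 = 0.
Proof. by have := Phi_linear (-1) 0 0; rewrite scaler0 addr0 scaleN1r addNr. Qed.
Lemma PhiS f V : Phi (f *: V) = f *: Phi V.
Proof. by have := Phi_linear f V 0; rewrite Phi0 !addr0. Qed.

Lemma GetaD V W f g : Geta V f + Geta W g = Geta (V + W) (f + g).
Proof. by rewrite /Geta PhiD scalerDl addrACA. Qed.
Lemma GetaZ f V g : f *: Geta V g = Geta (f *: V) (f * g).
Proof. by rewrite /Geta PhiS scalerDr scalerA. Qed.
Lemma GetaN V f : - Geta V f = Geta (- V) (- f).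
Proof. by have := GetaZ (-1) V f; rewrite !scaleN1r mulN1r. Qed.
Lemma Geta_Phi V : Phi V = Geta V 0.
Proof. by rewrite /Geta scale0r addr0. Qed.
Lemma Geta_xi : xi = Geta Z 0.
Proof. by rewrite -Geta_Phi PhiZ. Qed.
Lemma Geta_eta : eta = Geta 0 1.
Proof. by rewrite /Geta Phi0 scale1r add0r. Qed.

Lemma hT_Geta V f W g : hT (Geta V f) (Geta W g) = h V W + f * t W + g * t V.
Proof.
rewrite /Geta hTDl !hTDr !hTZl !hTZr hT_Phi hT_eta_eta hT_eta_Phi [hT (Phi V) eta]hTC hT_eta_Phi.
ring.
Qed.

Lemma Geta_inj V f W g : Geta V f = Geta W g -> V = W /\ f = g.
Proof.
move=> E; have fg : f = g.
  have := congr1 (fun s => hT s xi) E; rewrite /= Geta_xi !hT_Geta !hZ0r tZ !mul0r !mulr1.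
  by rewrite !addr0 !add0r.
by split=> //; apply: Phi_inj; move: E; rewrite /Geta fg => /addIr.
Qed.

Definition Enab V X : An tau := P (Psi (D V (Phi X))).
Definition EB V : An tau := P (Psi (D V eta)).

(** Differentiating h(eta, xi) = 1 and h(eta, eta) = 0 fixes the components along eta and Z; only
    the An-component [EB] is free. *)
Lemma D_eta V : D V eta = Geta (EB V) (- t V).
Proof.
have e1 : hT (D V eta) xi = - t V.
  have := hT_metric V eta xi; rewrite hT_eta_xi -[D V xi]/(Phi V) hT_eta_Phi.
  have -> : V 1 = 0.
    have := vfield_leibniz V 1 1; rewrite !mulr1 mul1r => h1.
    by apply: (@addrI _ (V 1)); rewrite addr0 -h1.
  by move/esym/eqP; rewrite addr_eq0 => /eqP.
have e2 : hT (D V eta) eta = 0.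
  have := hT_metric V eta eta; rewrite hT_eta_eta vfield0 [hT eta _]hTC => E.
  by apply: CinfP => q; have /eqP := congr1 (fun f : Cinf N => f q) E;
     rewrite CinfDE eq_sym -mulr2n mulrn_eq0 /= => /eqP.
have := PsiE (D V eta); rewrite e1 => E; rewrite {1}E.
congr (Geta _ _); rewrite [LHS](projK tau).
have E2 : hT (Geta (Psi (D V eta)) (- t V)) (Geta 0 1) = 0 by rewrite -Geta_eta -E.
move: E2; rewrite hT_Geta h0r t0 mulr0 mul1r !add0r => ->.
by rewrite scale0r addr0.
Qed.

(** Here the relations differentiated are h(Phi X, xi) = 0 and h(Phi X, eta) = 0; the second brings
    in [EB] through [D_eta]. *)
Lemma D_Phi V X : D V (Phi X) = Geta ((Enab V X : vfield N) - h X (EB V) *: Z) (- h X V).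
Proof.
have e1 : hT (D V (Phi X)) xi = - h X V.
  have := hT_metric V (Phi X) xi; rewrite hT_Phi_xi vfield0 -[D V xi]/(Phi V) hT_Phi.
  by move/esym/eqP; rewrite addr_eq0 => /eqP.
have e2 : hT (D V (Phi X)) eta = - h X (EB V).
  have := hT_metric V (Phi X) eta; rewrite [hT _ eta]hTC hT_eta_Phi tAn vfield0 D_eta.
  have -> : hT (Phi X) (Geta (EB V) (- t V)) = h X (EB V).
    by rewrite Geta_Phi hT_Geta !tAn !(mul0r, mulr0, addr0).
  by move/esym/eqP; rewrite addr_eq0 => /eqP.
have := PsiE (D V (Phi X)); rewrite e1 => E; rewrite {1}E.
congr (Geta _ _); rewrite [LHS](projK tau).
have E2 : hT (Geta (Psi (D V (Phi X))) (- h X V)) (Geta 0 1) = - h X (EB V).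
  by rewrite -Geta_eta -E.
move: E2; rewrite hT_Geta h0r t0 mulr0 mul1r !add0r => ->.
by rewrite scaleNr.
Qed.

Lemma D_modeled V S f : D V (Geta S f) =
  Geta (mod_nab Enab EB V S f) (mod_nab_eta tau V S f).
Proof.
have c := ext_connection T.
have exi : D V xi = Geta V 0 by exact: Geta_Phi.
rewrite {1}/Geta {1}(projK tau S) PhiD PhiS PhiZ !(nablaD c, nablaZ c) D_Phi D_eta.
rewrite exi [X in V (t S) *: X]Geta_xi [X in V f *: X]Geta_eta !(GetaZ, GetaD).
congr (Geta _ _); rewrite /mod_nab /mod_nab_eta !h_projl; last by ring.
apply: vfieldP => g; cring.
Qed.

Lemma EB_linear f V W : EB (f *: V + W) = f *: EB V + EB W.
Proof.
have := D_eta (f *: V + W); rewrite (nabla_linear (ext_connection T)) !D_eta GetaZ GetaD.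
by move=> /Geta_inj[E _]; apply: An_inj; rewrite -E.
Qed.

Lemma Enab_connection : is_connection Enab.
Proof.
have c := ext_connection T.
split.
- move=> f V W X; have := D_Phi (f *: V + W) X.
  rewrite (nabla_linear c) !D_Phi GetaZ GetaD => /Geta_inj[E _].
  have := congr1 P E.
  by rewrite !(projD, projN, projS, projZ, projAn, scaler0, oppr0, addr0).
- move=> V X Y; have := D_Phi V (X + Y).
  rewrite PhiD (nablaD c) !D_Phi GetaD => /Geta_inj[E _].
  have := congr1 P E.
  by rewrite !(projD, projN, projS, projZ, projAn, scaler0, oppr0, addr0).
- move=> V f X; have := D_Phi V (f *: X).
  rewrite PhiS (nablaZ c) {1}Geta_Phi !D_Phi !GetaZ GetaD => /Geta_inj[E _].
  have := congr1 P E.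
  by rewrite !(projD, projN, projS, projZ, projAn, scaler0, oppr0, addr0).
Qed.

Lemma Enab_metric : is_metric Enab (fun X Y => h X Y).
Proof.
move=> V X Y; rewrite -hT_Phi hT_metric !D_Phi !Geta_Phi !hT_Geta !tAn.
by rewrite !hBl !hBr !hZl !hZr !hZ0l !hZ0r !(mulr0, mul0r, addr0, subr0).
Qed.

Lemma collinear_Geta V f : collinear_xi (Geta V f) <-> P V = 0 /\ f = 0.
Proof.
split=> [[c cE]|[PV ->]]; last first.
  exists (t V) => q; rewrite -Geta_Phi (projK tau V) PV add0r PhiS PhiZ secZ.
  by rewrite tS tZ mulr1.
have f0 : f = 0.
  apply: CinfP => q; have : hT (Geta V f) xi q = c q * ext_h (xi q) (xi q).
    by rewrite -ehZl -cE.
  by rewrite ext_xi_null mulr0 Geta_xi hT_Geta hZ0r tZ mul0r mulr1 add0r addr0.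
split=> //; apply: An_at_inj => q; rewrite vf_at0.
have : vf_at V q = c q *: vf_at Z q.
  apply: (@ext_Phi_inj _ _ _ T q); rewrite linearZ_LR -xi_at -PhiE -cE f0.
  by rewrite -Geta_Phi.
move=> VE; rewrite projE vf_atB vf_atZ (_ : t V q = tau q (vf_at V q)) // VE.
by rewrite tauZ sformZ mulr1 subrr.
Qed.

(** The An-component of R(V, W) xi is a torsion expression. For V = Z and W in An tau it gives the
    rule for nabla_Z, for both in An tau it gives torsion-freeness. *)
Lemma Enab_is_nabla : curv_xi_collinear T -> is_nabla_tau Enab.
Proof.
move=> H.
have K V W : t W *: P V + Enab V (P W) - (t V *: P W + Enab W (P V)) - P (bracket V W) = 0.
  have := H V W; rewrite /ext_curv /curvature -![D _ xi]/(Phi _).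
  rewrite (Geta_Phi V) (Geta_Phi W) (Geta_Phi (bracket _ _)) !D_modeled !GetaN !GetaD.
  move=> /collinear_Geta[E _]; move: E; rewrite 2!projB !proj_mod_nab !scale0r !addr0.
  by [].
split; first exact: Enab_connection.
- exact: Enab_metric.
- move=> X; have := K Z X; rewrite tAn tZ projZ projAn (nabla0 Enab_connection).
  rewrite scale0r scale1r add0r addr0 => E.
  by apply/eqP; rewrite -subr_eq0 opprD addrA E.
- move=> X Y; have := K X Y; rewrite !tAn !projAn !scale0r !add0r.
  by [].
Qed.

End Eta.

End Ext.

(** * The curvature conditions *)

Section Trace.
Context {K : fieldType} {V : lmodType K}.

Definition comb k l (b : 'I_k -> V) (A : 'M[K]_(k, l)) (j : 'I_l) : V :=
  \sum_i A i j *: b i.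

Lemma comb_mul k l r (b : 'I_k -> V) (A : 'M[K]_(k, l)) (C : 'M[K]_(l, r)) j :
  comb (comb b A) C j = comb b (A *m C) j.
Proof.
rewrite /comb; under eq_bigr do rewrite scaler_sumr.
rewrite exchange_big /=; apply: eq_bigr => i _; rewrite mxE scaler_suml.
by apply: eq_bigr => l' _; rewrite scalerA mulrC.
Qed.

Lemma basis_coord k l (b : 'I_k -> V) (v : 'I_l -> V) : is_basis b ->
  exists A : 'M[K]_(k, l), forall j, v j = comb b A j.
Proof.
move=> bb; exists (\matrix_(i, j) projT1 (cid (bb (v j))) i) => j.
have [H _] := projT2 (cid (bb (v j))).
rewrite {1}H; apply: eq_bigr => i _; by rewrite mxE.
Qed.

Lemma basis_comb_inj k l (b : 'I_k -> V) (A C : 'M[K]_(k, l)) : is_basis b ->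
  (forall j, comb b A j = comb b C j) -> A = C.
Proof.
move=> bb AC; apply/matrixP => i j.
have [c [_ cu]] := bb (comb b A j).
have e1 := cu (fun i => A i j) erefl; have e2 := cu (fun i => C i j) (AC j).
have E : (fun i => A i j) = (fun i => C i j) by rewrite -e1 -e2.
exact: (congr1 (fun f => f i) E).
Qed.

Lemma linear_comb (f : V -> V) k l (b : 'I_k -> V) (A : 'M[K]_(k, l)) j : linear f ->
  f (comb b A j) = comb (f \o b) A j.
Proof.
move=> lf; have f0 : f 0 = 0.
  by have := lf (-1) 0 0; rewrite scaler0 addr0 scaleN1r addNr.
have fZ a u : f (a *: u) = a *: f u by have := lf a u 0; rewrite f0 !addr0.
have fD u v : f (u + v) = f u + f v by have := lf 1 u v; rewrite !scale1r.
rewrite /comb (big_morph f fD f0); apply: eq_bigr => i _; exact: fZ.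
Qed.

(* [is_trace] quantifies the basis existentially; any other gives the same trace. *)
Lemma is_trace_basis (f : V -> V) t k (e : 'I_k -> V) (C : 'M[K]_k) :
  is_trace f t -> is_basis e -> (forall j, f (e j) = comb e C j) -> t = \tr C.
Proof.
move=> [lf [l [b [A [bb fb ->]]]]] be fe.
have [P PE] := basis_coord e bb; have [Q QE] := basis_coord b be.
have PQ : P *m Q = 1%:M.
  apply: (basis_comb_inj bb) => j; rewrite -comb_mul.
  rewrite (_ : comb (comb b P) Q j = b j); last first.
    by rewrite QE /comb; apply: eq_bigr => i _; rewrite [in RHS]PE.
  rewrite /comb (bigD1 j) //= mxE eqxx scale1r big1 ?addr0 // => i ij.
  by rewrite mxE (negbTE ij) scale0r.
have -> : C = Q *m (A *m P).
  apply: (basis_comb_inj be) => j; rewrite -fe PE linear_comb //.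
  transitivity (comb (comb b A) P j).
    by apply: eq_bigr => i _; rewrite /= fb.
  rewrite comb_mul -[RHS]comb_mul /comb; apply: eq_bigr => i _.
  by rewrite [in LHS]QE.
by rewrite mxtrace_mulC -mulmxA PQ mulmx1.
Qed.

End Trace.

Section Conditions.
Context {R : realType} {m : nat} {N : manifold R m.+1} {L : lightlike N}.
Variables (tau : SForm L).
Implicit Types (p q : N) (U V W S : vfield N) (X Y : An tau) (f : Cinf N).
Notation h := (hfun L).
Notation Z := (lZ L).
Notation t := (form_app tau).
Notation P := (proj tau).

Section Screen.
Variable q : N.

Lemma cls_Z (c : R) : cls L (c *: vf_at Z q) = 0.
Proof.
have c0 : cls L (0 : Tan q) = 0 by apply: (@addrI _ (cls L (0 : Tan q))); rewrite -clsD !addr0.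
by rewrite -c0; apply/cls_eq => u; rewrite subr0 lhZl lh_Z mulr0.
Qed.

Lemma cls_sum k (v : 'I_k -> Tan q) : cls L (\sum_i v i) = \sum_i cls L (v i).
Proof.
apply: (big_morph (@cls _ _ _ L q)); first by move=> ? ?; exact: clsD.
by have := cls_Z 0; rewrite scale0r.
Qed.

Lemma cls_scale a (v : Tan q) : cls L (a *: v) = a *: cls L v.
Proof. exact: clsZ. Qed.

Lemma cls_vfZ U V : cls L (vf_at U q) = cls L (vf_at V q) ->
  exists c, vf_at (U - V - cst_fun c *: Z) q = 0.
Proof.
move=> /cls_eq/(lh_rad L)[c cE]; exists c.
by rewrite 2!vf_atB vf_atZ cE subrr.
Qed.

Lemma cls_proj V : cls L (vf_at (P V) q) = cls L (vf_at V q).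
Proof.
apply/cls_eq => u; rewrite -vf_atB.
have -> : (P V : vfield N) - V = - t V *: Z.
  by rewrite projE addrAC subrr add0r scaleNr.
by rewrite vf_atZ lhZl lh_Z mulr0.
Qed.

Definition sframe (e : 'I_m -> An tau) (a : 'I_m) : screen L q := cls L (vf_at (e a) q).

Lemma sframe_expand (e : 'I_m -> An tau) : onat e q -> forall v : Tan q,
  cls L v = \sum_a lh L v (vf_at (e a) q) *: sframe e a.
Proof.
move=> on v; rewrite {1}(on_span on v) clsD cls_Z add0r cls_sum.
by apply: eq_bigr => a _; rewrite cls_scale.
Qed.

Lemma sframe_basis (e : 'I_m -> An tau) : onat e q -> is_basis (sframe e).
Proof.
move=> on x; have vE := cls_repr x; set v := repr x in vE.
exists (fun a => lh L v (vf_at (e a) q)); split.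
  by rewrite -{1}vE; exact: sframe_expand.
move=> c cE; apply/funext => a.
have E : cls L v = cls L (\sum_a c a *: vf_at (e a) q).
  by rewrite vE cE cls_sum; apply: eq_bigr => b _; rewrite cls_scale.
have := congr1 (fun y => screen_metric y (cls L (vf_at (e a) q))) E.
by rewrite !screen_metricE (on_coord _ _ on).
Qed.

End Screen.

Section Model.
Variables (nab : vfield N -> An tau -> An tau) (B : vfield N -> An tau).
Hypothesis Hn : is_nabla_tau nab.
Hypothesis HB : forall f V W, B (f *: V + W) = f *: B V + B W.

Let Hc : is_connection nab. Proof. by case: Hn. Qed.
Let Hm : is_metric nab (fun X Y => h X Y). Proof. by case: Hn. Qed.

Notation K := (curvK nab B).

Lemma curvK_skew U V X : K U V X = - K V U X.
Proof. rewrite /curvK (curv_skew Hc); apply: AnP => g; cring. Qed.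

Lemma curvK_linear1 V X f U U' : K (f *: U + U') V X = f *: K U V X + K U' V X.
Proof.
rewrite /curvK (curv_linear1 Hc) HB proj_linear AnD AnZ hDr hZr hDr hZr.
by apply: AnP => g; cring.
Qed.

Lemma curvK_linear2 U X f V V' : K U (f *: V + V') X = f *: K U V X + K U V' X.
Proof. by rewrite curvK_skew curvK_linear1 !(curvK_skew U); apply: AnP => g; cring. Qed.

Lemma curvK_linear3 U V f X Y : K U V (f *: X + Y) = f *: K U V X + K U V Y.
Proof.
rewrite /curvK (curv_linear3 Hc) AnD AnZ !hDl !hZl.
by apply: AnP => g; cring.
Qed.

(** For U = Z the terms with P Z and h(X, Z) drop out, leaving the equation for D = B Z. Both sides
    vanish at V = Z, so fields V in An tau suffice. *)
Lemma curvK_Z_iff : (forall V X, K Z V X = 0) <->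
  (forall X Y, h X Y *: B Z - h Y (B Z) *: X = curvature nab Z X Y).
Proof.
split=> [H X Y|H V X].
  have := H X Y; rewrite /curvK projZ scaler0 hZ0r scale0r addr0 subr0 projAn hC => E.
  apply/eqP; rewrite -subr_eq0 -opprB oppr_eq0; apply/eqP; rewrite -E.
  by apply: AnP => g; cring.
rewrite /curvK projZ scaler0 hZ0r scale0r addr0 subr0.
have -> : curvature nab Z V X = curvature nab Z (P V) X.
  have c0 : curvature nab Z Z X = 0.
    rewrite /curvature (_ : bracket Z Z = 0); first by rewrite (nabla0V Hc) subrr subr0.
    by apply: vfieldP => g; rewrite bracketE subrr.
  by rewrite {1}(projK tau V) addrC (curv_linear2 Hc) c0 scaler0 add0r.
rewrite -H h_projl hC; apply: AnP => g; cring.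
Qed.

(* Condition (3), read off on frames of An tau orthonormal at [q]. *)
Definition ricci_curvK_zero := forall q (e : 'I_m -> An tau), onat e q -> forall V X,
  \sum_a h (K (e a) V X) (e a) q = 0.

Variable T : lightlike_ext N.
Hypothesis HT : ext_for L T.
Variable eta : section T.
Hypothesis Heta : forall q, is_eta tau (eta q).
Hypothesis HD : forall V S f, ext_nabla V (Geta eta S f) =
  Geta eta (mod_nab nab B V S f) (mod_nab_eta tau V S f).

Lemma ext_curv_Phi U V W : ext_curv U V (Phi T W) = Geta eta (mod_curv nab B U V W 0) 0.
Proof.
rewrite (Geta_Phi eta) /ext_curv /curvature !HD !GetaN !GetaD.
by rewrite -[RHS](congr1 (Geta eta _) (eta_mod_curv B Hn U V W)).
Qed.

Lemma modeled_curv_xi : curv_xi_collinear T.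
Proof.
move=> V W; rewrite -(PhiZ HT) ext_curv_Phi.
by apply/(collinear_Geta HT Heta); split=> //; exact: curvK_Z.
Qed.

Lemma modeled_curv_Z : curv_Z_collinear L T <-> forall V X, K Z V X = 0.
Proof.
split=> H.
  move=> V X; have := H V X; rewrite -[ext_nabla _ _]/(Phi T X) ext_curv_Phi.
  move=> /(collinear_Geta HT Heta)[+ _].
  by rewrite (proj_mod_curv B Hn) projAn.
move=> V W; rewrite -[ext_nabla _ _]/(Phi T W) ext_curv_Phi.
by apply/(collinear_Geta HT Heta); split=> //; rewrite (proj_mod_curv B Hn).
Qed.

(** As [ext_Phi] is injective, the preimage can only be the value of [mod_curv], and its class is
    that of its An-component. *)
Lemma is_calW_iff calW : is_calW T calW <-> forall U V W p,
  calW p (cls L (vf_at U p)) (cls L (vf_at V p)) (cls L (vf_at W p)) =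
  cls L (vf_at (K U V (P W)) p).
Proof.
have E U V W p : ext_Phi T p (vf_at (mod_curv nab B U V W 0) p) =
   ext_curv U V (ext_nabla W (ext_xi T)) p.
  by rewrite -[ext_nabla W _]/(Phi T W) ext_curv_Phi -Geta_Phi PhiE.
split=> H U V W p; last first.
  exists (vf_at (mod_curv nab B U V W 0) p); first exact: E.
  by rewrite H -(proj_mod_curv B Hn) cls_proj.
have [x xE ->] := H U V W p.
rewrite -(proj_mod_curv B Hn) cls_proj; congr (cls L _).
by apply: (@ext_Phi_inj _ _ _ T p); rewrite E.
Qed.

Hypothesis KZ : forall V X, K Z V X = 0.

Let ev q (X : An tau) : Tan q := vf_at X q.
Let evL q f X Y : ev q (f *: X + Y) = f q *: ev q X + ev q Y.
Proof. exact: vf_at_linear. Qed.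

(* By (2) the An-component of the curvature kills [lZ L], so it descends to E. *)
Lemma tensor_screen (F : vfield N -> An tau) q U V :
  (forall f U V, F (f *: U + V) = f *: F U + F V) -> F Z = 0 ->
  cls L (vf_at U q) = cls L (vf_at V q) -> vf_at (F U) q = vf_at (F V) q.
Proof.
move=> FL FZ /cls_vfZ[c cE].
have := tensorial (evL q) FL cE; rewrite /ev.
have -> : U - V - cst_fun c *: Z = (-1) *: V + (- cst_fun c *: Z + U).
  by apply: vfieldP => g; cring.
rewrite !FL FZ scaler0 add0r addrC scaleN1r => E.
by apply/subr0_eq; rewrite -vf_atB -E.
Qed.

Lemma curvK_screen q U V W U' V' W' :
  cls L (vf_at U q) = cls L (vf_at U' q) ->
  cls L (vf_at V q) = cls L (vf_at V' q) ->
  cls L (vf_at W q) = cls L (vf_at W' q) ->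
  vf_at (K U V (P W)) q = vf_at (K U' V' (P W')) q.
Proof.
move=> uu vv ww; transitivity (vf_at (K U' V (P W)) q).
  by apply: (@tensor_screen (fun U => K U V (P W))) => // *; exact: curvK_linear1.
transitivity (vf_at (K U' V' (P W)) q).
  apply: (@tensor_screen (fun V => K U' V (P W))) => // *; first exact: curvK_linear2.
  by rewrite curvK_skew KZ oppr0.
apply: (@tensor_screen (fun W => K U' V' (P W))) => // [f A C|].
  by rewrite proj_linear curvK_linear3.
by rewrite projZ; have := curvK_linear3 U' V' (-1) 0 0;
   rewrite scaler0 addr0 scaleN1r addNr.
Qed.

Lemma trace_K calW (Hcal : is_calW T calW) q (e : 'I_m -> An tau) V X : onat e q ->
  forall b, calW q (sframe q e b) (cls L (vf_at V q)) (cls L (vf_at X q)) =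
  comb (sframe q e) (\matrix_(a, b) (h (K (e b) V X) (e a) q)) b.
Proof.
move=> on b; have /is_calW_iff HK := Hcal; rewrite HK projAn (sframe_expand on).
by apply: eq_bigr => a _; rewrite mxE.
Qed.

Lemma modeled_ricci : ricci_calW_zero L T <-> ricci_curvK_zero.
Proof.
split=> [[calW Hcal tr] q e on V X|H].
  have := is_trace_basis (tr q (cls L (vf_at V q)) (cls L (vf_at X q)))
    (sframe_basis on) (trace_K Hcal V X on).
  move=> E; rewrite [RHS]E /mxtrace; by apply: eq_bigr => a _; rewrite mxE.
(* Each class is represented by a vector field through one of its vectors; by [curvK_screen] the
   choice does not affect [calW]. *)
pose ex q (x : screen L q) : vfield N := projT1 (cid (Tan_ext (repr x))).
have exE q (x : screen L q) : cls L (vf_at (ex q x) q) = x.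
  by rewrite /ex (projT2 (cid (Tan_ext (repr x)))) cls_repr.
pose calW q (x y z : screen L q) := cls L (vf_at (K (ex q x) (ex q y) (P (ex q z))) q).
have Hcal : is_calW T calW.
  by apply/is_calW_iff => U V W p; congr (cls L _); apply: curvK_screen; rewrite exE.
exists calW => // q v w; split.
  move=> c x y; rewrite /calW -cls_scale -clsD; congr (cls L _).
  have -> : c *: vf_at (K (ex q x) (ex q v) (P (ex q w))) q + vf_at (K (ex q y) (ex q v) (P (ex q w))) q =
    vf_at (K (cst_fun c *: ex q x + ex q y) (ex q v) (P (ex q w))) q.
    by rewrite curvK_linear1; symmetry; exact: vf_at_linear.
  apply: curvK_screen => //; rewrite exE vf_atD vf_atZ clsD cls_scale !exE.
  by [].
have [e /nbhs_singleton on] := on_exists tau q.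
exists m, (sframe q e); eexists; split.
- exact: sframe_basis.
- have := trace_K Hcal (ex q v) (P (ex q w)) on.
  rewrite cls_proj !exE; apply.
- rewrite -(H q e on (ex q v) (P (ex q w))) /mxtrace.
  by apply: eq_bigr => a _; rewrite mxE.
Qed.

End Model.

End Conditions.

(** * The model extension on TN + R *)

Section ModelBundle.
Context {R : realType} {m : nat} {N : manifold R m.+1}.
Implicit Types (p q : N) (V W S : vfield N) (f g : Cinf N).

Definition TanR p : lmodType R := (Tan p * R^o)%type.

(* A trivialization of TN + R is a local frame with functions [fcoord] dual to
   it, so that transition matrices are smooth on all of [N]. *)
Record frame_triv := FrameTriv {
  fdom : set N;
  fcoord : 'I_m.+1 -> Cinf N;
  fvec : 'I_m.+1 -> vfield N;
  fdom_open : open fdom;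
  fdual : forall q i j, fdom q -> fvec i (fcoord j) q = (i == j)%:R;
  fspan : forall q (v : Tan q), fdom q -> v = \sum_i v (fcoord i) *: vf_at (fvec i) q
}.

Definition ftmap (i : frame_triv) p (x : TanR p) : 'rV[R]_m.+2 :=
  \row_k (if unlift ord0 k is Some j then x.1 (fcoord i j) else x.2).

Lemma ftmap_linear i p : linear (@ftmap i p).
Proof.
move=> a x y; apply/rowP => k; rewrite !mxE.
by case: (unliftP ord0 k) => [j|] _.
Qed.
HB.instance Definition _ i p := GRing.isLinear.Build R (TanR p) 'rV[R]_m.+2 _
  (@ftmap i p) (@ftmap_linear i p).

Lemma fdom_cover p : exists i, fdom i p.
Proof.
have [U [f [E [oU Up d sp]]]] := local_frame p.
by exists (FrameTriv oU d sp).
Qed.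

Lemma ftmap_bij i p : fdom i p -> bijective (@ftmap i p).
Proof.
move=> ip; exists (fun r : 'rV[R]_m.+2 =>
  (\sum_j r ord0 (lift ord0 j) *: vf_at (fvec i j) p, r ord0 ord0) : TanR p).
  move=> [v a]; rewrite /ftmap; congr (_, _); last by rewrite mxE unlift_none.
  by rewrite [RHS](fspan v ip); apply: eq_bigr => j _; rewrite mxE liftK.
move=> r; apply/rowP => k; rewrite mxE; case: (unliftP ord0 k) => [j ->|->] //=.
rewrite sum_TanE (bigD1 j) //= [X in _ * X](fdual _ _ ip) eqxx mulr1 big1 ?addr0 // => l lj.
by rewrite [X in _ * X](fdual _ _ ip) (negbTE lj) mulr0.
Qed.

Lemma ftmap_trans i j : exists g : N -> 'M[R]_m.+2,
    (forall k l, smooth_on (fdom i `&` fdom j) (fun p => g p k l)) /\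
    (forall p, fdom i p -> fdom j p -> forall x, @ftmap j p x = @ftmap i p x *m g p).
Proof.
pose G k l : Cinf N := match unlift ord0 k, unlift ord0 l with
  | None, None => 1 | Some a, Some b => fvec i a (fcoord j b) | _, _ => 0 end.
exists (fun p => \matrix_(k, l) G k l p); split.
  move=> k l; rewrite (_ : (fun p => _) = G k l); last by apply/funext => p; rewrite mxE.
  by apply: smooth_on_Cinf; apply: openI; exact: fdom_open.
move=> p ip jp x; apply/rowP => l; rewrite !mxE big_ord_recl !mxE /G unlift_none.
case: (unliftP ord0 l) => [b ->|->].
  rewrite mulr0 add0r {1}(fspan x.1 ip) sum_TanE; apply: eq_bigr => a _.
  by rewrite !mxE !liftK.
by rewrite mulr1 big1 ?addr0 // => a _; rewrite !mxE !liftK unlift_none mulr0.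
Qed.

Definition TanR_bundle : vbundle N m.+2 := @VBundle R m.+1 N m.+2 TanR frame_triv fdom
  ftmap fdom_open fdom_cover ftmap_bij ftmap_trans.

Notation sec := (section TanR_bundle).

Lemma pair_smooth V f : (fun q => (vf_at V q, f q) : fib TanR_bundle q)
  \in @smooth_section_pred _ _ _ _ TanR_bundle.
Proof.
apply/asboolP => i k.
pose F : Cinf N := if unlift ord0 k is Some j then V (fcoord i j) else f.
rewrite (_ : (fun q => _) = F); first by apply: smooth_on_Cinf; exact: fdom_open.
by apply/funext => q; rewrite mxE /F; case: (unlift ord0 k).
Qed.
Definition Gsec V f : sec := MkSection (pair_smooth V f).

Lemma sec_pair (s : sec) : exists V f, s = Gsec V f.
Proof.
have /asboolP ss := valP s.
have [f fE] : exists f, forall q, f q = (s q).2.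
  apply: glue_Cinf => p; have [i ip] := fdom_cover p.
  have [f fE] := germ_extend (fdom_open i) ip (ss i ord0).
  by exists f; apply: filterS fE => q ->; rewrite mxE unlift_none.
have [V VE] : exists V, forall q, vf_at V q = (s q).1.
  apply: mk_vfield => g; apply: smooth_near => p; have [i ip] := fdom_cover p.
  have so : smooth_on (fdom i) (fun q => (s q).1 g).
    apply: (@smooth_on_ext R m.+1 N (fdom i) (fun q =>
      \sum_j ftmap i (s q) ord0 (lift ord0 j) * fvec i j g q) (fun q => (s q).1 g));
      first exact: fdom_open.
      move=> q /set_mem iq; rewrite [in RHS](fspan (s q).1 iq) sum_TanE.
      by apply: eq_bigr => j _; rewrite mxE liftK.
    apply: smooth_on_sum => [|j]; first exact: fdom_open.
    apply: smooth_on_mul; first exact: fdom_open.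
      exact: ss.
    by apply: smooth_on_Cinf; exact: fdom_open.
  have [f' fE'] := germ_extend (fdom_open i) ip so.
  by exists f'; [exact: Cinf_smooth|apply: filterS fE' => q ->].
exists V, f; apply: sectionP => q.
by rewrite [LHS]surjective_pairing -VE -fE.
Qed.

Definition sV s : vfield N := projT1 (cid (sec_pair s)).
Definition sf s : Cinf N := projT1 (cid (projT2 (cid (sec_pair s)))).
Lemma sVfK s : Gsec (sV s) (sf s) = s.
Proof. exact: (esym (projT2 (cid (projT2 (cid (sec_pair s)))))). Qed.

Lemma Gsec_inj V W f g : Gsec V f = Gsec W g -> V = W /\ f = g.
Proof.
move=> E; have Eq q := congr1 (fun s : sec => s q) E.
split; [apply: vfield_at|apply: CinfP] => q.
  exact: (congr1 (fun x : Tan q * R^o => x.1) (Eq q)).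
exact: (congr1 (fun x : Tan q * R^o => x.2) (Eq q)).
Qed.

Lemma sV_Gsec V f : sV (Gsec V f) = V.
Proof. by have [] := Gsec_inj (sVfK (Gsec V f)). Qed.
Lemma sf_Gsec V f : sf (Gsec V f) = f.
Proof. by have [] := Gsec_inj (sVfK (Gsec V f)). Qed.

Lemma Gsec_linear f V W g k : f *: Gsec V g + Gsec W k = Gsec (f *: V + W) (f * g + k).
Proof. by apply: sectionP => q; congr (_, _); rewrite vf_at_linear. Qed.
Lemma GsecD V W g k : Gsec V g + Gsec W k = Gsec (V + W) (g + k).
Proof. by apply: sectionP => q; congr (_, _); rewrite vf_atD. Qed.
Lemma GsecZ f V g : f *: Gsec V g = Gsec (f *: V) (f * g).
Proof. by apply: sectionP => q; congr (_, _); rewrite vf_atZ. Qed.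

Context {L : lightlike N}.
Variables (tau : SForm L) (nab : vfield N -> An tau -> An tau) (B : vfield N -> An tau).
Hypothesis Hc : is_connection nab.
Hypothesis Hm : is_metric nab (fun X Y => hfun L X Y).
Hypothesis HB : forall f V W, B (f *: V + W) = f *: B V + B W.
Notation h := (hfun L).
Notation Z := (lZ L).
Notation t := (form_app tau).
Notation P := (proj tau).

(** This is the formula that [hT_Geta] forces in any extension: the summand R is spanned by eta,
    null and paired with TN by tau. *)
Definition mh p (x y : fib TanR_bundle p) : R :=
  lh L x.1 y.1 + x.2 * tau p y.1 + y.2 * tau p x.1.

Lemma mh_sym p (x y : fib TanR_bundle p) : mh x y = mh y x.
Proof. by rewrite /mh lh_sym addrAC. Qed.

Lemma mh_linear p (x : fib TanR_bundle p) : scalar (mh x).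
Proof.
move=> a y z; rewrite /mh /= lhDr lhZr tauD tauZ.
rewrite -[a *: y.2]/(a * y.2); ring.
Qed.

Lemma mh_Gsec V f W g q : mh (Gsec V f q) (Gsec W g q) = (h V W + f * t W + g * t V) q.
Proof. by []. Qed.

Lemma mh_smooth (s u : sec) : smooth (fun q => mh (s q) (u q)).
Proof. rewrite -(sVfK s) -(sVfK u).
exact: (Cinf_smooth (h (sV s) (sV u) + sf s * t (sV u) + sf u * t (sV s))). Qed.

Lemma mh_lorentz p : exists e : 'I_m.+2 -> fib TanR_bundle p,
    forall i j, mh (e i) (e j) =
      if i == j then (if i == ord0 then -1 else 1) else 0.
Proof.
have [e /nbhs_singleton on] := on_exists tau p.
pose z := vf_at Z p; pose e2 (a : 'I_m) : fib TanR_bundle p := (vf_at (e a) p, 0).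
pose z1 (a : R) : fib TanR_bundle p := (z, a).
have h2 a b : mh (e2 a) (e2 b) = (a == b)%:R.
  by rewrite /mh /= [lh _ _ _](on a b) !mul0r !addr0.
have h1 a b : mh (z1 a) (z1 b) = a + b.
  by rewrite /mh /= lh_Z add0r sformZ !mulr1.
have h12 a b : mh (z1 a) (e2 b) = 0.
  by rewrite /mh /= lh_Z add0r tau_An mulr0 mul0r addr0.
have h21 a b : mh (e2 b) (z1 a) = 0 by rewrite mh_sym.
(* The square of Z + a eta is 2 a, so a = -1/2 and a = 1/2 give the timelike vector, placed at index
   0, and one spacelike vector, orthogonal to each other. *)
exists (fun i => if unlift ord0 i is Some j then
    if unlift ord0 j is Some a then e2 a else z1 2^-1 else z1 (- 2^-1)).
have hh : 2^-1 + 2^-1 = 1 :> R by field.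
move=> i j; case: (unliftP ord0 i) => [i' ->|->]; case: (unliftP ord0 j) => [j' ->|->].
- rewrite (inj_eq lift_inj); case: (unliftP ord0 i') => [a ->|->]; case: (unliftP ord0 j') => [b ->|->].
  + by rewrite (inj_eq lift_inj) h2; case: eqP.
  + by rewrite h21 eq_sym (negbTE (neq_lift _ _)).
  + by rewrite h12 (negbTE (neq_lift _ _)).
  + by rewrite eqxx h1 hh.
- rewrite [_ == ord0]eq_sym (negbTE (neq_lift _ _)).
  by case: (unlift ord0 i') => [a|]; rewrite ?h21 // h1 subrr.
- rewrite (negbTE (neq_lift _ _)).
  by case: (unlift ord0 j') => [a|]; rewrite ?h12 // h1 addNr.
- by rewrite eqxx h1 -opprD hh.
Qed.

(** The normal form that [D_modeled] establishes for every extension, now taken as a definition. *)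
Definition mnabla V (s : sec) : sec :=
  Gsec (mod_nab nab B V (sV s) (sf s)) (mod_nab_eta tau V (sV s) (sf s)).

Lemma mnabla_Gsec V S f : mnabla V (Gsec S f) = Gsec (mod_nab nab B V S f) (mod_nab_eta tau V S f).
Proof. by rewrite /mnabla sV_Gsec sf_Gsec. Qed.

Lemma mnabla_connection : is_connection mnabla.
Proof.
split=> [f V W s|V s u|V f s].
- rewrite -(sVfK s) !mnabla_Gsec Gsec_linear; congr Gsec.
    rewrite /mod_nab HB (nabla_linear Hc) !AnD !AnZ !hDr !hZr; apply: vfieldP => g; cring.
  by rewrite /mod_nab_eta !hDr !hZr tD tS; cring.
- rewrite -(sVfK s) -(sVfK u) GsecD !mnabla_Gsec GsecD; congr Gsec.
    by rewrite /mod_nab projD (nablaD Hc) !tD !vfieldD !hDl; apply: vfieldP => g; cring.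
  by rewrite /mod_nab_eta !hDl vfieldD; cring.
- rewrite -(sVfK s) GsecZ !mnabla_Gsec !GsecZ GsecD; congr Gsec.
    rewrite /mod_nab projS (nablaZ Hc) !tS !vfield_leibniz !hZl; apply: vfieldP => g.
    (* The derivative of f appears once with P S, from [nab], and once with t S along Z; together
       they give the Leibniz term on all of S. *)
    have E : sV s g = P (sV s) g + t (sV s) * Z g by rewrite {1}(projK tau (sV s)).
    by vf_eval; rewrite E; cring.
  by rewrite /mod_nab_eta !hZl vfield_leibniz; cring.
Qed.

Lemma mnabla_metric : is_metric mnabla (fun s u => mkCinf (mh_smooth s u)).
Proof.
move=> V s u; rewrite -(sVfK s) -(sVfK u) !mnabla_Gsec.
have E S f S' f' : mkCinf (mh_smooth (Gsec S f) (Gsec S' f')) = h S S' + f * t S' + f' * t S.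
  exact: CinfP.
rewrite !E; set S := sV s; set S' := sV u.
have M1 : V (h S S') = h (nab V (P S)) S' + h S (nab V (P S')).
  by rewrite -(h_projl tau S S') -(h_projr tau (P S) S') (metricE Hm) h_projr (h_projl tau S).
rewrite !vfieldD !vfield_leibniz M1 !t_mod_nab /mod_nab_eta /mod_nab.
rewrite !hDl !hDr !hZl !hZr hZ0l hZ0r.
rewrite (hC L V S') (hC L (B V) S').
by cring.
Qed.

Definition mxi : sec := Gsec Z 0.
Lemma mxi_null p : mh (mxi p) (mxi p) = 0.
Proof. by rewrite mh_Gsec hZ0l !mul0r !addr0. Qed.
Lemma mxi_neq0 p : mxi p != 0.
Proof.
apply/eqP => /(congr1 (fun x : Tan p * R^o => x.1)) /= E.
by have := lZ_neq0 L p; rewrite E eqxx.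
Qed.

Definition mPhi p (v : Tan p) : fib TanR_bundle p := (v, 0).
Lemma mPhi_linear p : linear (@mPhi p).
Proof. by move=> a v w; congr (_, _); rewrite /= scaler0 addr0. Qed.
HB.instance Definition _ p := GRing.isLinear.Build R (Tan p) (fib TanR_bundle p) _
  (@mPhi p) (@mPhi_linear p).

Lemma mnabla_xi W : mnabla W mxi = Gsec W 0.
Proof.
rewrite mnabla_Gsec; congr Gsec.
  rewrite /mod_nab projZ (nabla0 Hc) tZ hZ0l scale1r scale0r An0 !addr0.
  suff -> : W 1 = 0 by rewrite subr0 scale0r add0r.
  apply: (@addrI _ (W 1)); rewrite addr0.
  by have := vfield_leibniz W 1 1; rewrite !mul1r.
by rewrite /mod_nab_eta vfield0 mul0r hZ0l !subr0.
Qed.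

Lemma mPhiE W p : mPhi (vf_at W p) = mnabla W mxi p.
Proof. by rewrite mnabla_xi. Qed.
Lemma mPhi_inj p : injective (@mPhi p).
Proof. by move=> v w []. Qed.

Definition model : lightlike_ext N := @LightlikeExt R m.+1 N TanR_bundle mh
  mh_sym mh_linear mh_smooth mh_lorentz mnabla mnabla_connection mnabla_metric
  mxi mxi_null mxi_neq0 mPhi mPhiE mPhi_inj.

Lemma model_for : ext_for L model.
Proof.
split=> [p v w|p] //.
by rewrite /= /mh /= !mul0r !addr0.
Qed.

Definition meta : section model := Gsec 0 1.

Lemma model_eta q : is_eta tau (meta q).
Proof.
have hz : h 0 0 = 0 by rewrite h0l.
split.
- rewrite [LHS](mh_Gsec 0 1 0 1 q) hz t0 mulr0 !addr0 //.
- by rewrite [LHS](mh_Gsec 0 1 Z 0 q) h0l tZ mul1r mul0r add0r addr0.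
- move=> X; have -> : Phi model X = Gsec X 0 by exact: mnabla_xi.
  by rewrite [LHS](mh_Gsec 0 1 X 0 q) h0l tAn mulr0 mul0r !addr0.
Qed.

Lemma model_Geta S f : Geta meta S f = Gsec S f.
Proof.
rewrite /Geta (_ : Phi model S = Gsec S 0); last exact: mnabla_xi.
by rewrite [_ + _]addrC [LHS]Gsec_linear scaler0 mulr1 addr0 add0r.
Qed.

Lemma model_modeled V S f : ext_nabla V (Geta meta S f) =
  Geta meta (mod_nab nab B V S f) (mod_nab_eta tau V S f).
Proof. by rewrite !model_Geta; exact: mnabla_Gsec. Qed.

End ModelBundle.

(** * Ricci contraction and uniqueness *)

Section Frames.
Context {R : realType} {m : nat} {N : manifold R m.+1} {L : lightlike N}.
Variable tau : SForm L.
Implicit Types (p q : N) (U V W : vfield N) (X Y : An tau) (f : Cinf N).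
Notation h := (hfun L).
Notation Z := (lZ L).
Notation t := (form_app tau).
Notation P := (proj tau).

Section At.
Variables (q : N) (e : 'I_m -> An tau).
Hypothesis on : onat e q.

Lemma frame_expand X : vf_at X q = \sum_a h X (e a) q *: vf_at (e a) q.
Proof. by rewrite [LHS](on_span on) tau_An scale0r add0r. Qed.

Lemma frame_at0 X : (forall b, h X (e b) q = 0) -> vf_at X q = 0.
Proof. by move=> H; rewrite frame_expand big1 // => a _; rewrite H scale0r. Qed.

Lemma h_frame X V : h X V q = \sum_a h X (e a) q * h V (e a) q.
Proof.
rewrite [LHS]/= frame_expand lh_suml; apply: eq_bigr => a _.
by rewrite lhZl lh_sym.
Qed.

Lemma frame_tensor (F : An tau -> vfield N) Y :
  (forall f X Y, F (f *: X + Y) = f *: F X + F Y) ->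
  vf_at (F Y) q = \sum_a h Y (e a) q *: vf_at (F (e a)) q.
Proof.
move=> FL.
have F0 : F 0 = 0 by have := FL (-1) 0 0; rewrite scaler0 addr0 scaleN1r addNr.
have FD X X' : F (X + X') = F X + F X' by have := FL 1 X X'; rewrite !scale1r.
have FZ f X : F (f *: X) = f *: F X by have := FL f X 0; rewrite F0 !addr0.
pose S : An tau := \sum_a h Y (e a) *: e a.
have SE : S = \sum_a h Y (e a) *: (e a : vfield N) :> vfield N by exact: An_sum.
pose X : An tau := (-1) *: S + Y.
have X0 : vf_at X q = 0.
  rewrite (_ : (X : vfield N) = (-1) *: (S : vfield N) + Y) // SE.
  rewrite vf_atD vf_atZ vf_at_sum (frame_expand Y) CinfNE scaleN1r.
  apply/eqP; rewrite addrC subr_eq0; apply/eqP; apply: eq_bigr => a _.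
  by rewrite vf_atZ.
have evL f U V : vf_at (f *: U + V) q = f q *: vf_at U q + vf_at V q by exact: vf_at_linear.
(* [tensorial] concerns maps on all vector fields, so F is extended by precomposition with P. *)
have FPL f U V : F (P (f *: U + V)) = f *: F (P U) + F (P V) by rewrite proj_linear FL.
have := tensorial evL FPL X0; rewrite projAn FL vf_atD vf_atZ CinfNE scaleN1r addrC.
move=> /subr0_eq ->; rewrite (big_morph F FD F0) vf_at_sum.
by apply: eq_bigr => a _; rewrite FZ vf_atZ.
Qed.

End At.

Section Trace.
Variable F : An tau -> An tau -> vfield N.
Hypothesis FL1 : forall f X X' Y, F (f *: X + X') Y = f *: F X Y + F X' Y.
Hypothesis FL2 : forall f X Y Y', F X (f *: Y + Y') = f *: F X Y + F X Y'.

(** The matrix O between two frames orthonormal at q is orthogonal, so the double sum over its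
    entries collapses to the diagonal. *)
Lemma trace_frame_indep q (e e' : 'I_m -> An tau) : onat e q -> onat e' q ->
  \sum_a vf_at (F (e' a) (e' a)) q = \sum_a vf_at (F (e a) (e a)) q.
Proof.
move=> on on'; pose O : 'M[R]_m := \matrix_(b, a) h (e' b) (e a) q.
have OO : O^T *m O = 1%:M.
  apply: mulmx1C; apply/matrixP => b c; rewrite !mxE -on' (h_frame on).
  by apply: eq_bigr => a _; rewrite !mxE.
transitivity (\sum_b \sum_a \sum_c (O b a * O b c) *: vf_at (F (e a) (e c)) q).
  apply: eq_bigr => b _; rewrite (frame_tensor on (F := fun X => F X (e' b))) //.
  apply: eq_bigr => a _; rewrite (frame_tensor on (F := F (e a))) // scaler_sumr.
  by apply: eq_bigr => c _; rewrite scalerA !mxE.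
rewrite exchange_big; apply: eq_bigr => a _; rewrite exchange_big /=.
under eq_bigr => c _ do rewrite -scaler_suml.
have OE c : \sum_b O b a * O b c = (a == c)%:R.
  have := congr1 (fun A : 'M[R]_m => A a c) OO; rewrite !mxE => <-.
  apply: eq_bigr => b _; congr (_ * _); by rewrite [RHS]mxE.
rewrite (bigD1 a) //= OE eqxx scale1r big1 ?addr0 // => c ca.
by rewrite OE eq_sym (negbTE ca) scale0r.
Qed.

(** Independence of the frame allows gluing. Values are vector fields so that one lemma serves both
    the Ricci endomorphism and scalar traces, the latter written as multiples of Z. *)
Lemma trace_exists : exists T : vfield N, forall q (e : 'I_m -> An tau), onat e q ->
  vf_at T q = \sum_a vf_at (F (e a) (e a)) q.
Proof.
have H q : exists e : 'I_m -> An tau, onat e q.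
  by have [e /nbhs_singleton on] := on_exists tau q; exists e.
pose e q := projT1 (cid (H q)); have on q : onat (e q) q := projT2 (cid (H q)).
have [p|T TE] := @glue_vfield _ _ N (fun q => \sum_a vf_at (F (e q a) (e q a)) q).
  have [e' onp] := on_exists tau p; exists (\sum_a F (e' a) (e' a)).
  by apply: filterS onp => q on'; rewrite vf_at_sum; exact: trace_frame_indep.
exists T => q e' on'; rewrite TE; exact: trace_frame_indep.
Qed.

End Trace.

Section Ricci.
Variables (nab : vfield N -> An tau -> An tau) (B : vfield N -> An tau).
Hypothesis Hn : is_nabla_tau nab.
Hypothesis HB : forall f V W, B (f *: V + W) = f *: B V + B W.
Let Hc : is_connection nab. Proof. by case: Hn. Qed.
Let Hm : is_metric nab (fun X Y => h X Y). Proof. by case: Hn. Qed.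
Notation K := (curvK nab B).
Notation curv := (curvature nab).

(** The identity contributes - m h(X, B Y), and the two terms contracted through the frame each give
    back h(X, B Y); hence the factor m - 2. *)
Lemma trace_curvK q (e : 'I_m -> An tau) X Y : onat e q ->
  \sum_a h (K (e a) Y X) (e a) q =
  \sum_a h (curv (e a) Y X) (e a) q - (m%:R - 2) * h X (B Y) q
  - h X Y q * \sum_a h (B (e a)) (e a) q.
Proof.
move=> on.
have E a : h (K (e a) Y X) (e a) q = h (curv (e a) Y X) (e a) q - h X (B Y) q
    - h X Y q * h (B (e a)) (e a) q + h X (B (e a)) q * h Y (e a) q
    + h X (e a) q * h (B Y) (e a) q.
  have E : h (K (e a) Y X) (e a) = h (curv (e a) Y X) (e a) - h X (B Y) * h (e a) (e a)
    - h X Y * h (B (e a)) (e a) + h X (B (e a)) * h Y (e a) + h X (e a) * h (B Y) (e a).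
    rewrite (_ : (K (e a) Y X : vfield N) = (curv (e a) Y X : vfield N)
      - h X (B Y) *: (e a : vfield N) - h X Y *: (B (e a) : vfield N)
      + h X (B (e a)) *: (Y : vfield N) + h X (e a) *: (B Y : vfield N)); last first.
      by rewrite /curvK !projAn.
    by rewrite !hDl !hNl !hZl.
  rewrite E; transitivity (h (curv (e a) Y X) (e a) q - h X (B Y) q * h (e a) (e a) q
    - h X Y q * h (B (e a)) (e a) q + h X (B (e a)) q * h Y (e a) q
    + h X (e a) q * h (B Y) (e a) q); first by [].
  by rewrite (on a a) eqxx mulr1.
have G (A1 A2 A3 A4 : 'I_m -> R) c d : \sum_a (A1 a - c - d * A2 a + A3 a + A4 a) =
    \sum_a A1 a - c *+ m - d * (\sum_a A2 a) + \sum_a A3 a + \sum_a A4 a.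
  by rewrite 4!big_split /= !sumrN sumr_const card_ord -mulr_sumr.
under eq_bigr => a _ do rewrite E.
rewrite (G (fun a => h (curv (e a) Y X) (e a) q)) -(h_frame on).
have -> : \sum_a h X (B (e a)) q * h Y (e a) q = h X (B Y) q.
  rewrite (hC L X (B Y)) [RHS]/= (frame_tensor on (F := fun X => B X)); last first.
    by move=> f X' Y'; rewrite AnD AnZ HB.
  rewrite lh_suml; apply: eq_bigr => a _; rewrite lhZl mulrC lh_sym; congr (_ * _).
by rewrite -mulr_natl; ring.
Qed.

Lemma ricci_curvK_zero_An : (forall V X, K Z V X = 0) ->
  (forall q (e : 'I_m -> An tau), onat e q -> forall X Y, \sum_a h (K (e a) Y X) (e a) q = 0) ->
  ricci_curvK_zero nab B.
Proof.
move=> KZ H q e on V X; rewrite -[RHS](H q e on X (P V)); apply: eq_bigr => a _.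
have -> // : K (e a) V X = K (e a) (P V) X.
rewrite {1}(projK tau V) addrC (curvK_linear2 Hn HB) (curvK_skew B Hn _ Z) KZ oppr0 scaler0 add0r.
by [].
Qed.

Lemma ricci_exists : exists Ric : An tau -> An tau,
  (forall f X Y, Ric (f *: X + Y) = f *: Ric X + Ric Y) /\
  forall q (e : 'I_m -> An tau), onat e q -> forall X Y,
    h X (Ric Y) q = \sum_a h (curv (e a) Y X) (e a) q.
Proof.
(* The sign and the order of arguments come from metricity: h(X, - R(e, Y) e) = h(R(e, Y) X, e). *)
have H Y : exists T : An tau, forall q (e : 'I_m -> An tau), onat e q ->
    vf_at T q = \sum_a vf_at (- curv (e a) Y (e a)) q.
  have [|f X X' W|T TE] := @trace_exists (fun X X' => - curv X Y X').
  - move=> f X X' W; rewrite AnD AnZ (curv_linear1 Hc); apply: vfieldP => g; cring.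
  - by rewrite (curv_linear3 Hc); apply: vfieldP => g; cring.
  (* [trace_exists] returns a mere vector field; its tau-component is zero, so projecting changes no
     value. *)
  exists (P T) => q e on; rewrite projE vf_atB vf_atZ -[t T q]/(tau q (vf_at T q)) (TE q e on).
  rewrite tau_sum [X in X *: _]big1 ?scale0r ?subr0 // => a _.
  by rewrite vf_atN -scaleN1r tauZ tau_An mulr0.
pose Ric Y := projT1 (cid (H Y)); have RicE Y := projT2 (cid (H Y)).
exists Ric; split=> [f X Y|q e on X Y].
  apply: An_at_inj => q; have [e /nbhs_singleton on] := on_exists tau q.
  rewrite [RHS]vf_at_linear !(RicE _ q e on) scaler_sumr -big_split.
  apply: eq_bigr => a _.
  have E : - (curv (e a) (f *: X + Y) (e a) : vfield N) =
    f *: (- (curv (e a) X (e a) : vfield N)) + - (curv (e a) Y (e a) : vfield N).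
    have -> : curv (e a) (f *: X + Y : An tau) (e a) = f *: curv (e a) X (e a) + curv (e a) Y (e a).
      exact: curv_linear2.
    by apply: vfieldP => g; cring.
  exact: (etrans (congr1 (vf_at^~ q) E) (vf_at_linear _ _ _ _)).
rewrite hC [LHS]/= (RicE _ q e on) lh_suml; apply: eq_bigr => a _.
have := congr1 (fun f : Cinf N => f q) (curv_metric Hm (e a) Y (e a) X).
rewrite CinfDE vf_atN -scaleN1r lhZl mulN1r [h (e a) _]hC => /eqP; rewrite addrC addr_eq0 => /eqP ->.
by [].
Qed.

End Ricci.

Lemma ricci_shape nab (D : An tau) : (2 < m)%N -> is_nabla_tau nab ->
  (forall X Y, h X Y *: D - h Y D *: X = curvature nab Z X Y) ->
  exists B : vfield N -> An tau, [/\ forall f V W, B (f *: V + W) = f *: B V + B W,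
    forall V X, curvK nab B Z V X = 0 & ricci_curvK_zero nab B].
Proof.
move=> m3 Hn HD; have [Ric [RL RE]] := ricci_exists Hn.
have [|f X X' Y|T TE] := @trace_exists (fun X Y => h (Ric X) Y *: Z).
- by move=> f X X' Y; rewrite RL AnD AnZ hDl hZl; apply: vfieldP => g; cring.
- by rewrite AnD AnZ hDr hZr; apply: vfieldP => g; cring.
pose c : R := (m%:R - 2)^-1.
have m2 : m%:R - 2 != 0 :> R by rewrite subr_eq0 eqr_nat gtn_eqF.
have m1 : m%:R - 1 != 0 :> R by rewrite subr_eq0 (eqr_nat _ m 1) gtn_eqF // ltnW.
(* s is the trace that B must have: tracing the Ricci equation gives ((m - 2) + m) tr B = tr Ric. *)
pose s : Cinf N := cst_fun ((2 * (m%:R - 1))^-1) * t T.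
have sE q (e : 'I_m -> An tau) : onat e q -> \sum_a h (Ric (e a)) (e a) q = 2 * (m%:R - 1) * s q.
  move=> on; rewrite CinfME [cst_fun _ q]/=.
  rewrite mulrA mulfV ?mul1r; last by rewrite mulf_neq0 // pnatr_eq0.
  rewrite -[t T q]/(tau q (vf_at T q)) (TE q e on) tau_sum; apply: eq_bigr => a _.
  by rewrite vf_atZ tauZ sformZ mulr1.
(* On An tau this is, up to sign conventions, the Schouten tensor; it is the
   solution of (m - 2) h(X, B Y) + h(X, Y) tr B = Ric(X, Y). *)
pose B V : An tau := t V *: D + cst_fun c *: (Ric (P V) - s *: P V).
have HB f V W : B (f *: V + W) = f *: B V + B W.
  by rewrite /B proj_linear RL tD tS; apply: AnP => g; cring.
have R0 : Ric 0 = 0 by have := RL (-1) 0 0; rewrite scaler0 addr0 scaleN1r addNr.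
have BZ : B Z = D by rewrite /B projZ R0 tZ scale1r scaler0 subrr scaler0 addr0.
have KZ : forall V X, curvK nab B Z V X = 0 by apply/(curvK_Z_iff B Hn) => X Y; rewrite BZ.
exists B; split=> //; apply: ricci_curvK_zero_An => // q e on X Y.
have BE X' Y' : h X' (B Y') q = c * (h X' (Ric Y') q - s q * h X' Y' q).
  have -> : (B Y' : vfield N) = cst_fun c *: ((Ric Y' : vfield N) - s *: (Y' : vfield N)).
    by rewrite /B projAn tAn scale0r add0r.
  by rewrite hZr hBr hZr.
rewrite (trace_curvK nab HB) // -(RE q e on) BE.
have -> : \sum_a h (B (e a)) (e a) q = s q.
  transitivity (\sum_a c * (h (Ric (e a)) (e a) q - s q)).
    by apply: eq_bigr => a _; rewrite hC BE (on a a) eqxx mulr1 hC.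
  rewrite -mulr_sumr sumrB (sE q e on) sumr_const card_ord -mulr_natl /c.
  by field.
by rewrite /c; field.
Qed.

Section Unique.
Variables (nab : vfield N -> An tau -> An tau) (B1 B2 : vfield N -> An tau).
Hypothesis Hn : is_nabla_tau nab.
Hypothesis HB1 : forall f V W, B1 (f *: V + W) = f *: B1 V + B1 W.
Hypothesis HB2 : forall f V W, B2 (f *: V + W) = f *: B2 V + B2 W.
Hypothesis m3 : (2 < m)%N.

(* Choose X orthogonal to Y: then h(Y, D1 - D2) X = 0. *)
Lemma D_unique (D1 D2 : An tau) :
  (forall X Y, h X Y *: D1 - h Y D1 *: X = h X Y *: D2 - h Y D2 *: X) -> D1 = D2.
Proof.
move=> H; apply: An_at_inj => q; apply/subr0_eq; rewrite -vf_atB.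
have [e /nbhs_singleton on] := on_exists tau q.
apply: (frame_at0 on (X := D1 - D2)) => b.
have [a ab] : exists a : 'I_m, a != b.
  pose a0 : 'I_m := Ordinal (ltnW (ltnW m3)); pose a1 : 'I_m := Ordinal (ltnW m3).
  by have [<-|] := eqVneq a0 b; [exists a1|exists a0].
have E (D : An tau) : h (h (e a) (e b) *: D - h (e b) D *: e a : An tau) (e a) q = - h D (e b) q.
  transitivity (h (h (e a) (e b) *: (D : vfield N) - h (e b) D *: (e a : vfield N)) (e a) q) => //.
  rewrite hBl !hZl.
  transitivity (h (e a) (e b) q * h D (e a) q - h (e b) D q * h (e a) (e a) q) => //.
  by rewrite (on a b) (negbTE ab) mul0r sub0r (on a a) eqxx mulr1 hC.
have := E D1; rewrite H E => /oppr_inj D12.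
by rewrite AnB hBl; transitivity (h D1 (e b) q - h D2 (e b) q) => //; rewrite D12 subrr.
Qed.

(** B Z is settled by [D_unique]. On An tau the difference b satisfies (m - 2) b + (tr b) Id = 0;
    its trace gives 2 (m - 1) tr b = 0, and then b = 0 as m > 2. *)
Lemma B_unique : (forall V X, curvK nab B1 Z V X = 0) -> (forall V X, curvK nab B2 Z V X = 0) ->
  ricci_curvK_zero nab B1 -> ricci_curvK_zero nab B2 -> B1 = B2.
Proof.
move=> K1 K2 T1 T2.
have EZ : B1 Z = B2 Z.
  move/(curvK_Z_iff B1 Hn) : K1 => K1; move/(curvK_Z_iff B2 Hn) : K2 => K2.
  by apply: D_unique => X Y; rewrite K1 K2.
have EX X : B1 X = B2 X.
  apply: An_at_inj => q; apply/subr0_eq; rewrite -vf_atB.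
  have [e /nbhs_singleton on] := on_exists tau q.
  pose b c d : R := h (e c) (B1 (e d)) q - h (e c) (B2 (e d)) q.
  have bE c d : (m%:R - 2) * b c d + (c == d)%:R * \sum_a b a a = 0.
    have := T1 q e on (e d) (e c); have := T2 q e on (e d) (e c).
    rewrite (trace_curvK nab HB1 (e c) (e d) on) (trace_curvK nab HB2 (e c) (e d) on) (on c d) => e2 e1.
    have -> : \sum_a b a a = \sum_a h (B1 (e a)) (e a) q - \sum_a h (B2 (e a)) (e a) q.
      by rewrite -sumrB; apply: eq_bigr => a _; rewrite /b ![h (e a) _]hC.
    have G (s k x1 x2 u t1 t2 : R) : s - k * x1 - u * t1 = 0 -> s - k * x2 - u * t2 = 0 ->
        k * (x1 - x2) + u * (t1 - t2) = 0.
      move=> a1 a2; have -> : k * (x1 - x2) + u * (t1 - t2) =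
        (s - k * x2 - u * t2) - (s - k * x1 - u * t1) by ring.
      by rewrite a1 a2 subrr.
    exact: (G _ _ _ _ _ _ _ e1 e2).
  have tr0 : \sum_a b a a = 0.
    have : \sum_c ((m%:R - 2) * b c c + (c == c)%:R * \sum_a b a a) = 0 by rewrite big1.
    rewrite big_split /= -mulr_sumr; under [X in _ + X]eq_bigr => c _ do rewrite eqxx mul1r.
    rewrite sumr_const card_ord -[X in _ + X]mulr_natl -mulrDl => /eqP; rewrite mulf_eq0 => /orP[/eqP E|/eqP //].
    exfalso; have : (2 : R) < m%:R by rewrite ltr_nat.
    by move: E; move: (m%:R : R) => x; lra.
  have b0 c d : b c d = 0.
    have := bE c d; rewrite tr0 mulr0 addr0 => /eqP; rewrite mulf_eq0 subr_eq0 eqr_nat.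
    by rewrite gtn_eqF //= => /eqP.
  pose BB X : vfield N := B1 X - B2 X.
  have BBL f X' Y : BB (f *: X' + Y) = f *: BB X' + BB Y.
    have E1 : B1 (f *: X' + Y : An tau) = f *: B1 X' + B1 Y by exact: HB1.
    have E2 : B2 (f *: X' + Y : An tau) = f *: B2 X' + B2 Y by exact: HB2.
    by rewrite /BB E1 E2; apply: vfieldP => g; cring.
  rewrite -[vf_at _ _]/(vf_at (BB X) q) (frame_tensor on X BBL) big1 // => a _.
  rewrite [vf_at _ _](frame_at0 on (X := B1 (e a) - B2 (e a))) ?scaler0 // => c.
  rewrite AnB hBl (hC L (B1 _)) (hC L (B2 _)).
  exact: b0.
apply/funext => V; rewrite (projK tau V) addrC HB1 HB2 EZ EX.
by [].
Qed.

End Unique.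
End Frames.

(** * The isomorphism determined by the normal form *)

Section Iso.
Context {R : realType} {m : nat} {N : manifold R m.+1} {L : lightlike N} {tau : SForm L}.
Implicit Types (p q : N) (V W S : vfield N) (f : Cinf N).

Section Decomposition.
Variables (T : lightlike_ext N) (HT : ext_for L T) (eta : section T).
Hypothesis Heta : forall q, is_eta tau (eta q).

Lemma fib_decomp p (x : fib T p) :
  exists v : Tan p, x = ext_Phi T p v + ext_h x (ext_xi T p) *: eta p.
Proof.
have [e /nbhs_singleton on] := on_exists tau p.
by eexists; exact: (fib_span HT (Heta p) on x).
Qed.

Lemma eh_decomp p (v w : Tan p) (a b : R) :
  ext_h (ext_Phi T p v + a *: eta p) (ext_Phi T p w + b *: eta p) =
  lh L v w + a * tau p w + b * tau p v.
Proof.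
have [e0 e1 eX] := Heta p.
rewrite ehDl !ehDr !ehZl !ehZr (eh_Phi HT) e0 (eta_Phi HT _ (Heta p)).
rewrite [ext_h (ext_Phi _ _ _) (eta p)]ext_h_sym (eta_Phi HT _ (Heta p)).
by rewrite !mulr0 addr0 addrAC.
Qed.

Lemma eh_decomp_xi p (v : Tan p) (a : R) :
  ext_h (ext_Phi T p v + a *: eta p) (ext_xi T p) = a.
Proof.
have [_ e1 _] := Heta p.
by rewrite ehDl ehZl e1 mulr1 ext_h_sym (eh_xi_Phi HT) add0r.
Qed.

Definition fib_tan p (x : fib T p) : Tan p := projT1 (cid (fib_decomp x)).

Lemma fib_tanE p (x : fib T p) :
  x = ext_Phi T p (fib_tan x) + ext_h x (ext_xi T p) *: eta p.
Proof. exact: (projT2 (cid (fib_decomp x))). Qed.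

Lemma fib_tan_decomp p (v : Tan p) a : fib_tan (ext_Phi T p v + a *: eta p) = v.
Proof.
have := fib_tanE (ext_Phi T p v + a *: eta p).
by rewrite eh_decomp_xi => /addIr/ext_Phi_inj.
Qed.

End Decomposition.

Variables (T1 T2 : lightlike_ext N) (HT1 : ext_for L T1) (HT2 : ext_for L T2).
Variables (eta1 : section T1) (eta2 : section T2).
Hypotheses (Heta1 : forall q, is_eta tau (eta1 q)) (Heta2 : forall q, is_eta tau (eta2 q)).

Definition transfer p (x : fib T1 p) : fib T2 p :=
  ext_Phi T2 p (fib_tan HT1 Heta1 x) + ext_h x (ext_xi T1 p) *: eta2 p.

Lemma transfer_decomp p (v : Tan p) a :
  transfer (ext_Phi T1 p v + a *: eta1 p) = ext_Phi T2 p v + a *: eta2 p.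
Proof. by rewrite /transfer fib_tan_decomp (eh_decomp_xi HT1 Heta1). Qed.

Lemma transfer_linear p : linear (@transfer p).
Proof.
move=> a x y; rewrite (fib_tanE HT1 Heta1 x) (fib_tanE HT1 Heta1 y).
set v := fib_tan _ _ x; set w := fib_tan _ _ y.
set b := ext_h x _; set c := ext_h y _.
rewrite scalerDr addrACA scalerA -scalerDl -linearZ -linearD !transfer_decomp.
by rewrite linearD linearZ_LR scalerDl scalerDr scalerA addrACA.
Qed.
HB.instance Definition _ p := GRing.isLinear.Build R (fib T1 p) (fib T2 p) _
  (@transfer p) (@transfer_linear p).

Lemma transfer_Geta S f p : Geta eta2 S f p = transfer (Geta eta1 S f p).
Proof. by rewrite !secD !secZ !PhiE transfer_decomp. Qed.

Definition transfer_sec (s : section T1) : section T2 :=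
  Geta eta2 (Psi HT1 Heta1 s) (hT s (ext_xi T1)).

Lemma transfer_secE s p : transfer_sec s p = transfer (s p).
Proof. by rewrite transfer_Geta -PsiE. Qed.

Lemma transfer_sec_Geta S f : transfer_sec (Geta eta1 S f) = Geta eta2 S f.
Proof. by apply: sectionP => p; rewrite transfer_secE -transfer_Geta. Qed.

Lemma transfer_isometry p (x y : fib T1 p) : ext_h (transfer x) (transfer y) = ext_h x y.
Proof.
rewrite (eh_decomp HT2 Heta2) [in RHS](fib_tanE HT1 Heta1 x) [in RHS](fib_tanE HT1 Heta1 y).
by rewrite (eh_decomp HT1 Heta1).
Qed.

End Iso.

(** Sending Phi v + a eta1 to Phi v + a eta2 is an isometry because the metric in these terms
    depends on h and tau alone; equal [Enab] and [EB] make the two normal forms of the connection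
    coincide. *)
Lemma ext_iso_modeled (R : realType) (m : nat) (N : manifold R m.+1) (L : lightlike N)
    (tau : SForm L) (T1 T2 : lightlike_ext N) (HT1 : ext_for L T1) (HT2 : ext_for L T2)
    (eta1 : section T1) (eta2 : section T2)
    (Heta1 : forall q, is_eta tau (eta1 q)) (Heta2 : forall q, is_eta tau (eta2 q)) :
  Enab HT1 Heta1 = Enab HT2 Heta2 -> EB HT1 Heta1 = EB HT2 Heta2 -> ext_iso T1 T2.
Proof.
move=> En Eb.
exists (fun p => transfer HT1 eta2 Heta1 (p := p)), (transfer_sec HT1 eta2 Heta1); split.
- move=> p; exists (transfer HT2 eta1 Heta2 (p := p)) => x.
    by rewrite [x in RHS](fib_tanE HT1 Heta1) /= /transfer fib_tan_decomp (eh_decomp_xi HT2 Heta2).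
  by rewrite [x in RHS](fib_tanE HT2 Heta2) /= /transfer fib_tan_decomp (eh_decomp_xi HT1 Heta1).
- exact: transfer_secE.
- exact: transfer_isometry.
- move=> V s; rewrite (PsiE HT1 Heta1 s) (D_modeled HT1 Heta1) !transfer_sec_Geta.
  by rewrite (D_modeled HT2 Heta2) En Eb.
- by rewrite (Geta_xi HT1 eta1) transfer_sec_Geta -(Geta_xi HT2 eta2).
Qed.

Theorem theorem7p9 (R : realType) (m : nat) (N : manifold R m.+1)
    (L : lightlike N) (A : forall p, {linear screen L p -> screen L p})
    (m_ge3 : (3 <= m)%N)
    (A_Z : is_shape_operator A)
    (A_id : forall p (x : screen L p), A p x = x) :
  (forall T1 T2 : lightlike_ext N,
     [/\ ext_for L T1, curv_xi_collinear T1, curv_Z_collinear L T1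
       & ricci_calW_zero L T1] ->
     [/\ ext_for L T2, curv_xi_collinear T2, curv_Z_collinear L T2
       & ricci_calW_zero L T2] ->
     ext_iso T1 T2) /\
  ((exists T : lightlike_ext N,
      [/\ ext_for L T, curv_xi_collinear T, curv_Z_collinear L T
        & ricci_calW_zero L T]) <->
   (forall tau : SForm L,
      exists2 nabla : vfield N -> An tau -> An tau,
        is_nabla_tau nabla & D_solvable nabla)).
Proof.
(* Without some tau the solvability condition would be vacuous and there would be nothing to build
   an extension from. *)
have [tau0 _] := SForm_exists L.
split=> [T1 T2 [H1 c1 z1 r1] [H2 c2 z2 r2]|]; last split=> [[T [HT c1 z1 r1]] tau|H].
- have [eta1 e1] := eta_exists tau0 H1; have [eta2 e2] := eta_exists tau0 H2.
  have n1 := Enab_is_nabla H1 e1 c1; have n2 := Enab_is_nabla H2 e2 c2.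
  have En : Enab H1 e1 = Enab H2 e2 by apply/funext => V; apply/funext => X; exact: koszul.
  have k1 := (modeled_curv_Z n1 H1 e1 (D_modeled H1 e1)).1 z1.
  have k2 := (modeled_curv_Z n2 H2 e2 (D_modeled H2 e2)).1 z2.
  have t1 := (modeled_ricci n1 (EB_linear H1 e1) (D_modeled H1 e1) k1).1 r1.
  have t2 := (modeled_ricci n2 (EB_linear H2 e2) (D_modeled H2 e2) k2).1 r2.
  apply: (ext_iso_modeled (HT1 := H1) (HT2 := H2) (Heta1 := e1) (Heta2 := e2) En).
  (* Both sets of curvature equations now refer to the same connection, so they differ only in B. *)
  rewrite -En in k2 t2.
  exact: (B_unique n1 (EB_linear H1 e1) (EB_linear H2 e2) m_ge3 k1 k2 t1 t2).
- have [eta e] := eta_exists tau HT; have n := Enab_is_nabla HT e c1.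
  exists (Enab HT e) => //; exists (EB HT e (lZ L)).
  by apply/(curvK_Z_iff _ n); apply/(modeled_curv_Z n HT e (D_modeled HT e)).
- have [nab Hn [D HD]] := H tau0.
  have [B [HB KZ tr]] := ricci_shape m_ge3 Hn HD.
  have [Hc Hm _ _] := Hn.
  have Mf := model_for Hc Hm HB; have Me := model_eta Hc Hm HB.
  have Md := model_modeled Hc Hm HB.
  exists (model Hc Hm HB); split=> //.
  + exact: (modeled_curv_xi Hn Mf Me Md).
  + exact/(modeled_curv_Z Hn Mf Me Md).
  + exact/(modeled_ricci Hn HB Md KZ).
Qed.
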